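(* Each of the following holds. (i) $\mathsf{RCA}_0$ proves: for all sets $X$ and $Z$, if $X$ is $2$-random relative to $Z$, then $X$ is weakly $2$-random relative to $Z$. Hence $\mathsf{RCA}_0\vdash 2\mbox{-}\mathsf{MLR}\to\mathsf{W2R}$. (ii) $\mathsf{RCA}_0$ proves: for all sets $X$ and $Z$, if $X$ is weakly $2$-random relative to $Z$, then $X$ is $1$-random relative to $Z$. Hence $\mathsf{RCA}_0\vdash \mathsf{W2R}\to\mathsf{MLR}$. (iii) $\mathsf{RCA}_0$ proves: for all sets $X$ and $Z$, if $X$ is $1$-random relative to $Z$, then $X$ is computably random relative to $Z$. Hence $\mathsf{RCA}_0\vdash \mathsf{MLR}\to\mathsf{CR}$. (iv) $\mathsf{RCA}_0$ proves: for all sets $X$ and $Z$, if $X$ is computably random relative to $Z$, then $X$ is Schnorr random relative to $Z$. Hence $\mathsf{RCA}_0\vdash \mathsf{CR}\to\mathsf{SR}$.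
   Context: $\mathsf{RCA}_0$ is the theory in the language of second-order arithmetic with axioms: the basic axioms $\mathsf{PA}^-$ of Peano arithmetic (the natural numbers form a discretely ordered commutative semiring with $1$); the $\Sigma^0_1$ induction scheme, i.e. the universal closures of $(\varphi(0)\wedge\forall n(\varphi(n)\to\varphi(n+1)))\to\forall n\,\varphi(n)$ for $\varphi$ a $\Sigma^0_1$ formula; and the $\Delta^0_1$ comprehension scheme, i.e. the universal closures of $\forall n(\varphi(n)\leftrightarrow\psi(n))\to\exists X\forall n(n\in X\leftrightarrow\varphi(n))$ for $\varphi$ a $\Sigma^0_1$ and $\psi$ a $\Pi^0_1$ formula with $X$ not free in $\varphi$. Set parameters are allowed in formulas. All definitions below are made inside $\mathsf{RCA}_0$. $\mathbb{N}$ is the (possibly nonstandard) first-order part. Finite strings, finite sets and rationals are coded as usual; reals are coded by rapidly converging Cauchy sequences of rationals; $\leq_{\mathrm T}$ is Turing reducibility. $2^{<\mathbb{N}}$ is the set of finite binary strings, $|\sigma|$ is the length of $\sigma$, $X\restriction n=\langle X(0),\dots,X(n-1)\rangle$, $\sigma^{\frown}\tau$ is concatenation. For a set $B$ of strings, $X\in[B]$ means some $\sigma\in B$ is an initial segment of $X$. Open sets: A code for a $\mathbf{\Sigma^0_1}$ (open) set $\mathcal U$ is a sequence $(B_i)_{i\in\mathbb{N}}$ of coded finite subsets of $2^{<\mathbb{N}}$; it codes a $\Sigma^{0,Z}_1$ set if $(B_i)_{i\in\mathbb{N}}\leq_{\mathrm T}Z$; a uniform sequence of $\Sigma^{0,Z}_1$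 sets is coded by a double sequence $(B_{n,i})_{n,i\in\mathbb{N}}\leq_{\mathrm T}Z$. $X\in\mathcal U$ means $\exists i\,(X\in[B_i])$. For finite $B\subseteq 2^{<\mathbb{N}}$, $\mu(B)=\sum_{\sigma\in\widehat B}2^{-|\sigma|}$, where $\widehat B$ is the set of $\sigma\in B$ with no proper initial segment in $B$. $\mu(\mathcal U)=\lim_m\mu(\bigcup_{i\leq m}B_i)$ if the limit exists; $\mu(\mathcal U)>r$ means $\exists m\,(\mu(\bigcup_{i\leq m}B_i)>r)$; $\mu(\mathcal U)\leq r$ means $\forall m\,(\mu(\bigcup_{i\leq m}B_i)\leq r)$. $1$-randomness: A Martin-Löf test relative to $Z$ is a uniform sequence $(\mathcal U_n)_{n\in\mathbb{N}}$ of $\Sigma^{0,Z}_1$ sets with $\forall n\,(\mu(\mathcal U_n)\leq 2^{-n})$. $X$ is $1$-random relative to $Z$ if $X\notin\bigcap_n\mathcal U_n$ for every such test. Weak $2$-randomness: A weak $2$-test relative to $Z$ is a uniform sequence $(\mathcal U_n)_{n\in\mathbb{N}}$ of $\Sigma^{0,Z}_1$ sets with $\lim_n\mu(\mathcal U_n)=0$, meaning $\forall k\exists n(\forall m>n)(\mu(\mathcal U_m)\leq 2^{-k})$. $X$ is weakly $2$-random relative to $Z$ if $X\notin\bigcap_n\mathcal U_n$ for every such test. $2$-randomness: A tree is a set of strings closed under initial segments, and $T^n=\{\sigma\in T:|\sigma|=n\}$. A code for a $\Sigma^{0,Z}_2$ set $\mathcal W$ is a sequence $(T_i)_{i\in\mathbb{N}}\leq_{\mathrm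 T}Z$ of subtrees of $2^{<\mathbb{N}}$; a uniform sequence of $\Sigma^{0,Z}_2$ sets is coded by a double sequence $(T_{n,i})_{n,i\in\mathbb{N}}\leq_{\mathrm T}Z$ of such trees. $X\in\mathcal W$ means $\exists i\forall n(X\restriction n\in T_i)$, and for $q\in\mathbb{Q}$, $\mu(\mathcal W)\leq q$ means $\forall i\exists n\,(2^{-n}|\bigcup_{j\leq i}T_j^n|\leq q)$. A $\Sigma^{0,Z}_2$-test is a uniform sequence $(\mathcal W_n)_{n\in\mathbb{N}}$ of $\Sigma^{0,Z}_2$ sets with $\forall n\,(\mu(\mathcal W_n)\leq 2^{-n})$. $X$ is $2$-random relative to $Z$ if $X\notin\bigcap_n\mathcal W_n$ for every $\Sigma^{0,Z}_2$-test. Schnorr randomness: A Schnorr test relative to $Z$ is a Martin-Löf test $(\mathcal U_n)_{n\in\mathbb{N}}$ relative to $Z$ such that additionally the measures exist and $(\mu(\mathcal U_n))_{n\in\mathbb{N}}\leq_{\mathrm T}Z$. $X$ is Schnorr random relative to $Z$ if $X\notin\bigcap_n\mathcal U_n$ for every Schnorr test relative to $Z$. Computable randomness: A supermartingale is a function $S\colon 2^{<\mathbb{N}}\to\mathbb{Q}^{\geq 0}$ with $S(\sigma^{\frown} 0)+S(\sigma^{\frown} 1)\leq 2S(\sigma)$ for all $\sigma$. $S$ succeeds on $X$ if $\forall k\exists n\,(S(X\restriction n)>k)$. $X$ is computably random relative to $Z$ if no supermartingale $S\leq_{\mathrm T}Z$ succeeds on $X$. The principles $2\mbox{-}\mathsf{MLR}$,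 $\mathsf{W2R}$, $\mathsf{MLR}$, $\mathsf{CR}$, $\mathsf{SR}$ are the statements ''for every $Z$ there is an $X$ that is $\mathcal R$ relative to $Z$,'' where $\mathcal R$ is, respectively, $2$-random, weakly $2$-random, $1$-random, computably random, Schnorr random. *)

(* Defs.v *)
(* Second-order arithmetic is embedded deeply: [form] is its syntax with de
   Bruijn indices, [prv] is classical natural deduction, and [proves_from T]
   is derivability from a theory.  Concrete sentences are written with
   parametric higher-order syntax ([pform], whose binders are Rocq functions)
   and translated to [form] by [db]. *)
From Stdlib Require Import List.
Import ListNotations.
Set Implicit Arguments.
Unset Strict Implicit.

Inductive term (V : Type) : Type :=
| tvar (x : V)
| tzero
| tone
| tadd (s t : term V)
| tmul (s t : term V).
Arguments tzero {V}.
Arguments tone {V}.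

Fixpoint tbind {V W : Type} (f : V -> term W) (t : term V) : term W :=
  match t with
  | tvar x => f x
  | tzero => tzero
  | tone => tone
  | tadd s t => tadd (tbind f s) (tbind f t)
  | tmul s t => tmul (tbind f s) (tbind f t)
  end.

(* Number variables and set variables have independent index spaces:
   [fallN] binds index 0 of the former, [fallS] index 0 of the latter.  Equality
   is primitive for numbers only. *)
Inductive form : Type :=
| fbot
| feq (s t : term nat)
| flt (s t : term nat)
| fmem (t : term nat) (X : nat)
| fimp (p q : form)
| fallN (p : form)
| fallS (p : form).

Definition fnot (p : form) : form := fimp p fbot.
Definition fand (p q : form) : form := fnot (fimp p (fnot q)).
Definition fiff (p q : form) : form := fand (fimp p q) (fimp q p).
Definition fexN (p : form) : form := fnot (fallN (fnot p)).
Definition fexS (p : form) : form := fnot (fallS (fnot p)).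

Definition tlift (t : term nat) : term nat := tbind (fun x => tvar (S x)) t.

Definition upN (f : nat -> term nat) (x : nat) : term nat :=
  match x with 0 => tvar 0 | S y => tlift (f y) end.

Definition upS (g : nat -> nat) (X : nat) : nat :=
  match X with 0 => 0 | S Y => S (g Y) end.

Fixpoint fsubst (f : nat -> term nat) (g : nat -> nat) (p : form) : form :=
  match p with
  | fbot => fbot
  | feq s t => feq (tbind f s) (tbind f t)
  | flt s t => flt (tbind f s) (tbind f t)
  | fmem t X => fmem (tbind f t) (g X)
  | fimp p q => fimp (fsubst f g p) (fsubst f g q)
  | fallN p => fallN (fsubst (upN f) g p)
  | fallS p => fallS (fsubst f (upS g) p)
  end.

Definition idS (X : nat) : nat := X.
Definition liftN (p : form) : form := fsubst (fun x => tvar (S x)) idS p.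
Definition liftS (p : form) : form := fsubst (@tvar nat) S p.
Definition instN (p : form) (t : term nat) : form :=
  fsubst (fun x => match x with 0 => t | S y => tvar y end) idS p.
Definition instS (p : form) (X : nat) : form :=
  fsubst (@tvar nat) (fun Y => match Y with 0 => X | S Z => Z end) p.

Inductive prv : list form -> form -> Prop :=
| prv_hyp G p : In p G -> prv G p
| prv_impI G p q : prv (p :: G) q -> prv G (fimp p q)
| prv_impE G p q : prv G (fimp p q) -> prv G p -> prv G q
| prv_raa G p : prv (fnot p :: G) fbot -> prv G p
| prv_allNI G p : prv (map liftN G) p -> prv G (fallN p)
| prv_allNE G p t : prv G (fallN p) -> prv G (instN p t)
| prv_allSI G p : prv (map liftS G) p -> prv G (fallS p)
| prv_allSE G p X : prv G (fallS p) -> prv G (instS p X)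
| prv_eq_refl G t : prv G (feq t t)
| prv_eq_subst G p s t : prv G (feq s t) -> prv G (instN p s) -> prv G (instN p t).

Definition proves_from (T : form -> Prop) (p : form) : Prop :=
  exists G : list form, (forall q, In q G -> T q) /\ prv G p.

Section HigherOrderSyntax.
Context {N S : Type}.

Inductive pform : Type :=
| pbot
| peq (s t : term N)
| plt (s t : term N)
| pmem (t : term N) (X : S)
| pimp (p q : pform)
| pallN (p : N -> pform)
| pallS (p : S -> pform).

Definition pnot (p : pform) : pform := pimp p pbot.
Definition por (p q : pform) : pform := pimp (pnot p) q.
Definition pand (p q : pform) : pform := pnot (pimp p (pnot q)).
Definition piff (p q : pform) : pform := pand (pimp p q) (pimp q p).
Definition ple (s t : term N) : pform := por (plt s t) (peq s t).
Definition allN (p : term N -> pform) : pform := pallN (fun x => p (tvar x)).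
Definition exN (p : term N -> pform) : pform := pnot (allN (fun x => pnot (p x))).
Definition exS (p : S -> pform) : pform := pnot (pallS (fun X => pnot (p X))).
Definition ex1N (p : term N -> pform) : pform :=
  exN (fun x => pand (p x) (allN (fun y => pimp (p y) (peq y x)))).

End HigherOrderSyntax.
Arguments pform : clear implicits.

Definition sentence : Type := forall N S : Type, pform N S.

(* Instantiated at [nat], a variable is the number of binders of its sort that
   were open when it was bound; [db] turns this level into an index. *)
Fixpoint db_at (n s : nat) (p : pform nat nat) : form :=
  let tm := tbind (fun x => tvar (n - S x)) in
  match p with
  | pbot => fbot
  | peq t u => feq (tm t) (tm u)
  | plt t u => flt (tm t) (tm u)
  | pmem t X => fmem (tm t) (s - S X)
  | pimp p q => fimp (db_at n s p) (db_at n s q)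
  | pallN p => fallN (db_at (S n) s (p n))
  | pallS p => fallS (db_at n (S s) (p s))
  end.

Definition db (p : sentence) : form := db_at 0 0 (p nat nat).

Declare Scope l2_scope.
Delimit Scope l2_scope with l2.
Notation "0" := tzero : l2_scope.
Notation "1" := tone : l2_scope.
Notation "s + t" := (tadd s t) : l2_scope.
Notation "s * t" := (tmul s t) : l2_scope.
Notation "s ≡ t" := (peq s t) (at level 70, no associativity) : l2_scope.
Notation "s < t" := (plt s t) : l2_scope.
Notation "s <= t" := (ple s t) : l2_scope.
Notation "t ∈ X" := (pmem t X) (at level 70, no associativity) : l2_scope.
Notation "¬ p" := (pnot p) (at level 75, right associativity) : l2_scope.
Notation "p ∧ q" := (pand p q) (at level 80, right associativity) : l2_scope.
Notation "p ∨ q" := (por p q) (at level 85, right associativity) : l2_scope.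
Notation "p ⟹ q" := (pimp p q) (at level 99, right associativity) : l2_scope.
Notation "p ⟺ q" := (piff p q) (at level 95, no associativity) : l2_scope.
Notation "∀ x .. y , p" := (allN (fun x => .. (allN (fun y => p)) ..))
  (at level 200, x binder, y binder, right associativity) : l2_scope.
Notation "∃ x .. y , p" := (exN (fun x => .. (exN (fun y => p)) ..))
  (at level 200, x binder, y binder, right associativity) : l2_scope.
Notation "∃! x , p" := (ex1N (fun x => p))
  (at level 200, x name, right associativity) : l2_scope.
Notation "∀² X .. Y , p" := (pallS (fun X => .. (pallS (fun Y => p)) ..))
  (at level 200, X binder, Y binder, right associativity) : l2_scope.
Notation "∃² X .. Y , p" := (exS (fun X => .. (exS (fun Y => p)) ..))
  (at level 200, X binder, Y binder, right associativity) : l2_scope.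

Definition PA_minus : list sentence := ([
  fun N S => ∀ x y z, (x + y) + z ≡ x + (y + z);
  fun N S => ∀ x y, x + y ≡ y + x;
  fun N S => ∀ x y z, (x * y) * z ≡ x * (y * z);
  fun N S => ∀ x y, x * y ≡ y * x;
  fun N S => ∀ x y z, x * (y + z) ≡ x * y + x * z;
  fun N S => ∀ x, x + 0 ≡ x;
  fun N S => ∀ x, x * 0 ≡ 0;
  fun N S => ∀ x, x * 1 ≡ x;
  fun N S => ∀ x y z, x < y ⟹ y < z ⟹ x < z;
  fun N S => ∀ x, ¬ x < x;
  fun N S => ∀ x y, x < y ∨ x ≡ y ∨ y < x;
  fun N S => ∀ x y z, x < y ⟹ x + z < y + z;
  fun N S => ∀ x y z, 0 < z ⟹ x < y ⟹ x * z < y * z;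
  fun N S => ∀ x y, x < y ⟹ ∃ z, x + z ≡ y;
  fun N S => 0 < 1;
  fun N S => ∀ x, 0 < x ⟹ 1 <= x;
  fun N S => ∀ x, 0 <= x ])%l2.

Inductive Delta0 : form -> Prop :=
| Delta0_bot : Delta0 fbot
| Delta0_eq s t : Delta0 (feq s t)
| Delta0_lt s t : Delta0 (flt s t)
| Delta0_mem t X : Delta0 (fmem t X)
| Delta0_imp p q : Delta0 p -> Delta0 q -> Delta0 (fimp p q)
| Delta0_all t p : Delta0 p -> Delta0 (fallN (fimp (flt (tvar 0) (tlift t)) p)).

Definition Sigma01 (p : form) : Prop := exists q, Delta0 q /\ p = fexN q.
Definition Pi01 (p : form) : Prop := exists q, Delta0 q /\ p = fallN q.

(* All free number (resp. set) variables of [p] have index below [boundN p]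
   (resp. [boundS p]). *)
Fixpoint tbound (t : term nat) : nat :=
  match t with
  | tvar x => S x
  | tzero | tone => 0
  | tadd s t | tmul s t => Nat.max (tbound s) (tbound t)
  end.

Fixpoint boundN (p : form) : nat :=
  match p with
  | fbot => 0
  | feq s t | flt s t => Nat.max (tbound s) (tbound t)
  | fmem t _ => tbound t
  | fimp p q => Nat.max (boundN p) (boundN q)
  | fallN p => Nat.pred (boundN p)
  | fallS p => boundN p
  end.

Fixpoint boundS (p : form) : nat :=
  match p with
  | fbot | feq _ _ | flt _ _ => 0
  | fmem _ X => S X
  | fimp p q => Nat.max (boundS p) (boundS q)
  | fallN p => boundS p
  | fallS p => Nat.pred (boundS p)
  end.

Definition universal_closure (p : form) : form :=
  Nat.iter (boundN p) fallN (Nat.iter (boundS p) fallS p).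

Definition induction_axiom (p : form) : form :=
  let p_succ :=
    fsubst (fun x => match x with 0 => tadd (tvar 0) tone | S y => tvar (S y) end)
      idS p in
  fimp (fand (instN p tzero) (fallN (fimp p p_succ))) (fallN p).

(* Number variable 0 of [p] and [q] is the argument of the comprehension;
   [liftS] keeps the comprehended set from occurring in [p]. *)
Definition comprehension_axiom (p q : form) : form :=
  fimp (fallN (fiff p q))
       (fexS (fallN (fiff (fmem (tvar 0) 0) (liftS p)))).

Inductive RCA0 : form -> Prop :=
| RCA0_basic p : In p PA_minus -> RCA0 (db p)
| RCA0_induction p : Sigma01 p -> RCA0 (universal_closure (induction_axiom p))
| RCA0_comprehension p q :
    Sigma01 p -> Pi01 q -> RCA0 (universal_closure (comprehension_axiom p q)).

Definition RCA0_proves (p : sentence) : Prop := proves_from RCA0 (db p).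

Section Internal.
Context {N S : Type}.
Local Open Scope l2_scope.
Local Notation tm := (term N).
Local Notation fm := (pform N S).

Fixpoint num (n : nat) : tm :=
  match n with O => 0 | Datatypes.S m => num m + 1 end.

Definition pair (s t : tm) : tm := (s + t) * (s + t) + s.

(* [c = (k,(m,n))] represents [{i < k : m(i+1)+1 divides n}]; a finite set is
   coded by its least representative, so that equal sets have equal codes.
   A finite sequence is the finite set of its pairs (index, value).  Both, and
   [pair], are as in Simpson's "Subsystems of Second Order Arithmetic". *)
Definition fin_mem (i c : tm) : fm :=
  ∃ k m n, c ≡ pair k (pair m n) ∧ i < k ∧ ∃ q, n ≡ q * (m * (i + 1) + 1).

Definition fin_code (c : tm) : fm :=
  ∀ d, d < c ⟹ ¬ ∀ i, fin_mem i d ⟺ fin_mem i c.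

Definition entry (s i a : tm) : fm := fin_mem (pair i a) s.

Definition is_seq (s l : tm) : fm :=
  fin_code s ∧
  (∀ z, fin_mem z s ⟹ ∃ i a, i < l ∧ z ≡ pair i a) ∧
  (∀ i, i < l ⟹ ∃! a, entry s i a).

Definition pow2 (n e : tm) : fm :=
  ∃ s, is_seq s (n + 1) ∧ entry s 0 1 ∧
    (∀ i a, i < n ⟹ entry s i a ⟹ entry s (i + 1) ((1 + 1) * a)) ∧
    entry s n e.

Definition card (c p : tm) : fm :=
  ∃ s, is_seq s p ∧
    (∀ i j a, entry s i a ⟹ entry s j a ⟹ i ≡ j) ∧
    (∀ a, fin_mem a c ⟺ ∃ i, entry s i a).

Definition is_string (s l : tm) : fm :=
  is_seq s l ∧ ∀ i a, entry s i a ⟹ a ≡ 0 ∨ a ≡ 1.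

Definition string (s : tm) : fm := ∃ l, is_string s l.

(* For strings, inclusion of graphs is the initial segment relation. *)
Definition prefix (s t : tm) : fm := ∀ z, fin_mem z s ⟹ fin_mem z t.

Definition snoc (s a t : tm) : fm :=
  ∃ l, is_string s l ∧ is_string t (l + 1) ∧ prefix s t ∧ entry t l a.

Definition restriction (X : S) (n s : tm) : fm :=
  is_string s n ∧ ∀ i, i < n ⟹ (entry s i 1 ⟺ i ∈ X).

(* [Rat a b c] stands for [(a - b) / c], with [0 < c]. *)
Record rat : Type := Rat { rat_pos : tm; rat_neg : tm; rat_den : tm }.

Definition rat_add (u v : rat) : rat :=
  Rat (rat_pos u * rat_den v + rat_pos v * rat_den u)
      (rat_neg u * rat_den v + rat_neg v * rat_den u)
      (rat_den u * rat_den v).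

Definition rat_opp (u : rat) : rat := Rat (rat_neg u) (rat_pos u) (rat_den u).

Definition rat_nat (k : tm) : rat := Rat k 0 1.

Definition rat_le (u v : rat) : fm :=
  rat_pos u * rat_den v + rat_neg v * rat_den u <=
  rat_pos v * rat_den u + rat_neg u * rat_den v.

Definition rat_lt (u v : rat) : fm :=
  rat_pos u * rat_den v + rat_neg v * rat_den u <
  rat_pos v * rat_den u + rat_neg u * rat_den v.

Definition rat_eq (u v : rat) : fm :=
  rat_pos u * rat_den v + rat_neg v * rat_den u ≡
  rat_pos v * rat_den u + rat_neg u * rat_den v.

Definition ex_rat (p : rat -> fm) : fm :=
  ∃ a b c, 0 < c ∧ p (Rat a b c).

(* "[q] is the code of a rational [u], and [p u]" *)
Definition with_rat (q : tm) (p : rat -> fm) : fm :=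
  ex_rat (fun u => q ≡ pair (pair (rat_pos u) (rat_neg u)) (rat_den u) ∧ p u).

(* [p] holds of [2^{-n}] *)
Definition with_exp2_neg (n : tm) (p : rat -> fm) : fm :=
  ∃ e, pow2 n e ∧ p (Rat 1 0 e).

(* Indices of partial recursive functionals with oracle [Z], as pairs
   (tag, arguments):
     (0,k) constant k            (1,0) identity         (2,0) successor
     (3,0) first projection      (4,0) second projection
     (5,0) characteristic function of the oracle
     (6,(a,b))  x |-> (a(x), b(x))
     (7,(a,b))  x |-> a(b(x))
     (8,(a,b))  (u,0) |-> a(u),  (u,n+1) |-> b((u,(n,r))) with r the value at (u,n)
     (9,a)      x |-> least y with a((x,y)) = 0
   [eval_step Z E c x y]: the claim "index c has value y at x" follows by one
   clause from the claims satisfying [E]. *)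
Definition eval_step (Z : S) (E : tm -> tm -> tm -> fm) (c x y : tm) : fm :=
  (∃ k, c ≡ pair (num 0) k ∧ y ≡ k) ∨
  (c ≡ pair (num 1) 0 ∧ y ≡ x) ∨
  (c ≡ pair (num 2) 0 ∧ y ≡ x + 1) ∨
  (c ≡ pair (num 3) 0 ∧ ∃ v, x ≡ pair y v) ∨
  (c ≡ pair (num 4) 0 ∧ ∃ u, x ≡ pair u y) ∨
  (c ≡ pair (num 5) 0 ∧ ((x ∈ Z ∧ y ≡ 1) ∨ (¬ x ∈ Z ∧ y ≡ 0))) ∨
  (∃ a b u v, c ≡ pair (num 6) (pair a b) ∧ E a x u ∧ E b x v ∧ y ≡ pair u v) ∨
  (∃ a b u, c ≡ pair (num 7) (pair a b) ∧ E b x u ∧ E a u y) ∨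
  (∃ a b u n, c ≡ pair (num 8) (pair a b) ∧ x ≡ pair u n ∧
     ((n ≡ 0 ∧ E a u y) ∨
      (∃ m r, n ≡ m + 1 ∧ E c (pair u m) r ∧ E b (pair u (pair m r)) y))) ∨
  (∃ a, c ≡ pair (num 9) a ∧ E a (pair x y) 0 ∧
     ∀ n, n < y ⟹ ∃ v, E a (pair x n) (v + 1)).

(* [d] is a finite sequence of claims, each of which follows from earlier ones,
   and the claim "index e has value y at x" is among them. *)
Definition eval (Z : S) (e x y : tm) : fm :=
  ∃ d l, is_seq d l ∧
    (∀ i c u v, entry d i (pair c (pair u v)) ⟹
       eval_step Z
         (fun c' u' v' => ∃ j, j < i ∧ entry d j (pair c' (pair u' v'))) c u v) ∧
    ∃ i, entry d i (pair e (pair x y)).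

Definition turing_le (X Z : S) : fm :=
  ∃ e, ∀ n, (n ∈ X ⟹ eval Z e n 1) ∧ (¬ n ∈ X ⟹ eval Z e n 0).

(* [F] is (the graph of) a function of type N x N -> N *)
Definition double_seq (F : S) : fm :=
  (∀ z, z ∈ F ⟹ ∃ n i b, z ≡ pair (pair n i) b) ∧
  (∀ n i, ∃! b, pair (pair n i) b ∈ F).

(* [F] codes a uniform sequence of Sigma^{0,Z}_1 sets, with [B_{n,i}] the finite
   set coded by the value of [F] at [(n,i)]. *)
Definition open_seq (Z F : S) : fm :=
  double_seq F ∧
  (∀ n i b, pair (pair n i) b ∈ F ⟹
     fin_code b ∧ ∀ s, fin_mem s b ⟹ string s) ∧
  turing_le F Z.

Definition open_mem (X F : S) (n : tm) : fm :=
  ∃ i b s l, pair (pair n i) b ∈ F ∧ fin_mem s b ∧ restriction X l s.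

(* [c] codes the union of the [B_{n,i}], [i <= m] *)
Definition open_stage (F : S) (n m c : tm) : fm :=
  fin_code c ∧
  ∀ s, fin_mem s c ⟺
    ∃ i b, i <= m ∧ pair (pair n i) b ∈ F ∧ fin_mem s b.

Definition minimal (B s : tm) : fm :=
  fin_mem s B ∧ ∀ t, fin_mem t B ⟹ prefix t s ⟹ t ≡ s.

(* [mu(B) = r]: [s] lists the partial sums over the minimal strings [< i],
   for [i <= B]; all elements of the finite set coded by [B] are [< B]. *)
Definition fin_measure (B : tm) (r : rat) : fm :=
  ∃ s, is_seq s (B + 1) ∧
    (∃ p, entry s 0 p ∧ with_rat p (fun u => rat_eq u (rat_nat 0))) ∧
    (∀ i, i < B ⟹ ∃ p q, entry s i p ∧ entry s (i + 1) q ∧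
       with_rat p (fun u => with_rat q (fun v =>
         (minimal B i ∧ ∃ l, is_string i l ∧
            with_exp2_neg l (fun e => rat_eq v (rat_add u e))) ∨
         (¬ minimal B i ∧ rat_eq v u)))) ∧
    (∃ p, entry s B p ∧ with_rat p (fun u => rat_eq u r)).

Definition open_measure_le (F : S) (n : tm) (r : rat) : fm :=
  ∀ m, ∃ c, open_stage F n m c ∧ ex_rat (fun u => fin_measure c u ∧ rat_le u r).

Definition in_all_open (X F : S) : fm := ∀ n, open_mem X F n.

Definition ml_test (Z F : S) : fm :=
  open_seq Z F ∧ ∀ n, with_exp2_neg n (fun r => open_measure_le F n r).

Definition one_random (X Z : S) : fm :=
  ∀² F, ml_test Z F ⟹ ¬ in_all_open X F.

Definition weak_two_test (Z F : S) : fm :=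
  open_seq Z F ∧
  ∀ k, ∃ n, ∀ m, n < m ⟹ with_exp2_neg k (fun r => open_measure_le F m r).

Definition weakly_two_random (X Z : S) : fm :=
  ∀² F, weak_two_test Z F ⟹ ¬ in_all_open X F.

(* [T] codes the trees [T_{n,i} = {s : ((n,i),s) in T}] *)
Definition tree_seq (Z T : S) : fm :=
  (∀ n i s, pair (pair n i) s ∈ T ⟹
     string s ∧ ∀ t, string t ⟹ prefix t s ⟹ pair (pair n i) t ∈ T) ∧
  turing_le T Z.

Definition sigma2_mem (X T : S) (n : tm) : fm :=
  ∃ i, ∀ l, ∃ s, restriction X l s ∧ pair (pair n i) s ∈ T.

(* [c] codes the set of strings of length [l] in the union of the [T_{n,j}],
   [j <= i] *)
Definition tree_level (T : S) (n i l c : tm) : fm :=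
  fin_code c ∧
  ∀ s, fin_mem s c ⟺
    is_string s l ∧ ∃ j, j <= i ∧ pair (pair n j) s ∈ T.

Definition sigma2_measure_le (T : S) (n : tm) (r : rat) : fm :=
  ∀ i, ∃ l c p e, tree_level T n i l c ∧ card c p ∧ pow2 l e ∧
    rat_le (Rat p 0 e) r.

Definition sigma2_test (Z T : S) : fm :=
  tree_seq Z T ∧ ∀ n, with_exp2_neg n (fun r => sigma2_measure_le T n r).

Definition two_random (X Z : S) : fm :=
  ∀² T, sigma2_test Z T ⟹ ¬ ∀ n, sigma2_mem X T n.

(* [M] codes a sequence of reals; the [n]-th real is given by the rationals
   [q_k] with code [b] such that [((n,k),b) in M], where
   [|q_k - q_{k+i}| <= 2^{-k}]. *)
Definition real_seq (M : S) : fm :=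
  double_seq M ∧
  ∀ n k i a b, pair (pair n k) a ∈ M ⟹ pair (pair n (k + i)) b ∈ M ⟹
    with_rat a (fun u => with_rat b (fun v => with_exp2_neg k (fun e =>
      rat_le u (rat_add v e) ∧ rat_le v (rat_add u e)))).

(* Simpson's order on the reals: [x <= y] iff [q_k <= q'_k + 2^{-k+1}] for
   all [k], with [r] regarded as a constant sequence. *)
Definition real_le_rat (M : S) (n : tm) (r : rat) : fm :=
  ∀ k b, pair (pair n k) b ∈ M ⟹
    with_rat b (fun u => with_exp2_neg k (fun e =>
      rat_le u (rat_add r (rat_add e e)))).

Definition rat_le_real (M : S) (n : tm) (r : rat) : fm :=
  ∀ k b, pair (pair n k) b ∈ M ⟹
    with_rat b (fun u => with_exp2_neg k (fun e =>
      rat_le r (rat_add u (rat_add e e)))).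

(* The measure of the [n]-th open set exists and is the [n]-th real of [M]. *)
Definition open_measure_eq (F : S) (n : tm) (M : S) : fm :=
  ∀ k, ∃ m0, ∀ m, m0 <= m ⟹
    ∃ c, open_stage F n m c ∧
      ex_rat (fun u => fin_measure c u ∧ with_exp2_neg k (fun e =>
        real_le_rat M n (rat_add u e) ∧
        rat_le_real M n (rat_add u (rat_opp e)))).

Definition schnorr_test (Z F : S) : fm :=
  ml_test Z F ∧
  ∃² M, real_seq M ∧ turing_le M Z ∧ ∀ n, open_measure_eq F n M.

Definition schnorr_random (X Z : S) : fm :=
  ∀² F, schnorr_test Z F ⟹ ¬ in_all_open X F.

Definition supermartingale (M : S) : fm :=
  (∀ z, z ∈ M ⟹ ∃ s q, z ≡ pair s q ∧ string s ∧
     with_rat q (fun u => rat_le (rat_nat 0) u)) ∧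
  (∀ s, string s ⟹ ∃! q, pair s q ∈ M) ∧
  (∀ s s0 s1 q q0 q1, snoc s 0 s0 ⟹ snoc s 1 s1 ⟹
     pair s q ∈ M ⟹ pair s0 q0 ∈ M ⟹ pair s1 q1 ∈ M ⟹
     with_rat q (fun u => with_rat q0 (fun u0 => with_rat q1 (fun u1 =>
       rat_le (rat_add u0 u1) (rat_add u u))))).

Definition succeeds (M X : S) : fm :=
  ∀ k, ∃ n s q, restriction X n s ∧ pair s q ∈ M ∧
    with_rat q (fun u => rat_lt (rat_nat k) u).

Definition computably_random (X Z : S) : fm :=
  ∀² M, supermartingale M ⟹ turing_le M Z ⟹ ¬ succeeds M X.

Definition random_existence (R : S -> S -> fm) : fm := ∀² Z, ∃² X, R X Z.

Definition MLR2 : fm := random_existence two_random.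
Definition W2R : fm := random_existence weakly_two_random.
Definition MLR : fm := random_existence one_random.
Definition CR : fm := random_existence computably_random.
Definition SR : fm := random_existence schnorr_random.

End Internal.

(* Main.v *)
(* By Henkin's completeness theorem it is enough to argue in an arbitrary model
   of RCA0, and there the definability of every auxiliary object is checked by
   closure properties of the Sigma01 and Delta01 predicates of the model.

   (i) Let (U_m) be a weak 2-test and n a number.  The least m with
   mu(U_m) <= 2^-n is a limit of guesses (m, t), where stage t refutes every
   smaller m.  The tree of a guess consists of the strings compatible with
   U_m[t] and stops growing when the guess is refuted; only the trees of the
   right m are infinite, and on high levels they contain only strings of U_m, so
   their union has measure at most 2^-n.
   (ii) A Martin-Loef test is a weak 2-test.
   (iii) If c bounds the initial capital of a supermartingale S, the strings
   with S > 2^n c form a Martin-Loef test by Kolmogorov's inequality.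
   (iv) Given a Schnorr test (U_n), the computable measures yield a stage t(l)
   after which U_(3n+2) grows by at most 2^-(3l+2), for all n < l.  On strings s
   of length l put S(s) = 2^l (sum_(n < l) 2^n mu(U_(3n+2)[t(l)] /\ [s]) + 4^-l);
   the term 4^-l pays for the growth between t(l) and t(l+1) and for the new
   summand n = l, so S is a rational-valued supermartingale. *)
Require Import Defs.
From HB Require Import structures.
From mathcomp Require Import ssreflect ssrfun ssrbool eqtype choice order ssralg ssrnum.
From Stdlib Require Import List Arith Lia Ring Cantor ClassicalEpsilon.
From Stdlib Require Import FunctionalExtensionality PropExtensionality ProofIrrelevance.
Import ListNotations.
Set Implicit Arguments.
Unset Strict Implicit.

(** The model may be nonstandard and has only Sigma01 induction. Auxiliary functions, though chosen
    by [epsilon], are therefore shown to have Sigma01 graphs, and statements proved by induction are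
    kept Sigma01; this is why numbers of strings at a common level stand in for measures, and
    numerators and denominators for field values. Turing reducibility is defined through concrete
    indices, so a construction is defined once relative to a class of set parameters: with all sets
    it feeds comprehension, with the sets computable from Z it yields an index. In (i) the least m
    comes from the Pi01 least number principle, and Sigma01 collection supplies one stage t that
    refutes all smaller indices. In (iv) the constants fit exactly: the new summand is at most 2^l
    2^-(3l+2), the growth of the old ones is less than that, and together they use at most half of
    4^-l; the other half is the sum of the two terms 4^-(l+1) due to the two extensions. The weights
    2^n make S unbounded along X: for l > k, once the prefix of length l lies in U_(3k+2)[t(l)], S
    is at least 2^k there. *)

Section Quotient.
Variables (A : Type) (E : A -> A -> Prop).
Hypotheses (E_refl : forall x, E x x) (E_sym : forall x y, E x y -> E y x)
  (E_trans : forall x y z, E x y -> E y z -> E x z).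

Definition norm (x : A) : A := epsilon (inhabits x) (E x).

Lemma norm_rel x : E x (norm x).
Proof. exact: (epsilon_spec (inhabits x) (E x) (ex_intro _ x (E_refl x))). Qed.

Lemma norm_eq x y : E x y -> norm x = norm y.
Proof.
move=> Exy; rewrite /norm.
(* The choice depends on [x] only through the predicate [E x] and the proof of inhabitation; the
   former agree by extensionality, the latter by proof irrelevance. *)
have -> : E x = E y.
  apply: functional_extensionality => z; apply: propositional_extensionality.
  split=> H; last exact: E_trans Exy H.
  by apply: E_trans H; apply: E_sym.
by rewrite (proof_irrelevance _ (inhabits x) (inhabits y)).
Qed.

(** Classes are the fixed points of the choice of representatives, so that equality of classes is
    Leibniz equality, as the semantics of [feq] and the algebraic structures demand. *)
Definition quot : Type := {x : A | norm x = x}.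

Definition cls (x : A) : quot := exist _ (norm x) (esym (norm_eq (norm_rel x))).
Definition rep (x : quot) : A := proj1_sig x.

Lemma cls_eq x y : cls x = cls y <-> E x y.
Proof.
split=> [[Exy]|Exy].
  by apply: E_trans (norm_rel x) _; rewrite Exy; apply: E_sym; apply: norm_rel.
rewrite /cls; move: (esym _) (esym _); rewrite (norm_eq Exy) => e e'.
by rewrite (proof_irrelevance _ e e').
Qed.

Lemma rep_cls x : E x (rep (cls x)).
Proof. exact: norm_rel. Qed.

Lemma cls_rep x : cls (rep x) = x.
Proof.
case: x => t e; rewrite /cls /=; move: (esym _); rewrite e => e'.
by rewrite (proof_irrelevance _ e e').
Qed.

End Quotient.

(** * Semantics *)

Definition scons {A : Type} (a : A) (f : nat -> A) (n : nat) : A :=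
  match n with 0 => a | S m => f m end.

Record model : Type := Model {
  dom : Type;
  sets : Type;
  mzero : dom;
  mone : dom;
  madd : dom -> dom -> dom;
  mmul : dom -> dom -> dom;
  mlt : dom -> dom -> Prop;
  mmem : dom -> sets -> Prop }.

Fixpoint tval (M : model) (V : Type) (rho : V -> dom M) (t : term V) : dom M :=
  match t with
  | tvar x => rho x
  | tzero => mzero M
  | tone => mone M
  | tadd s t => madd (tval rho s) (tval rho t)
  | tmul s t => mmul (tval rho s) (tval rho t)
  end.

Fixpoint sat (M : model) (rho : nat -> dom M) (sig : nat -> sets M) (p : form) : Prop :=
  match p with
  | fbot => False
  | feq s t => tval rho s = tval rho t
  | flt s t => mlt (tval rho s) (tval rho t)
  | fmem t X => mmem (tval rho t) (sig X)
  | fimp p q => sat rho sig p -> sat rho sig q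
  | fallN p => forall x, sat (scons x rho) sig p
  | fallS p => forall X, sat rho (scons X sig) p
  end.

Lemma tbind_ext (V W : Type) (f g : V -> term W) t :
  (forall x, f x = g x) -> tbind f t = tbind g t.
Proof. by move=> E; elim: t => //= s -> t ->. Qed.

Lemma tbind_comp (V W U : Type) (f : W -> term U) (g : V -> term W) t :
  tbind f (tbind g t) = tbind (fun x => tbind f (g x)) t.
Proof. by elim: t => //= s -> t ->. Qed.

Lemma tbind_var (V : Type) (t : term V) : tbind (@tvar V) t = t.
Proof. by elim: t => //= s -> t ->. Qed.

Lemma tval_tbind (M : model) (V W : Type) (rho : W -> dom M) (f : V -> term W) t :
  tval rho (tbind f t) = tval (fun x => tval rho (f x)) t.
Proof. by elim: t => //= s -> t ->. Qed.

Lemma upN_comp f g :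
  (fun x => tbind (upN f) (upN g x)) = upN (fun x => tbind f (g x)).
Proof.
apply: functional_extensionality => -[//|x] /=.
by rewrite /tlift !tbind_comp; apply: tbind_ext.
Qed.

Lemma upS_comp f g : (fun X => upS f (upS g X)) = upS (fun X => f (g X)).
Proof. by apply: functional_extensionality => -[]. Qed.

Lemma upN_var : upN (@tvar nat) = @tvar nat.
Proof. by apply: functional_extensionality => -[]. Qed.

Lemma upS_id : upS idS = idS.
Proof. by apply: functional_extensionality => -[]. Qed.

Lemma fsubst_comp p f1 g1 f2 g2 :
  fsubst f1 g1 (fsubst f2 g2 p) =
  fsubst (fun x => tbind f1 (f2 x)) (fun X => g1 (g2 X)) p.
Proof.
elim: p f1 g1 f2 g2 => //= [s t|s t|t X|p IHp q IHq|p IHp|p IHp] f1 g1 f2 g2.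
- by rewrite !tbind_comp.
- by rewrite !tbind_comp.
- by rewrite !tbind_comp.
- by rewrite IHp IHq.
- by rewrite IHp upN_comp.
- by rewrite IHp upS_comp.
Qed.

Lemma fsubst_id p : fsubst (@tvar nat) idS p = p.
Proof.
elim: p => //= [s t|s t|t X|p IHp q IHq|p IHp|p IHp]; rewrite ?tbind_var //.
- by rewrite IHp IHq.
- by rewrite upN_var IHp.
- by rewrite upS_id IHp.
Qed.

Lemma tbind_bound (V : Type) (f g : nat -> term V) t :
  (forall x, x < tbound t -> f x = g x) -> tbind f t = tbind g t.
Proof.
elim: t => //= [x|s IHs t IHt|s IHs t IHt] E; first by apply: E; lia.
- by rewrite IHs ?IHt // => x Hx; apply: E; lia.
- by rewrite IHs ?IHt // => x Hx; apply: E; lia.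
Qed.

Lemma fsubst_bound p f1 g1 f2 g2 :
  (forall x, x < boundN p -> f1 x = f2 x) ->
  (forall X, X < boundS p -> g1 X = g2 X) -> fsubst f1 g1 p = fsubst f2 g2 p.
Proof.
elim: p f1 g1 f2 g2 => //= [s t|s t|t X|p IHp q IHq|p IHp|p IHp] f1 g1 f2 g2 E1 E2.
- by rewrite !(@tbind_bound _ f1 f2) // => x Hx; apply: E1; lia.
- by rewrite !(@tbind_bound _ f1 f2) // => x Hx; apply: E1; lia.
- rewrite (@tbind_bound _ f1 f2); last by move=> x Hx; apply: E1; lia.
  by rewrite E2; last lia.
- rewrite (IHp f1 g1 f2 g2) ?(IHq f1 g1 f2 g2) // => x Hx;
    by [apply: E1; lia | apply: E2; lia].
- rewrite (IHp _ g1 (upN f2) g2) // => -[//|x] Hx /=.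
  by rewrite E1; last lia.
- rewrite (IHp f1 _ f2 (upS g2)) // => -[//|x] Hx /=.
  by rewrite E2; last lia.
Qed.

Lemma sat_fsubst (M : model) p (rho : nat -> dom M) (sig : nat -> sets M) f g :
  sat rho sig (fsubst f g p) <->
  sat (fun x => tval rho (f x)) (fun X => sig (g X)) p.
Proof.
elim: p rho sig f g => //= [s t|s t|t X|p IHp q IHq|p IHp|p IHp] rho sig f g.
- by rewrite !tval_tbind.
- by rewrite !tval_tbind.
- by rewrite !tval_tbind.
- by rewrite IHp IHq.
- have E x : (fun y => tval (scons x rho) (upN f y)) =
             scons x (fun y => tval rho (f y)).
    by apply: functional_extensionality => -[//|y] /=; rewrite tval_tbind.
  by split=> H x; move: (H x); rewrite IHp E.
- have E X : (fun Y => scons X sig (upS g Y)) = scons X (fun Y => sig (g Y)).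
    by apply: functional_extensionality => -[].
  by split=> H X; move: (H X); rewrite IHp E.
Qed.

Lemma tval_bound (M : model) (rho rho' : nat -> dom M) t :
  (forall x, x < tbound t -> rho x = rho' x) -> tval rho t = tval rho' t.
Proof.
elim: t => //= [x|s IHs t IHt|s IHs t IHt] E; first by apply: E; lia.
- by rewrite IHs ?IHt // => x Hx; apply: E; lia.
- by rewrite IHs ?IHt // => x Hx; apply: E; lia.
Qed.

Lemma sat_bound (M : model) p (rho rho' : nat -> dom M) (sig sig' : nat -> sets M) :
  (forall x, x < boundN p -> rho x = rho' x) ->
  (forall X, X < boundS p -> sig X = sig' X) -> sat rho sig p <-> sat rho' sig' p.
Proof.
elim: p rho rho' sig sig' => //= [s t|s t|t X|p IHp q IHq|p IHp|p IHp] r r' s1 s2 E1 E2.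
- by rewrite !(@tval_bound _ r r') // => x Hx; apply: E1; lia.
- by rewrite !(@tval_bound _ r r') // => x Hx; apply: E1; lia.
- rewrite (@tval_bound _ r r'); last by move=> x Hx; apply: E1; lia.
  by rewrite E2; last lia.
- rewrite (IHp r r' s1 s2) ?(IHq r r' s1 s2) // => x Hx;
    by [apply: E1; lia | apply: E2; lia].
- have H x : sat (scons x r) s1 p <-> sat (scons x r') s2 p.
    by apply: IHp => // -[//|y] Hy /=; apply: E1; lia.
  by split=> A x; apply/H.
- have H x : sat r (scons x s1) p <-> sat r' (scons x s2) p.
    by apply: IHp => // -[//|y] Hy /=; apply: E2; lia.
  by split=> A x; apply/H.
Qed.

(** * Derivations *)

Lemma prv_weaken G G' p : prv G p -> incl G G' -> prv G' p.
Proof.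
rewrite /incl => H.
elim: H G' => {G p} [G p Hp|G p q _ IH|G p q _ IHp _ IHq|G p _ IH|G p _ IH
  |G p t _ IH|G p _ IH|G p X _ IH|G t|G p s t _ IHe _ IHp] G' I.
- by apply: prv_hyp; apply: I.
- by apply/prv_impI/IH => x /= [->|/I]; [left|right].
- by apply: prv_impE; [apply: IHp|apply: IHq].
- by apply/prv_raa/IH => x /= [->|/I]; [left|right].
- by apply/prv_allNI/IH; apply: incl_map.
- by apply/prv_allNE/IH.
- by apply/prv_allSI/IH; apply: incl_map.
- by apply/prv_allSE/IH.
- exact: prv_eq_refl.
- by apply: prv_eq_subst; [apply: IHe|apply: IHp].
Qed.

Lemma fsubst_instN f g p t :
  fsubst f g (instN p t) = instN (fsubst (upN f) g p) (tbind f t).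
Proof.
rewrite /instN !fsubst_comp; congr (fsubst _ _ p).
apply: functional_extensionality => -[//|x] /=.
by rewrite /tlift tbind_comp /= tbind_var.
Qed.

Lemma fsubst_instS f g p X :
  fsubst f g (instS p X) = instS (fsubst f (upS g) p) (g X).
Proof.
rewrite /instS !fsubst_comp; congr (fsubst _ _ p).
- by apply: functional_extensionality => x; rewrite tbind_var.
- by apply: functional_extensionality => -[].
Qed.

Lemma fsubst_liftN f g p : fsubst (upN f) g (liftN p) = liftN (fsubst f g p).
Proof. by rewrite /liftN !fsubst_comp. Qed.

Lemma fsubst_liftS f g p : fsubst f (upS g) (liftS p) = liftS (fsubst f g p).
Proof.
rewrite /liftS !fsubst_comp; congr (fsubst _ _ p).
by apply: functional_extensionality => x; rewrite tbind_var.
Qed.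

(** The rules introduce quantifiers over a lifted context, whereas Henkin witnesses are free
    variables outside those in use; a substitution inside a derivation turns one form of
    generalization into the other. *)
Lemma prv_fsubst G p : prv G p ->
  forall f g, prv (map (fsubst f g) G) (fsubst f g p).
Proof.
elim=> {G p} [G p Hp|G p q _ IH|G p q _ IHp _ IHq|G p _ IH|G p _ IH
  |G p t _ IH|G p _ IH|G p X _ IH|G t|G p s t _ IHe _ IHp] f g /=.
- by apply/prv_hyp/in_map.
- exact/prv_impI/IH.
- exact: prv_impE (IHp f g) (IHq f g).
- exact/prv_raa/IH.
- apply: prv_allNI; move: (IH (upN f) g); rewrite !map_map.
  by rewrite (map_ext _ (fun q => liftN (fsubst f g q))) // => q; rewrite fsubst_liftN.
- by rewrite fsubst_instN; apply/prv_allNE/IH.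
- apply: prv_allSI; move: (IH f (upS g)); rewrite !map_map.
  by rewrite (map_ext _ (fun q => liftS (fsubst f g q))) // => q; rewrite fsubst_liftS.
- by rewrite fsubst_instS; apply/prv_allSE/IH.
- exact: prv_eq_refl.
- rewrite fsubst_instN; apply: (@prv_eq_subst _ _ (tbind f s)); first exact: IHe.
  by rewrite -fsubst_instN.
Qed.

Definition fresh_above (c d : nat) (G : list form) : Prop :=
  forall p, In p G -> boundN p <= c /\ boundS p <= d.

(** The substitution that sends [c] to index 0 and lifts all other variables undoes the
    instantiation at [c], and agrees with [liftN] on the context, where [c] does not occur. *)
Lemma prv_freshN G p c d : fresh_above c d (fallN p :: G) ->
  prv G (instN p (tvar c)) -> prv G (fallN p).
Proof.
move=> fr H; apply: prv_allNI.
pose f x : term nat := if Nat.eqb x c then tvar 0 else tvar (S x).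
have := prv_fsubst H f idS.
have -> : fsubst f idS (instN p (tvar c)) = p.
  rewrite /instN fsubst_comp -[RHS]fsubst_id.
  apply: fsubst_bound => // -[|x] Hx /=; rewrite /f; first by rewrite Nat.eqb_refl.
  have [/= Hc _] := fr _ (or_introl erefl).
  by have -> : Nat.eqb x c = false by apply/Nat.eqb_neq; lia.
rewrite (map_ext_in _ liftN) // => q Hq; apply: fsubst_bound => // x Hx.
have [Hc _] := fr _ (or_intror Hq).
by rewrite /f (_ : Nat.eqb x c = false) //; apply/Nat.eqb_neq; lia.
Qed.

Lemma prv_freshS G p c d : fresh_above c d (fallS p :: G) ->
  prv G (instS p d) -> prv G (fallS p).
Proof.
move=> fr H; apply: prv_allSI.
pose g x := if Nat.eqb x d then 0 else S x.
have := prv_fsubst H (@tvar nat) g.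
have -> : fsubst (@tvar nat) g (instS p d) = p.
  rewrite /instS fsubst_comp -[RHS]fsubst_id.
  apply: fsubst_bound => // -[|x] Hx /=; rewrite /g; first by rewrite Nat.eqb_refl.
  have [_ /= Hc] := fr _ (or_introl erefl).
  by have -> : Nat.eqb x d = false by apply/Nat.eqb_neq; lia.
rewrite (map_ext_in _ liftS) // => q Hq; apply: fsubst_bound => // x Hx.
have [_ Hc] := fr _ (or_intror Hq).
by rewrite /g (_ : Nat.eqb x d = false) //; apply/Nat.eqb_neq; lia.
Qed.

Lemma prv_botE G p : prv G fbot -> prv G p.
Proof. by move=> H; apply: prv_raa; apply: prv_weaken H _ => x Hx; right. Qed.

Lemma prv_cut G p q : prv G p -> prv (p :: G) q -> prv G q.
Proof. by move=> Hp Hq; apply: prv_impE Hp; apply: prv_impI. Qed.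

(** * The completeness theorem *)

Local Arguments Cantor.to_nat : simpl never.

Fixpoint term_code (t : term nat) : nat :=
  match t with
  | tvar x => Cantor.to_nat (0, x)
  | tzero => Cantor.to_nat (1, 0)
  | tone => Cantor.to_nat (2, 0)
  | tadd s t => Cantor.to_nat (3, Cantor.to_nat (term_code s, term_code t))
  | tmul s t => Cantor.to_nat (4, Cantor.to_nat (term_code s, term_code t))
  end.

Fixpoint form_code (p : form) : nat :=
  match p with
  | fbot => Cantor.to_nat (0, 0)
  | feq s t => Cantor.to_nat (1, Cantor.to_nat (term_code s, term_code t))
  | flt s t => Cantor.to_nat (2, Cantor.to_nat (term_code s, term_code t))
  | fmem t X => Cantor.to_nat (3, Cantor.to_nat (term_code t, X))
  | fimp p q => Cantor.to_nat (4, Cantor.to_nat (form_code p, form_code q))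
  | fallN p => Cantor.to_nat (5, form_code p)
  | fallS p => Cantor.to_nat (6, form_code p)
  end.

Lemma term_code_inj s t : term_code s = term_code t -> s = t.
Proof.
have I := Cantor.to_nat_inj.
elim: s t => [x| | |s IHs s' IHs'|s IHs s' IHs'] [y| | |t t'|t t'] /=
  /I // [] // => [->|/I [/IHs -> /IHs' ->]|/I [/IHs -> /IHs' ->]] //.
Qed.

Lemma form_code_inj p q : form_code p = form_code q -> p = q.
Proof.
have I := Cantor.to_nat_inj; have J := term_code_inj.
elim: p q => [|s t|s t|t X|p IHp p' IHp'|p IHp|p IHp] [|u v|u v|u Y|q q'|q|q] /=
  /I // [] //.
- by move=> /I [/J -> /J ->].
- by move=> /I [/J -> /J ->].
- by move=> /I [/J -> ->].
- by move=> /I [/IHp -> /IHp' ->].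
- by move=> /IHp ->.
- by move=> /IHp ->.
Qed.

Definition form_enum (n : nat) : form :=
  epsilon (inhabits fbot) (fun p => form_code p = n).

Lemma form_enumK p : form_enum (form_code p) = p.
Proof.
apply: form_code_inj.
exact: (epsilon_spec (inhabits fbot) (fun q => form_code q = form_code p)
  (ex_intro _ p erefl)).
Qed.

Section Henkin.
Variable T : form -> Prop.
Hypothesis T_closed : forall p, T p -> boundN p = 0 /\ boundS p = 0.

(** The theory stays apart from the finite list [D] of added formulas: its members are closed, so an
    index fresh for [D] is fresh for everything, and variables can themselves serve as Henkin
    constants. *)
Definition consistent (D : list form) : Prop :=
  ~ exists G, (forall q, In q G -> T q) /\ prv (G ++ D) fbot.

Definition maxN (D : list form) : nat := list_max (map boundN D).
Definition maxS (D : list form) : nat := list_max (map boundS D).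

Lemma list_max_in x l : In x l -> x <= list_max l.
Proof. by elim: l => //= y l IH [->|/IH]; lia. Qed.

Lemma fresh_max G D : (forall q, In q G -> T q) ->
  fresh_above (maxN D) (maxS D) (G ++ D).
Proof.
move=> HG p Hp; case: (in_app_or _ _ _ Hp) => [/HG /T_closed [-> ->]|HpD].
  by split; lia.
by split; apply/list_max_in/in_map.
Qed.

(** Existential formulas abbreviate negated universal ones, so these are the only formulas that call
    for a witness. *)
Definition witness (p : form) (D : list form) : list form :=
  match p with
  | fimp (fallN q) fbot => [fnot (instN q (tvar (maxN D)))]
  | fimp (fallS q) fbot => [fnot (instS q (maxS D))]
  | _ => []
  end.

Lemma prv_move_hyp G D p : In (fnot p) D -> prv (G ++ D) p -> prv (G ++ D) fbot.
Proof.
move=> I H; apply: prv_impE H; apply: prv_hyp.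
by apply: in_or_app; right.
Qed.

Lemma prv_raa_mid G D p : prv (G ++ fnot p :: D) fbot -> prv (G ++ D) p.
Proof.
move=> H; apply: prv_raa; apply: prv_weaken H _ => x Hx.
case: (in_app_or _ _ _ Hx) => [h|[->|h]].
- by right; apply: in_or_app; left.
- by left.
- by right; apply: in_or_app; right.
Qed.

Lemma consistent_witness p D : consistent (p :: D) ->
  consistent (witness p (p :: D) ++ p :: D).
Proof.
(* Freshness for the universal formula itself is inherited from its negation, which lies in the
   list. *)
have fr_cons G q D' : (forall q, In q G -> T q) -> In (fnot q) D' ->
    fresh_above (maxN D') (maxS D') (q :: G ++ D').
  move=> HG Hq r /= [<-|]; last exact: fresh_max.
  have Hq' : In (fnot q) (G ++ D') by apply: in_or_app; right.
  by have /= := fresh_max HG Hq'; lia.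
case: p => // -[] // ; [move=> q|move=> q] => -[] // C [G [HG H]]; apply: C; exists G; split=> //.
- apply: (@prv_move_hyp _ _ (fallN q)); first by left.
  apply: prv_freshN; last exact: prv_raa_mid H.
  by apply: fr_cons => //; left.
- apply: (@prv_move_hyp _ _ (fallS q)); first by left.
  apply: prv_freshS; last exact: prv_raa_mid H.
  by apply: fr_cons => //; left.
Qed.

Variable D0 : list form.
Hypothesis D0_consistent : consistent D0.

Fixpoint stage (n : nat) : list form :=
  match n with
  | 0 => D0
  | S n =>
      let p := form_enum n in
      if excluded_middle_informative (consistent (p :: stage n))
      then witness p (p :: stage n) ++ p :: stage n
      else stage n
  end.

Lemma stageS n : stage (S n) =
  if excluded_middle_informative (consistent (form_enum n :: stage n))
  then witness (form_enum n) (form_enum n :: stage n) ++ form_enum n :: stage n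
  else stage n.
Proof. by []. Qed.

Lemma stage_consistent n : consistent (stage n).
Proof.
elim: n => //= n IH; case: excluded_middle_informative => // C.
exact: consistent_witness.
Qed.

Lemma stage_S n : incl (stage n) (stage (S n)).
Proof.
rewrite /=; case: excluded_middle_informative => C x Hx //.
by apply: in_or_app; right; right.
Qed.

Lemma stage_mono m n : m <= n -> incl (stage m) (stage n).
Proof.
elim=> // k _ IH x Hx.
exact/stage_S/IH.
Qed.

Definition hen (p : form) : Prop := exists n, In p (stage n).

Lemma hen_finite L : (forall p, In p L -> hen p) -> exists n, incl L (stage n).
Proof.
elim: L => [_|p L IH H]; first by exists 0.
have [|n Hn] := IH; first by move=> q Hq; apply: H; right.
have [m Hm] : hen p by apply: H; left.
exists (Nat.max m n) => q /= [<-|Hq].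
  by apply: stage_mono Hm; lia.
by move: (Hn _ Hq); apply: stage_mono; lia.
Qed.

Lemma hen_or p : hen p \/ exists n, ~ consistent (p :: stage n).
Proof.
case: (excluded_middle_informative (consistent (p :: stage (form_code p)))) => C.
  left; exists (S (form_code p)); rewrite stageS form_enumK.
  by case: excluded_middle_informative => // C'; apply: in_or_app; right; left.
by right; exists (form_code p).
Qed.

(** If [p] were left out, some stage would refute it; a later stage that also contains the premises
    would then be inconsistent by a cut. *)
Lemma hen_prv L p : (forall q, In q L -> hen q) -> prv L p -> hen p.
Proof.
move=> /hen_finite [m Hm] H; case: (hen_or p) => // -[n].
case/NNPP => G [HG H']; exfalso.
apply: (@stage_consistent (Nat.max m n)); exists G; split=> //.
apply: (@prv_cut _ p).
  apply: prv_weaken H _ => x /Hm Hx; apply: in_or_app; right.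
  by move: Hx; apply: stage_mono; lia.
apply: prv_weaken H' _ => x Hx; case: (in_app_or _ _ _ Hx) => [h|[->|h]]; last first.
- right; apply: in_or_app; right; move: h; apply: stage_mono; lia.
- by left.
- by right; apply: in_or_app; left.
Qed.

Lemma hen_theory p : T p -> hen p.
Proof.
move=> Tp; case: (hen_or p) => // -[n] /NNPP [G [HG H]]; exfalso.
apply: (@stage_consistent n); exists (p :: G); split.
  by move=> q /= [<-|/HG].
apply: prv_weaken H _ => x Hx; case: (in_app_or _ _ _ Hx) => [h|[->|h]].
- by right; apply: in_or_app; left.
- by left.
- by right; apply: in_or_app; right.
Qed.

Lemma hen_bot : ~ hen fbot.
Proof.
move=> [n Hn]; apply: (@stage_consistent n); exists []; split=> //.
exact: prv_hyp.
Qed.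

Lemma hen_not p : ~ hen p -> hen (fnot p).
Proof.
move=> Hp; case: (hen_or (fnot p)) => // -[n] /NNPP [G [HG H]]; exfalso.
apply: Hp; apply: (@hen_prv (G ++ stage n)); last exact: prv_raa_mid.
move=> q Hq; case: (in_app_or _ _ _ Hq) => [/HG /hen_theory //|h].
by exists n.
Qed.

Lemma hen_imp p q : hen (fimp p q) <-> (hen p -> hen q).
Proof.
split=> [Hi Hp|H].
  apply: (@hen_prv [fimp p q; p]); first by move=> r [<-|[<-|[]]].
  apply: (@prv_impE _ p); apply: prv_hyp; [by left|by right; left].
case: (classic (hen p)) => [/H Hq|/hen_not Hp].
  apply: (@hen_prv [q]); first by move=> r [<-|[]].
  by apply: prv_impI; apply: prv_hyp; right; left.
apply: (@hen_prv [fnot p]); first by move=> r [<-|[]].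
apply: prv_impI; apply: prv_botE; apply: (@prv_impE _ p); apply: prv_hyp;
  [by right; left|by left].
Qed.

(** The converse is the Henkin property: if [fallN p] is missing, its negation is added at the stage
    of its own code, together with a variable as counterexample. *)
Lemma hen_allN p : hen (fallN p) <-> forall t, hen (instN p t).
Proof.
split=> [H t|H].
  apply: (@hen_prv [fallN p]); first by move=> r [<-|[]].
  by apply: prv_allNE; apply: prv_hyp; left.
apply: NNPP => /hen_not Hn; set q := fnot (fallN p) in Hn.
have : consistent (q :: stage (form_code q)).
  move=> [G [HG /prv_raa_mid H']]; apply: hen_bot.
  apply: (proj1 (hen_imp (fallN p) fbot) Hn).
  apply: (hen_prv _ H') => r Hr; case: (in_app_or _ _ _ Hr) => [/HG /hen_theory //|h].
  by exists (form_code q).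
move=> C; apply: hen_bot; apply: (proj1 (hen_imp _ fbot) _ (H (tvar (maxN (q :: stage (form_code q)))))).
exists (S (form_code q)); rewrite stageS form_enumK.
by case: excluded_middle_informative => // C'; left.
Qed.

Lemma hen_allS p : hen (fallS p) <-> forall X, hen (instS p X).
Proof.
split=> [H t|H].
  apply: (@hen_prv [fallS p]); first by move=> r [<-|[]].
  by apply: prv_allSE; apply: prv_hyp; left.
apply: NNPP => /hen_not Hn; set q := fnot (fallS p) in Hn.
have : consistent (q :: stage (form_code q)).
  move=> [G [HG /prv_raa_mid H']]; apply: hen_bot.
  apply: (proj1 (hen_imp (fallS p) fbot) Hn).
  apply: (hen_prv _ H') => r Hr; case: (in_app_or _ _ _ Hr) => [/HG /hen_theory //|h].
  by exists (form_code q).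
move=> C; apply: hen_bot; apply: (proj1 (hen_imp _ fbot) _ (H (maxS (q :: stage (form_code q))))).
exists (S (form_code q)); rewrite stageS form_enumK.
by case: excluded_middle_informative => // C'; left.
Qed.

Definition heq (s t : term nat) : Prop := hen (feq s t).

Lemma heq_refl s : heq s s.
Proof. by apply: (@hen_prv []) => //; apply: prv_eq_refl. Qed.

(* Leibniz's rule for an arbitrary context [p], from the substitution rule of
   the calculus. *)
Lemma heq_subst p s t : heq s t -> hen (instN p s) -> hen (instN p t).
Proof.
move=> E H; apply: (@hen_prv [feq s t; instN p s]).
  by move=> r [<-|[<-|[]]].
by apply: (@prv_eq_subst _ _ s); apply: prv_hyp; [left|right; left].
Qed.

Lemma instN_lift (t s : term nat) :
  tbind (fun x => match x with 0 => s | S y => tvar y end) (tlift t) = t.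
Proof. by rewrite /tlift tbind_comp /= tbind_var. Qed.

Lemma heq_sym s t : heq s t -> heq t s.
Proof.
move=> E; have := @heq_subst (feq (tvar 0) (tlift s)) _ _ E.
by rewrite /instN /= !instN_lift; apply; apply: heq_refl.
Qed.

Lemma heq_trans s t u : heq s t -> heq t u -> heq s u.
Proof.
move=> E1 E2; have := @heq_subst (feq (tlift s) (tvar 0)) _ _ E2.
by rewrite /instN /= !instN_lift; apply.
Qed.

Definition hdom : Type := quot heq.
Local Notation hcls := (cls heq_refl heq_sym heq_trans).

(** Numbers are terms modulo provable equality. Sets are the bare set variables: the language has no
    equality between sets, so nothing has to be identified. *)
Definition hmodel : model :=
  @Model hdom nat (hcls tzero) (hcls tone)
    (fun x y => hcls (tadd (rep x) (rep y))) (fun x y => hcls (tmul (rep x) (rep y)))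
    (fun x y => hen (flt (rep x) (rep y))) (fun x X => hen (fmem (rep x) X)).

(** Leibniz's rule is applied to one argument at a time; the operation has to commute with
    substitution for the context to be of the required form. *)
Lemma heq_congr2 (op : term nat -> term nat -> term nat) s s' t t' :
  (forall f u v, tbind f (op u v) = op (tbind f u) (tbind f v)) ->
  heq s s' -> heq t t' -> heq (op s t) (op s' t').
Proof.
move=> B E1 E2; apply: (@heq_trans _ (op s t')).
  have := @heq_subst (feq (tlift (op s t)) (op (tlift s) (tvar 0))) _ _ E2.
  rewrite /instN /= !B !instN_lift /=; apply; exact: heq_refl.
have := @heq_subst (feq (tlift (op s t')) (op (tvar 0) (tlift t'))) _ _ E1.
rewrite /instN /= !B !instN_lift /=; apply; exact: heq_refl.
Qed.

Lemma hmodel_tval (rho : nat -> hdom) t :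
  @tval hmodel nat rho t = hcls (tbind (fun x => rep (rho x)) t).
Proof.
elim: t => //= [x|s -> t ->|s -> t ->]; first by rewrite cls_rep.
- apply/(cls_eq heq_refl heq_sym heq_trans); apply: (@heq_congr2 (@tadd nat)) => //; apply: heq_sym; apply: rep_cls.
- apply/(cls_eq heq_refl heq_sym heq_trans); apply: (@heq_congr2 (@tmul nat)) => //; apply: heq_sym; apply: rep_cls.
Qed.

Lemma hen_lt_congr s s' t t' : heq s s' -> heq t t' -> hen (flt s t) -> hen (flt s' t').
Proof.
move=> E1 E2 H.
have := @heq_subst (flt (tvar 0) (tlift t)) _ _ E1.
rewrite /instN /= !instN_lift => /(_ H) {}H.
have := @heq_subst (flt (tlift s') (tvar 0)) _ _ E2.
by rewrite /instN /= !instN_lift; apply.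
Qed.

(** The truth lemma. A number quantifier ranges over classes, so in its case a term is exchanged for
    the representative of its class by Leibniz's rule. *)
Lemma hmodel_sat p (rho : nat -> hdom) (sig : nat -> nat) :
  @sat hmodel rho sig p <-> hen (fsubst (fun x => rep (rho x)) sig p).
Proof.
elim: p rho sig => /= [|s t|s t|t X|p IHp q IHq|p IHp|p IHp] rho sig.
- by split=> // /hen_bot.
- by rewrite !hmodel_tval (cls_eq heq_refl heq_sym heq_trans).
- rewrite !hmodel_tval; split; apply: hen_lt_congr => //;
    by [apply: rep_cls|apply: heq_sym; apply: rep_cls].
- rewrite !hmodel_tval; set u := tbind _ t.
  have A v w : heq v w -> hen (fmem v (sig X)) -> hen (fmem w (sig X)).
    by move=> E; apply: (@heq_subst (fmem (tvar 0) (sig X)) _ _ E).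
  by split; apply: A; [apply: heq_sym|]; apply: rep_cls.
- by rewrite hen_imp IHp IHq.
- rewrite hen_allN; split=> [H t|H x].
    have /IHp := H (hcls t).
    set a := fsubst _ _ p.
    have -> : a = instN (fsubst (upN (fun x => rep (rho x))) sig p) (rep (hcls t)).
      rewrite /a /instN fsubst_comp; congr (fsubst _ _ p).
      by apply: functional_extensionality => -[//|x] /=; rewrite instN_lift.
    by apply: heq_subst; apply: heq_sym; apply: rep_cls.
  apply/IHp; have := H (rep x); rewrite /instN fsubst_comp.
  congr (hen (fsubst _ _ p)).
  by apply: functional_extensionality => -[//|y] /=; rewrite instN_lift.
- rewrite hen_allS; have E X : instS (fsubst (fun x => rep (rho x)) (upS sig) p) X =
      fsubst (fun x => rep (rho x)) (scons X sig) p.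
    rewrite /instS fsubst_comp; congr (fsubst _ _ p).
      by apply: functional_extensionality => x; rewrite tbind_var.
    by apply: functional_extensionality => -[].
  by split=> H X; [rewrite E; apply/IHp|apply/IHp; rewrite -E].
Qed.

Lemma hmodel_closed p : boundN p = 0 -> boundS p = 0 ->
  forall rho sig, @sat hmodel rho sig p <-> hen p.
Proof.
move=> HN HS rho sig; rewrite hmodel_sat (@fsubst_bound p _ sig (@tvar nat) idS).
- by rewrite fsubst_id.
- by rewrite HN => x; lia.
- by rewrite HS => x; lia.
Qed.

End Henkin.

Theorem completeness (T : form -> Prop) (p : form) :
  (forall q, T q -> boundN q = 0 /\ boundS q = 0) ->
  boundN p = 0 -> boundS p = 0 ->
  (forall M : model, (forall q, T q -> forall rho sig, @sat M rho sig q) ->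
     forall rho sig, @sat M rho sig p) ->
  proves_from T p.
Proof.
move=> HT HN HS H; apply: NNPP => nT.
have C : consistent T [fnot p].
  move=> [G [HG H']]; apply: nT; exists G; split=> //.
  by have := prv_raa_mid H'; rewrite app_nil_r.
pose M := hmodel HT C.
pose rho (x : nat) : dom M := cls (heq_refl HT C) (heq_sym HT C) (heq_trans HT C) tzero.
have E q := @hmodel_closed T HT [fnot p] C q.
have Hp : hen T [fnot p] p.
  apply/(E p HN HS rho idS); apply: H => q Tq r s.
  have [qN qS] := HT _ Tq.
  by apply/(E q qN qS); apply: (@hen_theory T).
have Hn : hen T [fnot p] (fnot p) by exists 0; left.
by apply: (@hen_bot T HT _ C); apply: (proj1 (hen_imp HT C p fbot) Hn).
Qed.

Import Order.TTheory GRing.Theory Num.Theory.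

(** * The ordered field of fractions *)

Definition asb (P : Prop) : bool := if excluded_middle_informative P then true else false.

Lemma asbP P : reflect P (asb P).
Proof. by rewrite /asb; case: excluded_middle_informative => H; constructor. Qed.

Section FractionField.
Variables (A : Type) (z o : A) (ad mu : A -> A -> A) (lt : A -> A -> Prop).
Hypotheses (adA : forall x y w, ad (ad x y) w = ad x (ad y w))
  (adC : forall x y, ad x y = ad y x)
  (muA : forall x y w, mu (mu x y) w = mu x (mu y w))
  (muC : forall x y, mu x y = mu y x)
  (muD : forall x y w, mu x (ad y w) = ad (mu x y) (mu x w))
  (ad0 : forall x, ad x z = x) (mu0 : forall x, mu x z = z)
  (mu1 : forall x, mu x o = x)
  (lt_trans : forall x y w, lt x y -> lt y w -> lt x w)
  (lt_irr : forall x, ~ lt x x)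
  (lt_total : forall x y, lt x y \/ x = y \/ lt y x)
  (lt_ad : forall x y w, lt x y -> lt (ad x w) (ad y w))
  (lt_mu : forall x y w, lt z w -> lt x y -> lt (mu x w) (mu y w))
  (lt_sub : forall x y, lt x y -> exists w, ad x w = y)
  (lt01 : lt z o)
  (ge1 : forall x, lt z x -> lt o x \/ o = x)
  (ge0 : forall x, lt z x \/ z = x).

Lemma semiring : semi_ring_theory z o ad mu (@eq A).
Proof.
split=> // *.
- by rewrite adC ad0.
- by rewrite muC mu1.
- by rewrite muC mu0.
- by rewrite muC muD muC [X in ad _ X]muC.
Qed.
Add Ring semiring_A : semiring.

Lemma ad_canc x y w : ad x w = ad y w -> x = y.
Proof.
move=> E; case: (lt_total x y) => [|[//|]] => /(lt_ad w); rewrite E => /lt_irr //.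
Qed.

Lemma mu_canc x y w : lt z w -> mu x w = mu y w -> x = y.
Proof.
by move=> w0 E; case: (lt_total x y) => [|[//|]] => /(lt_mu w0); rewrite E => /lt_irr.
Qed.

Lemma lt_ad_canc x y w : lt (ad x w) (ad y w) -> lt x y.
Proof.
move=> L; case: (lt_total x y) => [//|[E|/(lt_ad w) L']].
  by rewrite E in L; case: (lt_irr L).
by case: (lt_irr (lt_trans L L')).
Qed.

Lemma lt_mu_canc x y w : lt z w -> lt (mu x w) (mu y w) -> lt x y.
Proof.
move=> w0 L; case: (lt_total x y) => [//|[E|/(lt_mu w0) L']].
  by rewrite E in L; case: (lt_irr L).
by case: (lt_irr (lt_trans L L')).
Qed.

Lemma lt_succ x : lt z (ad x o).
Proof.
have L : lt x (ad x o) by have := lt_ad x lt01; rewrite adC ad0 adC.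
by case: (ge0 x) => [H|->//]; apply: lt_trans H L.
Qed.

Lemma succ_ex x : lt z x -> exists y, x = ad y o.
Proof.
case/ge1 => [/lt_sub [w <-]|<-]; first by exists w; rewrite adC.
by exists z; rewrite adC ad0.
Qed.

(* [(a, b, c)] represents [(a - b) / (c + 1)]. *)
Definition pre : Type := (A * A * A)%type.
Definition pp (u : pre) := u.1.1.
Definition pn (u : pre) := u.1.2.
Definition pd (u : pre) := ad u.2 o.
Definition pden (c d : A) := ad (ad (mu c d) c) d.

Definition preq (u v : pre) : Prop :=
  ad (mu (pp u) (pd v)) (mu (pn v) (pd u)) = ad (mu (pp v) (pd u)) (mu (pn u) (pd v)).

Lemma preq_refl u : preq u u.
Proof. by []. Qed.

Lemma preq_sym u v : preq u v -> preq v u.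
Proof. by rewrite /preq. Qed.

Lemma preq_trans u v w : preq u v -> preq v w -> preq u w.
Proof.
rewrite /preq => E1 E2; apply: (@mu_canc _ _ (pd v)); first exact: lt_succ.
(* Without subtraction the numerator of [v] cannot be eliminated directly: after multiplication by
   its denominator its terms are added to both sides and cancelled. *)
apply: (@ad_canc _ _ (ad (mu (pn v) (mu (pd u) (pd w))) (mu (pp v) (mu (pd u) (pd w))))).
transitivity (ad (mu (ad (mu (pp u) (pd v)) (mu (pn v) (pd u))) (pd w))
   (mu (ad (mu (pp v) (pd w)) (mu (pn w) (pd v))) (pd u))); first by ring.
by rewrite E1 E2; ring.
Qed.

Definition K : Type := quot preq.
Notation cl := (cls preq_refl preq_sym preq_trans).

Lemma clE u v : cl u = cl v <-> preq u v.
Proof. exact: cls_eq. Qed.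

Lemma clP (x : K) : exists u, x = cl u.
Proof. by exists (rep x); rewrite cls_rep. Qed.

Lemma rep_cl u : preq u (rep (cl u)).
Proof. exact: rep_cls. Qed.

Definition padd (u v : pre) : pre :=
  (ad (mu (pp u) (pd v)) (mu (pp v) (pd u)),
   ad (mu (pn u) (pd v)) (mu (pn v) (pd u)), pden u.2 v.2).
Definition pmul (u v : pre) : pre :=
  (ad (mu (pp u) (pp v)) (mu (pn u) (pn v)),
   ad (mu (pp u) (pn v)) (mu (pn u) (pp v)), pden u.2 v.2).
Definition popp (u : pre) : pre := (pn u, pp u, u.2).
Definition kadd (x y : K) : K := cl (padd (rep x) (rep y)).
Definition kmul (x y : K) : K := cl (pmul (rep x) (rep y)).
Definition kopp (x : K) : K := cl (popp (rep x)).
Definition kemb (a : A) : K := cl (a, z, z).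

Ltac pre_ring := rewrite /preq /padd /pmul /popp /pden /pd /pp /pn /=.

Lemma padd_compat u u' v v' : preq u u' -> preq v v' -> preq (padd u v) (padd u' v').
Proof.
move: u u' v v' => [[a b] c] [[a' b'] c'] [[d e] f] [[d' e'] f']; pre_ring => Eu Ev.
transitivity (ad (mu (ad (mu a (ad c' o)) (mu b' (ad c o))) (mu (ad f o) (ad f' o)))
  (mu (ad (mu d (ad f' o)) (mu e' (ad f o))) (mu (ad c o) (ad c' o)))); first by ring.
by rewrite Eu Ev; ring.
Qed.

Lemma pmul_compat_l u u' v : preq u u' -> preq (pmul u v) (pmul u' v).
Proof.
move: u u' v => [[a b] c] [[a' b'] c'] [[d e] f]; pre_ring => Eu.
transitivity (mu (ad f o) (ad (mu d (ad (mu a (ad c' o)) (mu b' (ad c o))))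
  (mu e (ad (mu a' (ad c o)) (mu b (ad c' o)))))); first by ring.
transitivity (mu (ad f o) (ad (mu d (ad (mu a' (ad c o)) (mu b (ad c' o))))
  (mu e (ad (mu a (ad c' o)) (mu b' (ad c o)))))); last by ring.
by rewrite Eu.
Qed.

Lemma pmulC u v : preq (pmul u v) (pmul v u).
Proof. by move: u v => [[a b] c] [[d e] f]; pre_ring; ring. Qed.

Lemma pmul_compat u u' v v' : preq u u' -> preq v v' -> preq (pmul u v) (pmul u' v').
Proof.
move=> Eu Ev; apply: (@preq_trans _ (pmul u' v)); first exact: pmul_compat_l.
apply: preq_trans (pmulC _ _) _; apply: preq_trans (pmulC _ _).
exact: pmul_compat_l.
Qed.

Lemma popp_compat u v : preq u v -> preq (popp u) (popp v).
Proof.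
move: u v => [[a b] c] [[d e] f]; pre_ring => E.
by rewrite adC -E adC.
Qed.

Lemma kaddE u v : kadd (cl u) (cl v) = cl (padd u v).
Proof. by apply/clE/padd_compat; apply/preq_sym/rep_cl. Qed.

Lemma kmulE u v : kmul (cl u) (cl v) = cl (pmul u v).
Proof. by apply/clE/pmul_compat; apply/preq_sym/rep_cl. Qed.

Lemma koppE u : kopp (cl u) = cl (popp u).
Proof. by apply/clE/popp_compat; apply/preq_sym/rep_cl. Qed.

Ltac kring := repeat (let u := fresh "u" in intros u; case: (clP u) => {u} [[[? ?] ?] ->]);
  rewrite ?(kaddE, kmulE, koppE); apply/clE; pre_ring; ring.

Lemma kaddA : associative kadd. Proof. by kring. Qed.
Lemma kaddC : commutative kadd. Proof. by kring. Qed.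
Lemma kadd0 : left_id (kemb z) kadd. Proof. by rewrite /kemb; kring. Qed.
Lemma kaddN : left_inverse (kemb z) kopp kadd. Proof. by rewrite /kemb; kring. Qed.
Lemma kmulA : associative kmul. Proof. by kring. Qed.
Lemma kmulC : commutative kmul. Proof. by kring. Qed.
Lemma kmul1 : left_id (kemb o) kmul. Proof. by rewrite /kemb; kring. Qed.
Lemma kmulD : left_distributive kmul kadd. Proof. by kring. Qed.

Lemma kemb_inj a b : kemb a = kemb b -> a = b.
Proof.
move/clE; pre_ring => E.
have : ad a z = ad b z; last by rewrite !ad0.
transitivity (ad (mu a (ad z o)) (mu z (ad z o))); first by ring.
by rewrite E; ring.
Qed.

Lemma kemb_add a b : kemb (ad a b) = kadd (kemb a) (kemb b).
Proof. by rewrite /kemb; kring. Qed.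

Lemma kemb_mul a b : kemb (mu a b) = kmul (kemb a) (kemb b).
Proof. by rewrite /kemb; kring. Qed.

Lemma kone_neq0 : kemb o <> kemb z.
Proof. by move/kemb_inj => E; have := lt01; rewrite E => /lt_irr. Qed.

(** A nonzero numerator has absolute value of the form [d + 1], which is just the form of a
    denominator, so numerator and denominator can be exchanged, with the sign kept. *)
Lemma kinv_ex (x : K) : x <> kemb z -> exists y, kmul y x = kemb o.
Proof.
case: (clP x) => [[[a b] c] ->] H.
case: (lt_total a b) => [/lt_sub [w]|[E|/lt_sub [w]]].
- have [/succ_ex [d ->] <-|<-] := ge0 w.
    by exists (cl (z, ad c o, d)); rewrite kmulE; apply/clE; pre_ring; ring.
  by rewrite ad0 => E; case: H; rewrite E; apply/clE; pre_ring; ring.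
- by case: H; rewrite E; apply/clE; pre_ring; ring.
- have [/succ_ex [d ->] <-|<-] := ge0 w.
    by exists (cl (ad c o, z, d)); rewrite kmulE; apply/clE; pre_ring; ring.
  by rewrite ad0 => E; case: H; rewrite E; apply/clE; pre_ring; ring.
Qed.

Definition nneg (u : pre) : Prop := ~ lt (pp u) (pn u).

Lemma nneg_compat u v : preq u v -> nneg u -> nneg v.
Proof.
move: u v => [[a b] c] [[d e] f]; rewrite /nneg; pre_ring => E H L; apply: H.
have cp := lt_succ c; have fp := lt_succ f.
apply: (@lt_mu_canc _ _ (ad f o)) => //.
apply: (@lt_ad_canc _ _ (mu e (ad c o))).
by rewrite E [X in lt _ X]adC; apply: lt_ad; apply: lt_mu.
Qed.

Definition kge0 (x : K) : Prop := nneg (rep x).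

Lemma kge0E u : kge0 (cl u) <-> nneg u.
Proof.
split; first by apply: nneg_compat; apply/preq_sym/rep_cl.
by apply: nneg_compat; apply: rep_cl.
Qed.

Lemma nlt_sub a b : ~ lt a b -> exists w, a = ad b w.
Proof.
by case: (lt_total a b) => [//|[->|/lt_sub [w <-]]] _; [exists z; rewrite ad0|exists w].
Qed.

Lemma nlt0 a : ~ lt a z.
Proof. by move=> L; case: (ge0 a) => [/(lt_trans L) /lt_irr|E] //; rewrite E in L; case: (lt_irr L). Qed.

Lemma nlt_adr a w : ~ lt (ad a w) a.
Proof. by move=> L; apply: (@nlt0 w); apply: (@lt_ad_canc _ _ a); rewrite [ad z a]adC ad0 adC. Qed.

Lemma kge0_add x y : kge0 x -> kge0 y -> kge0 (kadd x y).
Proof.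
case: (clP x) (clP y) => [[[a b] c] ->] [[[d e] f] ->].
rewrite kaddE !kge0E /nneg; pre_ring => /nlt_sub [w ->] /nlt_sub [v ->].
have -> : ad (mu (ad b w) (ad f o)) (mu (ad e v) (ad c o)) =
  ad (ad (mu b (ad f o)) (mu e (ad c o))) (ad (mu w (ad f o)) (mu v (ad c o))) by ring.
exact: nlt_adr.
Qed.

Lemma kge0_mul x y : kge0 x -> kge0 y -> kge0 (kmul x y).
Proof.
case: (clP x) (clP y) => [[[a b] c] ->] [[[d e] f] ->].
rewrite kmulE !kge0E /nneg; pre_ring => /nlt_sub [w ->] /nlt_sub [v ->].
have -> : ad (mu (ad b w) (ad e v)) (mu b e) =
  ad (ad (mu (ad b w) e) (mu b (ad e v))) (mu w v) by ring.
exact: nlt_adr.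
Qed.

Lemma kge0_anti x : kge0 x -> kge0 (kopp x) -> x = kemb z.
Proof.
case: (clP x) => [[[a b] c] ->].
rewrite koppE !kge0E /nneg; pre_ring => H1 H2.
case: (lt_total a b) => [//|[->|//]].
by apply/clE; pre_ring; ring.
Qed.

Lemma kge0_total x : kge0 x \/ kge0 (kopp x).
Proof.
case: (clP x) => [[[a b] c] ->].
rewrite koppE !kge0E /nneg; pre_ring.
case: (lt_total a b) => [L|[->|L]].
- by right => /(lt_trans L) /lt_irr.
- by left => /lt_irr.
- by left => /(lt_trans L) /lt_irr.
Qed.

Lemma kemb_sub_ge0 a b : kge0 (kadd (kemb b) (kopp (kemb a))) <-> ~ lt b a.
Proof.
rewrite /kemb koppE kaddE kge0E /nneg; pre_ring.
have -> : ad (mu b (ad z o)) (mu z (ad z o)) = b by ring.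
by have -> : ad (mu z (ad z o)) (mu a (ad z o)) = a by ring.
Qed.

HB.instance Definition _ := hasDecEq.Build K (fun x y => asbP (x = y)).

Definition kfind (P : pred K) (n : nat) : option K :=
  if asb (exists x, P x) then Some (epsilon (inhabits (kemb z)) (fun x => P x)) else None.

Lemma kfind_correct (P : pred K) n x : kfind P n = Some x -> P x.
Proof.
rewrite /kfind; case: asbP => // H [<-].
exact: (epsilon_spec (inhabits (kemb z)) (fun x => P x)).
Qed.

Lemma kfind_complete (P : pred K) : (exists x, P x) -> exists n, kfind P n.
Proof. by move=> H; exists 0; rewrite /kfind; case: asbP. Qed.

Lemma kfind_ext (P Q : pred K) : P =1 Q -> kfind P =1 kfind Q.
Proof.
by move=> E n; have -> : P = Q by apply: FunctionalExtensionality.functional_extensionality.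
Qed.

HB.instance Definition _ := hasChoice.Build K kfind_correct kfind_complete kfind_ext.
HB.instance Definition _ := GRing.isZmodule.Build K kaddA kaddC kadd0 kaddN.

Lemma kone_neq0b : kemb o != kemb z.
Proof. by apply/eqP/kone_neq0. Qed.

HB.instance Definition _ :=
  GRing.Zmodule_isComNzRing.Build K kmulA kmulC kmul1 kmulD kone_neq0b.

Definition kinv (x : K) : K :=
  if x == 0%R then 0%R else epsilon (inhabits (0%R : K)) (fun y => kmul y x = kemb o).

Lemma kmulV (x : K) : x != 0%R -> (kinv x * x = 1)%R.
Proof.
move=> x0; rewrite /kinv (negbTE x0); have H := kinv_ex (elimN eqP x0).
exact: (epsilon_spec (inhabits (0%R : K)) (fun y => kmul y x = kemb o)).
Qed.

Lemma kinv0 : kinv 0%R = 0%R.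
Proof. by rewrite /kinv eqxx. Qed.

HB.instance Definition _ := GRing.ComNzRing_isField.Build K kmulV kinv0.

Definition kle (x y : K) : bool := asb (kge0 (y - x)%R).
Definition knorm (x : K) : K := if kle 0%R x then x else (- x)%R.

Lemma kle0E (x : K) : reflect (kge0 x) (kle 0%R x).
Proof. by rewrite /kle subr0; apply: asbP. Qed.

Lemma kle_E0 (x : K) : reflect (kge0 (kopp x)) (kle x 0%R).
Proof. by rewrite /kle sub0r; apply: asbP. Qed.

Lemma kle_anti (x : K) : kle 0%R x -> kle x 0%R -> x = 0%R.
Proof. by move/kle0E => H1 /kle_E0; apply: kge0_anti. Qed.

Lemma kle0_add (x y : K) : kle 0%R x -> kle 0%R y -> kle 0%R (x + y)%R.
Proof. by move=> /kle0E H /kle0E H'; apply/kle0E/kge0_add. Qed.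

Lemma kle0_mul (x y : K) : kle 0%R x -> kle 0%R y -> kle 0%R (x * y)%R.
Proof. by move=> /kle0E H /kle0E H'; apply/kle0E/kge0_mul. Qed.

Lemma ksub_ge0 (x y : K) : kle 0%R (y - x)%R = kle x y.
Proof. by rewrite /kle subr0. Qed.

Lemma kle_total (x : K) : kle 0%R x || kle x 0%R.
Proof. by case: (kge0_total x) => [/kle0E ->|/kle_E0 ->] //; rewrite orbT. Qed.

Lemma knormN (x : K) : knorm (- x)%R = knorm x.
Proof.
rewrite /knorm; have := kle_total x.
have -> : kle 0%R (- x)%R = kle x 0%R by rewrite /kle subr0 sub0r.
case H1: (kle 0%R x); case H2: (kle x 0%R) => // _; last by rewrite opprK.
by rewrite (kle_anti H1 H2) oppr0.
Qed.

Lemma kge0_norm (x : K) : kle 0%R x -> knorm x = x.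
Proof. by rewrite /knorm => ->. Qed.

HB.instance Definition _ := Num.IntegralDomain_isLeReal.Build K
  kle0_add kle0_mul kle_anti ksub_ge0 kle_total knormN kge0_norm (fun _ _ => erefl).

(** The order is reflected as well as preserved, so inequalities of the semiring can be decided in
    the field, where [lra], [nra] and [ring] work. *)
Lemma fraction_field : exists (F : realFieldType) (i : A -> F),
  [/\ i z = 0%R, i o = 1%R, (forall x y, i (ad x y) = i x + i y)%R,
      (forall x y, i (mu x y) = i x * i y)%R &
      forall x y, lt x y <-> (i x < i y)%R].
Proof.
exists (K : realFieldType), kemb; split=> // [||x y]; [exact: kemb_add|exact: kemb_mul|].
rewrite ltNge; have -> : (kemb y <= kemb x)%R = kle (kemb y) (kemb x) by [].
rewrite /kle; case: asbP => /kemb_sub_ge0 H; split=> //.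
by move=> _; case: (classic (lt x y)).
Qed.

End FractionField.

(** * Bounded formulas with constants *)

(** Parameters are built in as constants, so that formulas can be combined without a record of which
    index of an assignment holds which parameter. Bounded formulas have no set quantifiers, hence
    set positions hold constants only. *)
Inductive cform (A B : Type) : Type :=
| cbot
| ceq (s t : term (nat + A))
| clt (s t : term (nat + A))
| cmem (t : term (nat + A)) (X : B)
| cimp (p q : cform A B)
| call (t : term (nat + A)) (p : cform A B).
Arguments cbot {A B}.
Arguments ceq {A B}.
Arguments clt {A B}.

Definition cval (M : model) (e : nat -> dom M) (t : term (nat + dom M)) : dom M :=
  tval (fun v => match v with inl i => e i | inr a => a end) t.

Fixpoint csat (M : model) (e : nat -> dom M) (q : cform (dom M) (sets M)) : Prop :=
  match q with
  | cbot => False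
  | ceq s t => cval e s = cval e t
  | clt s t => mlt (cval e s) (cval e t)
  | cmem t X => mmem (cval e t) X
  | cimp p q => csat e p -> csat e q
  | call t p => forall x, mlt x (cval e t) -> csat (scons x e) p
  end.

Section Substitution.
Variables (A B : Type).

Definition ctsub (s : nat -> term (nat + A)) (t : term (nat + A)) : term (nat + A) :=
  tbind (fun v => match v with inl i => s i | inr a => tvar (inr a) end) t.

Definition cup (s : nat -> term (nat + A)) (n : nat) : term (nat + A) :=
  match n with
  | 0 => tvar (inl 0)
  | S i => ctsub (fun j => tvar (inl (S j))) (s i)
  end.

Fixpoint csub (s : nat -> term (nat + A)) (q : cform A B) : cform A B :=
  match q with
  | cbot => cbot
  | ceq t u => ceq (ctsub s t) (ctsub s u)
  | clt t u => clt (ctsub s t) (ctsub s u)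
  | cmem t X => cmem (ctsub s t) X
  | cimp p q => cimp (csub s p) (csub s q)
  | call t p => call (ctsub s t) (csub (cup s) p)
  end.

Fixpoint csets (q : cform A B) : list B :=
  match q with
  | cbot | ceq _ _ | clt _ _ => nil
  | cmem _ X => X :: nil
  | cimp p q => csets p ++ csets q
  | call _ p => csets p
  end.

Lemma csets_csub s q : csets (csub s q) = csets q.
Proof. by elim: q s => //= p IHp q IHq s; rewrite IHp IHq. Qed.

Fixpoint tconsts (t : term (nat + A)) : list A :=
  match t with
  | tvar (inr a) => a :: nil
  | tvar (inl _) | tzero | tone => nil
  | tadd s t | tmul s t => tconsts s ++ tconsts t
  end.

Fixpoint cconsts (q : cform A B) : list A :=
  match q with
  | cbot => nil
  | ceq s t | clt s t => tconsts s ++ tconsts t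
  | cmem t _ => tconsts t
  | cimp p q => cconsts p ++ cconsts q
  | call t p => tconsts t ++ cconsts p
  end.

Fixpoint tcbound (t : term (nat + A)) : nat :=
  match t with
  | tvar (inl i) => S i
  | tvar (inr _) | tzero | tone => 0
  | tadd s t | tmul s t => Nat.max (tcbound s) (tcbound t)
  end.

Fixpoint cbound (q : cform A B) : nat :=
  match q with
  | cbot => 0
  | ceq s t | clt s t => Nat.max (tcbound s) (tcbound t)
  | cmem t _ => tcbound t
  | cimp p q => Nat.max (cbound p) (cbound q)
  | call t p => Nat.max (tcbound t) (Nat.pred (cbound p))
  end.

(* The constants become variables above the first [k], numbered by [rA], [rB]. *)
Variables (rA : A -> nat) (rB : B -> nat).

Definition tabs (k : nat) (t : term (nat + A)) : term nat :=
  tbind (fun v => tvar match v with inl i => i | inr a => k + rA a end) t.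

Fixpoint cabs (k : nat) (q : cform A B) : form :=
  match q with
  | cbot => fbot
  | ceq s t => feq (tabs k s) (tabs k t)
  | clt s t => flt (tabs k s) (tabs k t)
  | cmem t X => fmem (tabs k t) (rB X)
  | cimp p q => fimp (cabs k p) (cabs k q)
  | call t p => fallN (fimp (flt (tvar 0) (tlift (tabs k t))) (cabs (S k) p))
  end.

Lemma cabs_Delta0 k q : Delta0 (cabs k q).
Proof. by elim: q k => *; constructor. Qed.

End Substitution.

Lemma cval_ctsub (M : model) (e : nat -> dom M) s t :
  cval e (ctsub s t) = cval (fun i => cval e (s i)) t.
Proof.
rewrite /cval /ctsub tval_tbind; congr (tval _ t).
by apply: functional_extensionality => -[].
Qed.

Lemma csat_csub (M : model) q (e : nat -> dom M) s :
  csat e (csub s q) <-> csat (fun i => cval e (s i)) q.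
Proof.
elim: q e s => //= [t u|t u|t X|p IHp q IHq|t p IHp] e s; rewrite ?cval_ctsub //.
  by rewrite IHp IHq.
have E x : (fun i => cval (scons x e) (cup s i)) = scons x (fun i => cval e (s i)).
  by apply: functional_extensionality => -[//|i] /=; rewrite cval_ctsub.
by split=> H x /H; rewrite IHp E.
Qed.

Definition mixenv (A : Type) (k : nat) (e ps : nat -> A) (i : nat) : A :=
  if Nat.ltb i k then e i else ps (i - k).

Lemma scons_mixenv (A : Type) k (x : A) e ps :
  scons x (mixenv k e ps) = mixenv (S k) (scons x e) ps.
Proof. by apply: functional_extensionality => -[]. Qed.

Lemma tval_tabs (M : model) rA k (e ps : nat -> dom M) t :
  tcbound t <= k -> (forall a, In a (tconsts t) -> ps (rA a) = a) ->
  tval (mixenv k e ps) (tabs rA k t) = cval e t.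
Proof.
elim: t => //= [[i|a]|s IHs t IHt|s IHs t IHt] Hk Hc.
- by rewrite /mixenv; case: Nat.ltb_spec => //; lia.
- rewrite /mixenv; case: Nat.ltb_spec => [|_]; first by lia.
  by rewrite (_ : k + rA a - k = rA a) ?Hc //; [left|lia].
- by rewrite IHs ?IHt //; try lia; move=> a Ha; apply: Hc; apply: in_or_app; auto.
- by rewrite IHs ?IHt //; try lia; move=> a Ha; apply: Hc; apply: in_or_app; auto.
Qed.

Lemma tval_scons_lift (M : model) (e : nat -> dom M) x t :
  tval (scons x e) (tlift t) = tval e t.
Proof. by rewrite tval_tbind. Qed.

Lemma sat_cabs (M : model) rA rB k (e ps : nat -> dom M) (ss : nat -> sets M) q :
  cbound q <= k -> (forall a, In a (cconsts q) -> ps (rA a) = a) ->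
  (forall X, In X (csets q) -> ss (rB X) = X) ->
  sat (mixenv k e ps) ss (cabs rA rB k q) <-> csat e q.
Proof.
elim: q k e => //= [s t|s t|t X|p IHp q IHq|t p IHp] k e Hk Hc HX.
- by rewrite !tval_tabs //; try lia; move=> a Ha; apply: Hc; apply: in_or_app; auto.
- by rewrite !tval_tabs //; try lia; move=> a Ha; apply: Hc; apply: in_or_app; auto.
- by rewrite tval_tabs // HX //; left.
- rewrite IHp ?IHq //; try lia; move=> a Ha; first [apply: Hc|apply: HX];
    apply: in_or_app; auto.
- have E x : sat (scons x (mixenv k e ps)) ss (cabs rA rB (S k) p) <-> csat (scons x e) p.
    rewrite scons_mixenv; apply: IHp => //; first by lia.
    by move=> a Ha; apply: Hc; apply: in_or_app; right.
  split=> H x; have := H x; rewrite tval_scons_lift E tval_tabs //; try lia;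
    by move=> a Ha; apply: Hc; apply: in_or_app; left.
Qed.

(** Only finitely many constants occur in a formula, so a single assignment can hold them all. *)
Lemma rank_exists (A : Type) (d : A) (l : list A) :
  exists (r : A -> nat) (ps : nat -> A), forall a, In a l -> ps (r a) = a.
Proof.
exists (fun a => epsilon (inhabits 0) (fun j => nth j l d = a)), (fun j => nth j l d).
move=> a /(@In_nth _ _ _ d) [j [_ Hj]].
exact: (epsilon_spec (inhabits 0) (fun j => nth j l d = a) (ex_intro _ j Hj)).
Qed.

(** * Models of RCA0 *)

(* The first-order part is embedded in an ordered field, and Sigma01 induction
   and Delta01 comprehension are stated for bounded formulas with parameters
   from the model instead of assignments. *)
Record rca0 : Type := Rca0 {
  rmodel :> model;
  rfield : realFieldType;
  emb : dom rmodel -> rfield;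
  emb0 : (emb (mzero rmodel) = 0)%R;
  emb1 : (emb (mone rmodel) = 1)%R;
  embD : (forall x y, emb (madd x y) = emb x + emb y)%R;
  embM : (forall x y, emb (mmul x y) = emb x * emb y)%R;
  lt_emb : forall x y, mlt x y <-> (emb x < emb y)%R;
  lt_add_ex : forall x y : dom rmodel, mlt x y -> exists z, madd x z = y;
  one_le : forall x : dom rmodel, mlt (mzero rmodel) x -> ~ mlt x (mone rmodel);
  emb_ge0 : (forall x, 0 <= emb x)%R;
  emb_inj : forall x y, emb x = emb y -> x = y;
  csat_ind : forall (q : cform (dom rmodel) (sets rmodel)) e,
    let P x := exists y, csat (scons y (scons x e)) q in
    P (mzero rmodel) -> (forall x, P x -> P (madd x (mone rmodel))) -> forall x, P x;
  csat_comp : forall (p q : cform (dom rmodel) (sets rmodel)) e,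
    (forall x, (exists y, csat (scons y (scons x e)) p) <->
       (forall y, csat (scons y (scons x e)) q)) ->
    exists X : sets rmodel, forall x, mmem x X <-> exists y, csat (scons y (scons x e)) p }.

Lemma universal_closure_sat (M : model) p :
  (forall rho sig, @sat M rho sig (universal_closure p)) ->
  forall rho sig, @sat M rho sig p.
Proof.
rewrite /universal_closure; move: (boundN p) (boundS p) => m n.
have EN (A : Type) (f : nat -> A) : scons (f 0) (fun i => f (S i)) = f.
  by apply: functional_extensionality => -[].
have HS : (forall rho sig, @sat M rho sig (Nat.iter n fallS p)) ->
    forall rho sig, @sat M rho sig p.
  elim: n => //= n IH H; apply: IH => rho sig.
  by have := H rho (fun i => sig (S i)) (sig 0); rewrite EN.
elim: m => //= m IH H; apply: IH => rho sig.
by have := H (fun i => rho (S i)) sig (rho 0); rewrite EN.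
Qed.

(** * Induction and comprehension with constants, from satisfaction of the axioms *)

Section FromModel.
Variable M : model.
Hypothesis HM : forall p, RCA0 p -> forall rho sig, @sat M rho sig p.
Variable X0 : sets M.

Lemma sat_basic n f : nth_error PA_minus n = Some f ->
  @sat M (fun _ => mzero M) (fun _ => X0) (db f).
Proof. by move=> H; apply: HM; apply: RCA0_basic; apply: nth_error_In H. Qed.

Lemma sat_exN (rho : nat -> dom M) sig p :
  sat rho sig (fexN p) <-> exists x, sat (scons x rho) sig p.
Proof.
split=> [H|[x Hx] H]; last exact: (H x).
by apply: NNPP => nx; apply: H => x Hx; apply: nx; exists x.
Qed.

Lemma sat_exS (rho : nat -> dom M) sig p :
  sat rho sig (fexS p) <-> exists x, sat rho (scons x sig) p.
Proof.
split=> [H|[x Hx] H]; last exact: (H x).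
by apply: NNPP => nx; apply: H => x Hx; apply: nx; exists x.
Qed.

Lemma sat_and (rho : nat -> dom M) sig p q :
  sat rho sig (fand p q) <-> sat rho sig p /\ sat rho sig q.
Proof.
split=> /= [H|[Hp Hq] H]; last exact: H.
by split; apply: NNPP => n; apply: H => // Hp Hq; apply: n.
Qed.

Lemma sat_iff (rho : nat -> dom M) sig p q :
  sat rho sig (fiff p q) <-> (sat rho sig p <-> sat rho sig q).
Proof. by rewrite sat_and. Qed.

Lemma model_ind (q : cform (dom M) (sets M)) e (P := fun x => exists y, csat (scons y (scons x e)) q) :
  P (mzero M) -> (forall x, P x -> P (madd x (mone M))) -> forall x, P x.
Proof.
move=> P0 PS.
have [rA [ps Hps]] := rank_exists (mzero M) (cconsts q).
have [rB [ss Hss]] := rank_exists X0 (csets q).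
(* [k] exceeds the free variables of [q], so an assignment that is [e] below [k] and lists the
   constants above it serves both purposes. *)
pose k := cbound q; pose f := fexN (cabs rA rB (S (S k)) q).
have Hf x : sat (scons x (mixenv k e ps)) ss f <-> P x.
  rewrite sat_exN; split=> -[y Hy]; exists y; move: Hy;
    by rewrite !scons_mixenv sat_cabs //; rewrite /k; lia.
have Sf : Sigma01 f by exists (cabs rA rB (S (S k)) q); split=> //; apply: cabs_Delta0.
clearbody f; have /universal_closure_sat := HM (RCA0_induction Sf).
move/(_ (mixenv k e ps) ss); rewrite /induction_axiom /=.
move=> H x; apply/Hf; apply: H => H; apply: H.
  rewrite /instN sat_fsubst; move/Hf: P0; apply: iffLR.
  by apply: sat_bound => // -[].
move=> y /Hf /PS /Hf; apply: iffLR; rewrite sat_fsubst.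
by apply: sat_bound => // -[].
Qed.

Lemma model_comp (p q : cform (dom M) (sets M)) e :
  (forall x, (exists y, csat (scons y (scons x e)) p) <->
     (forall y, csat (scons y (scons x e)) q)) ->
  exists X, forall x, mmem x X <-> exists y, csat (scons y (scons x e)) p.
Proof.
move=> E.
have [rA [ps Hps]] := rank_exists (mzero M) (cconsts p ++ cconsts q).
have [rB [ss Hss]] := rank_exists X0 (csets p ++ csets q).
pose k := cbound p + cbound q.
pose f := fexN (cabs rA rB (S (S k)) p); pose g := fallN (cabs rA rB (S (S k)) q).
have Hf x : sat (scons x (mixenv k e ps)) ss f <-> exists y, csat (scons y (scons x e)) p.
  have A y : sat (scons y (scons x (mixenv k e ps))) ss (cabs rA rB (S (S k)) p) <->
      csat (scons y (scons x e)) p.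
    rewrite !scons_mixenv sat_cabs //; try (rewrite /k; lia);
      by move=> a Ha; first [apply: Hps|apply: Hss]; apply: in_or_app; left.
  by rewrite sat_exN; split=> -[y /A Hy]; exists y.
have Hg x : sat (scons x (mixenv k e ps)) ss g <-> forall y, csat (scons y (scons x e)) q.
  have A y : sat (scons y (scons x (mixenv k e ps))) ss (cabs rA rB (S (S k)) q) <->
      csat (scons y (scons x e)) q.
    rewrite !scons_mixenv sat_cabs //; try (rewrite /k; lia);
      by move=> a Ha; first [apply: Hps|apply: Hss]; apply: in_or_app; right.
  by split=> H y; apply/A/H.
have Sf : Sigma01 f by exists (cabs rA rB (S (S k)) p); split=> //; apply: cabs_Delta0.
have Sg : Pi01 g by exists (cabs rA rB (S (S k)) q); split=> //; apply: cabs_Delta0.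
clearbody f g; have /universal_closure_sat := HM (RCA0_comprehension Sf Sg).
move/(_ (mixenv k e ps) ss) => H.
have /sat_exS [X HX] : sat (mixenv k e ps) ss
    (fexS (fallN (fiff (fmem (tvar 0) 0) (liftS f)))).
  by apply: H => x; apply/sat_iff; rewrite Hf Hg.
exists X => x.
have : sat (scons x (mixenv k e ps)) (scons X ss) (fiff (fmem (tvar 0) 0) (liftS f)).
  exact: HX x.
rewrite sat_iff -Hf => HX'; apply: iff_trans HX' _.
by rewrite /liftS sat_fsubst; apply: sat_bound.
Qed.

Theorem rca0_of_model : exists R : rca0, rmodel R = M.
Proof.
have ax n := sat_basic n.
(* Satisfaction of a translated axiom is convertible to its reading in the model; only the
   disjunctions and the existential quantifier, which are coded by negation, take classical
   reasoning. *)
have A1 : forall x y w : dom M, madd (madd x y) w = madd x (madd y w) by exact: (sat_basic (n:=0) erefl).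
have A2 : forall x y : dom M, madd x y = madd y x by exact: (sat_basic (n:=1) erefl).
have A3 : forall x y w : dom M, mmul (mmul x y) w = mmul x (mmul y w) by exact: (sat_basic (n:=2) erefl).
have A4 : forall x y : dom M, mmul x y = mmul y x by exact: (sat_basic (n:=3) erefl).
have A5 : forall x y w : dom M, mmul x (madd y w) = madd (mmul x y) (mmul x w)
  by exact: (sat_basic (n:=4) erefl).
have A6 : forall x : dom M, madd x (mzero M) = x by exact: (sat_basic (n:=5) erefl).
have A7 : forall x : dom M, mmul x (mzero M) = mzero M by exact: (sat_basic (n:=6) erefl).
have A8 : forall x : dom M, mmul x (mone M) = x by exact: (sat_basic (n:=7) erefl).
have A9 : forall x y w : dom M, mlt x y -> mlt y w -> mlt x w by exact: (sat_basic (n:=8) erefl).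
have A10 : forall x : dom M, ~ mlt x x by exact: (sat_basic (n:=9) erefl).
have A11 : forall x y : dom M, mlt x y \/ x = y \/ mlt y x.
  move=> x y; have := (sat_basic (n:=10) erefl) x y => /= H.
  case: (classic (mlt x y)) => [|n1]; first by left.
  by right; case: (classic (x = y)) => [|n2]; [left|right; apply: H].
have A12 : forall x y w : dom M, mlt x y -> mlt (madd x w) (madd y w) by exact: (sat_basic (n:=11) erefl).
have A13 : forall x y w : dom M, mlt (mzero M) w -> mlt x y -> mlt (mmul x w) (mmul y w)
  by exact: (sat_basic (n:=12) erefl).
have A14 : forall x y : dom M, mlt x y -> exists w, madd x w = y.
  move=> x y L; apply: NNPP => n; apply: ((sat_basic (n:=13) erefl) x y L) => /= w E.
  by apply: n; exists w.
have A15 : mlt (mzero M) (mone M) by exact: (sat_basic (n:=14) erefl).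
have A16 : forall x : dom M, mlt (mzero M) x -> mlt (mone M) x \/ mone M = x.
  move=> x L; have := (sat_basic (n:=15) erefl) x L => /= H.
  by case: (classic (mlt (mone M) x)) => [|/H]; [left|right].
have A17 : forall x : dom M, mlt (mzero M) x \/ mzero M = x.
  move=> x; have := (sat_basic (n:=16) erefl) x => /= H.
  by case: (classic (mlt (mzero M) x)) => [|/H]; [left|right].
have [F [i [i0 i1 iD iM iL]]] :=
  fraction_field A1 A2 A3 A4 A5 A6 A7 A8 A9 A10 A11 A12 A13 A14 A15 A16 A17.
unshelve eexists (@Rca0 M F i i0 i1 iD iM iL A14 _ _ _ model_ind model_comp).
- move=> x x0 x1; case: (A16 x x0) => [L|E]; first exact: (A10 _ (A9 _ _ _ x1 L)).
  by rewrite -E in x1; apply: A10 x1.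
- move=> x; rewrite -i0; case: (A17 x) => [/iL /Order.POrderTheory.ltW //|<-].
  exact: Order.POrderTheory.lexx.
- move=> x y E; case: (A11 x y) => [|[//|]] /iL; by rewrite E Order.POrderTheory.ltxx.
- by [].
Qed.

End FromModel.

From mathcomp Require Import ring lra.

(** * Arithmetic in a model *)

Declare Scope n_scope.
Delimit Scope n_scope with n.
Bind Scope n_scope with dom.
Notation n0 := (mzero _).
Notation n1 := (mone _).
Notation n2 := (madd n1 n1).
Notation "x + y" := (madd x y) : n_scope.
Notation "x * y" := (mmul x y) : n_scope.
Notation "x < y" := (mlt x y) : n_scope.
Definition nle (R : rca0) (x y : dom R) : Prop := ~ mlt y x.
Notation "x <= y" := (nle x y) : n_scope.
Local Open Scope n_scope.

Lemma iff_refl_eq (P Q : Prop) : P = Q -> P <-> Q.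
Proof. by move=> ->. Qed.

Section Arithmetic.
Variable R : rca0.
Notation N := (dom R).
Implicit Types x y z : N.

(** Discreteness: a positive difference is at least 1. In this form a strict inequality of numbers
    loses nothing in the field. *)
Lemma lt_iff x y : x < y <-> (emb x + 1 <= emb y)%R.
Proof.
split=> [L|L]; last by apply/lt_emb; lra.
have [z E] := lt_add_ex L; move: L; rewrite -E => /lt_emb; rewrite embD => L.
have z0 : n0 < z by apply/lt_emb; rewrite emb0; lra.
have : ~ (emb z < emb (n1 : N))%R by move/lt_emb; apply: one_le.
by rewrite emb1 => /negP; rewrite -leNgt => H; lra.
Qed.

Lemma le_iff x y : x <= y <-> (emb x <= emb y)%R.
Proof.
rewrite /nle; split=> [H|H /lt_emb]; last by rewrite ltNge H.
by rewrite leNgt; apply/negP => /lt_emb.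
Qed.

Lemma nlt_iff x y : ~ x < y <-> (emb y <= emb x)%R.
Proof. exact: le_iff. Qed.

Lemma nle_iff x y : ~ x <= y <-> (emb y + 1 <= emb x)%R.
Proof. by rewrite -lt_iff; split=> [/NNPP|H H']. Qed.

Lemma nle_anti x y : x <= y -> y <= x -> x = y.
Proof. by move=> /le_iff H /le_iff H'; apply: emb_inj; lra. Qed.

Lemma false_by (F : realFieldType) : (1 <= 0 :> F)%R -> False.
Proof. by rewrite ler10. Qed.

End Arithmetic.

Ltac npose x :=
  lazymatch goal with
  | _ : is_true (0 <= emb x)%R |- _ => fail
  | |- _ => pose proof (emb_ge0 x)
  end.

Ltac nhyps :=
  repeat match goal with
  | H : mlt _ _ |- _ => apply lt_iff in H
  | H : nle _ _ |- _ => apply le_iff in H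
  | H : ~ mlt _ _ |- _ => apply nlt_iff in H
  | H : ~ nle _ _ |- _ => apply nle_iff in H
  | H : @eq (dom _) _ _ |- _ => apply (f_equal (@emb _)) in H
  end;
  repeat match goal with
  | H : context [emb (madd _ _)] |- _ => rewrite embD in H
  | H : context [emb (mmul _ _)] |- _ => rewrite embM in H
  | H : context [emb (mzero _)] |- _ => rewrite emb0 in H
  | H : context [emb (mone _)] |- _ => rewrite emb1 in H
  end;
  repeat match goal with
  | H : context [emb ?x] |- _ => npose x
  end.

Ltac ngoal :=
  lazymatch goal with
  | |- mlt _ _ => apply: NNPP => ?
  | |- nle _ _ => rewrite /nle => ?
  | |- @eq (dom _) _ _ => apply: nle_anti; rewrite /nle => ?
  | |- ~ _ => move=> ?
  | |- _ => exfalso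
  end.

(* [nlin] and [nnlin] decide inequalities of the first-order part in its field
   of fractions, where [x < y] becomes [x + 1 <= y]. *)
Ltac nlin := ngoal; nhyps; apply: false_by; lra.
Ltac nring := apply: emb_inj; rewrite ?(embD, embM, emb0, emb1); ring.
Ltac nnlin := ngoal; nhyps; apply: false_by; nra.

(** * Definability *)

(* Predicates of environments definable with arbitrary number parameters and with
   set parameters satisfying [OK]: terms, bounded formulas, Sigma01 and Delta01
   predicates, and functions with a Sigma01 graph.  A variable bound in a
   predicate is entry 0 of the environment. *)
Section Definability.
Variable R : rca0.
Notation N := (dom R).
Notation env := (nat -> N).
Implicit Types (x y z : N) (e : env).

Definition Tm (f : env -> N) : Prop := exists t, forall e, f e = cval e t.

Definition D0 (OK : sets R -> Prop) (P : env -> Prop) : Prop :=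
  exists q : cform N (sets R), (forall X, In X (csets q) -> OK X) /\
    forall e, P e <-> csat e q.

Definition Sig (OK : sets R -> Prop) (P : env -> Prop) : Prop :=
  exists Q, D0 OK Q /\ forall e, P e <-> exists y, Q (scons y e).

Definition Del OK P : Prop := Sig OK P /\ Sig OK (fun e => ~ P e).

Definition Fn OK (f : env -> N) : Prop := Sig OK (fun e => e 0 = f (fun i => e (S i))).

(** Induction and comprehension admit every set as a parameter; the other important choice of [OK]
    is computability from a fixed set, for [TLe_Del]. *)
Definition anyset (X : sets R) : Prop := True.

Lemma Tm_var k : Tm (fun e => e k).
Proof. by exists (tvar (inl k)). Qed.

Lemma Tm_cst x : Tm (fun _ => x).
Proof. by exists (tvar (inr x)). Qed.

Lemma Tm_add f g : Tm f -> Tm g -> Tm (fun e => f e + g e).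
Proof. by move=> [t Ht] [u Hu]; exists (tadd t u) => e; rewrite Ht Hu. Qed.

Lemma Tm_mul f g : Tm f -> Tm g -> Tm (fun e => f e * g e).
Proof. by move=> [t Ht] [u Hu]; exists (tmul t u) => e; rewrite Ht Hu. Qed.

Lemma Tm_choice (s : nat -> env -> N) : (forall i, Tm (s i)) ->
  exists t : nat -> term (nat + N), forall i e, s i e = cval e (t i).
Proof.
move=> H; exists (fun i => epsilon (inhabits tzero) (fun t => forall e, s i e = cval e t)) => i.
exact: (epsilon_spec (inhabits tzero) (fun t => forall e, s i e = cval e t) (H i)).
Qed.

Lemma Tm_sub f (s : nat -> env -> N) : Tm f -> (forall i, Tm (s i)) ->
  Tm (fun e => f (fun i => s i e)).
Proof.
move=> [t Ht] /Tm_choice [u Hu]; exists (ctsub u t) => e.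
by rewrite Ht cval_ctsub; congr (cval _ t); apply: functional_extensionality => i.
Qed.

Lemma Tm_lift f : Tm f -> Tm (fun e => f (fun i => e (S i))).
Proof. by move/Tm_sub; apply=> i; apply: Tm_var. Qed.

Section Sets.
Variable OK : sets R -> Prop.

Lemma D0_sub P (s : nat -> env -> N) : D0 OK P -> (forall i, Tm (s i)) ->
  D0 OK (fun e => P (fun i => s i e)).
Proof.
move=> [q [Hq HP]] /Tm_choice [u Hu]; exists (csub u q); split.
  by rewrite csets_csub.
move=> e; rewrite HP csat_csub.
by have -> : (fun i => s i e) = (fun i => cval e (u i)) by apply: functional_extensionality => i.
Qed.

Lemma D0_ext P Q : D0 OK P -> (forall e, Q e <-> P e) -> D0 OK Q.
Proof. by move=> [q [Hq HP]] E; exists q; split=> // e; rewrite E HP. Qed.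

Lemma D0_bot : D0 OK (fun _ => False).
Proof. by exists cbot. Qed.

Lemma D0_eq f g : Tm f -> Tm g -> D0 OK (fun e => f e = g e).
Proof. by move=> [t Ht] [u Hu]; exists (ceq t u); split=> // e; rewrite Ht Hu. Qed.

Lemma D0_lt f g : Tm f -> Tm g -> D0 OK (fun e => f e < g e).
Proof. by move=> [t Ht] [u Hu]; exists (clt t u); split=> // e; rewrite Ht Hu. Qed.

Lemma D0_mem f X : Tm f -> OK X -> D0 OK (fun e => mmem (f e) X).
Proof. by move=> [t Ht] HX; exists (cmem t X); split=> [Y [<-|[]]|e] //; rewrite Ht. Qed.

Lemma D0_imp P Q : D0 OK P -> D0 OK Q -> D0 OK (fun e => P e -> Q e).
Proof.
move=> [p [Hp HP]] [q [Hq HQ]]; exists (cimp p q); split=> [X|e] /=; last by rewrite HP HQ.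
by move=> HX; case: (in_app_or _ _ _ HX) => [/Hp|/Hq].
Qed.

Lemma D0_all f Q : Tm f -> D0 OK (fun e => Q (e 0) (fun i => e (S i))) ->
  D0 OK (fun e => forall y, y < f e -> Q y e).
Proof.
move=> [t Ht] [q [Hq HQ]]; exists (call t q); split=> // e /=.
by rewrite Ht; split=> H y /H; rewrite -(HQ (scons y e)).
Qed.

Lemma D0_not P : D0 OK P -> D0 OK (fun e => ~ P e).
Proof. by move/D0_imp; apply; apply: D0_bot. Qed.

Lemma D0_and P Q : D0 OK P -> D0 OK Q -> D0 OK (fun e => P e /\ Q e).
Proof.
move=> HP HQ; apply: D0_ext (D0_not (D0_imp HP (D0_not HQ))) _ => e.
split=> [[p q] n|n]; first exact: n.
by split; apply: NNPP => n'; apply: n.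
Qed.

Lemma D0_or P Q : D0 OK P -> D0 OK Q -> D0 OK (fun e => P e \/ Q e).
Proof.
move=> HP HQ; apply: D0_ext (D0_imp (D0_not HP) HQ) _ => e.
split=> [[p|q] n //|H]; case: (classic (P e)) => [|/H]; by [left|right].
Qed.

Lemma D0_ex f Q : Tm f -> D0 OK (fun e => Q (e 0) (fun i => e (S i))) ->
  D0 OK (fun e => exists y, y < f e /\ Q y e).
Proof.
move=> Tf HQ; apply: D0_ext (D0_not (@D0_all f (fun y e => ~ Q y e) Tf (D0_not HQ))) _ => e.
split=> [[y [L q]] H|H]; first exact: H L q.
by apply: NNPP => n; apply: H => y L q; apply: n; exists y.
Qed.

Lemma Sig_ext P Q : Sig OK P -> (forall e, Q e <-> P e) -> Sig OK Q.
Proof. by move=> [P' [HP' HP]] E; exists P'; split=> // e; rewrite E HP. Qed.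

Lemma Sig_D0 P : D0 OK P -> Sig OK P.
Proof.
move=> HP; exists (fun e => P (fun i => e (S i))); split.
  by apply: D0_sub HP _ => i; apply: Tm_var.
by move=> e; split=> [H|[y]]; first by exists n0.
Qed.

Lemma Sig_sub P (s : nat -> env -> N) : Sig OK P -> (forall i, Tm (s i)) ->
  Sig OK (fun e => P (fun i => s i e)).
Proof.
move=> [Q [HQ HP]] Hs.
exists (fun e => Q (fun i => match i with 0 => e 0 | S j => s j (fun i => e (S i)) end)).
split.
  apply: (D0_sub (s := fun i e => match i with 0 => e 0 | S j => s j (fun i => e (S i)) end) HQ).
  by case=> [|j]; [apply: Tm_var|apply: Tm_lift].
move=> e; rewrite HP; split=> -[y Hy]; exists y; move: Hy;
  by apply: iffLR; apply: iff_refl_eq; congr Q; apply: functional_extensionality => -[].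
Qed.

Lemma Sig_lift P : Sig OK P -> Sig OK (fun e => P (fun i => e (S i))).
Proof. by move/Sig_sub; apply=> i; apply: Tm_var. Qed.

(** The two unbounded quantifiers are contracted to one over a common strict bound of both
    witnesses; [Sig_ex] uses the same device. *)
Lemma Sig_and P Q : Sig OK P -> Sig OK Q -> Sig OK (fun e => P e /\ Q e).
Proof.
move=> [P' [DP HP]] [Q' [DQ HQ]].
exists (fun e => (exists y, y < e 0 /\ P' (scons y (fun i => e (S i)))) /\
  (exists y, y < e 0 /\ Q' (scons y (fun i => e (S i))))); split.
  have A P0 : D0 OK P0 ->
      D0 OK (fun e => exists y, y < e 0 /\ P0 (scons y (fun i => e (S i)))).
    move=> D; apply: (@D0_ex (fun e => e 0) (fun y e => P0 (scons y (fun i => e (S i))))).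
      exact: Tm_var.
    apply: D0_ext (D0_sub (s := fun i e => match i with 0 => e 0 | S j => e (S (S j)) end) D _) _.
      by case=> [|j]; apply: Tm_var.
    by move=> e; apply: iff_refl_eq; congr P0.
  by apply: D0_and; apply: A.
move=> e; rewrite HP HQ; split=> [[[y Hy] [z Hz]]|[w [[y [_ Hy]] [z [_ Hz]]]]].
  by exists (y + z + n1); split; [exists y|exists z]; split=> //=; nlin.
by split; [exists y|exists z].
Qed.

Lemma Sig_or P Q : Sig OK P -> Sig OK Q -> Sig OK (fun e => P e \/ Q e).
Proof.
move=> [P' [DP HP]] [Q' [DQ HQ]]; exists (fun e => P' e \/ Q' e); split.
  exact: D0_or.
move=> e; rewrite HP HQ; split=> [[[y Hy]|[y Hy]]|[y [Hy|Hy]]].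
- by exists y; left.
- by exists y; right.
- by left; exists y.
- by right; exists y.
Qed.

Lemma Sig_ex Q : Sig OK (fun e => Q (e 0) (fun i => e (S i))) ->
  Sig OK (fun e => exists y, Q y e).
Proof.
move=> [P [DP HP]].
pose s i (e : env) := match i with 0 => e 0 | 1 => e 1 | S (S j) => e (S (S (S j))) end.
exists (fun e => exists y, y < e 0 /\ (exists z, z < e 0 /\
  P (fun i => s i (scons z (scons y e))))); split.
  apply: (@D0_ex (fun e => e 0) (fun y e => exists z, z < e 0 /\
     P (fun i => s i (scons z (scons y e))))); first exact: Tm_var.
  apply: (@D0_ex (fun e => e 1) (fun z e => P (fun i => s i (scons z e)))).
    exact: Tm_var.
  apply: (D0_ext (D0_sub (s := s) DP _)); first by case=> [|[|j]]; apply: Tm_var.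
  by move=> e; apply: iff_refl_eq; congr P.
have E y z w e : (fun i => s i (scons z (scons y (scons w e)))) = scons z (scons y e).
  by apply: functional_extensionality => -[|[|j]].
move=> e; split=> [[y /(HP (scons y e)) [z Hz]]|[w [y [_ [z [_ Hz]]]]]].
  exists (y + z + n1); exists y; split=> /=; first by nlin.
  by exists z; split; [nlin|rewrite E].
exists y; apply/(HP (scons y e)); exists z.
by rewrite E in Hz.
Qed.

Lemma sig_ind (P : N -> Prop) : Sig OK (fun e => P (e 0)) ->
  P n0 -> (forall x, P x -> P (x + n1)) -> forall x, P x.
Proof.
move=> [Q [[q [_ Hq]] HP]] P0 PS x.
pose P' x := exists y, csat (scons y (scons x (fun _ => n0))) q.
have E y : P y <-> P' y.
  rewrite (HP (scons y (fun _ => n0))); split=> -[w Hw]; exists w; exact/Hq.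
apply/E; apply: (csat_ind (r := R)); first exact/E.
by move=> y /E /PS /E.
Qed.

(** Induction on [c] for the existence of a bound that works for all [x] below both [c] and [b]. The
    induction formula is Sigma01 because its matrix is bounded. *)
Lemma d0_collection (Q : N -> N -> Prop) b : D0 OK (fun e => Q (e 1) (e 0)) ->
  (forall x, x < b -> exists y, Q x y) ->
  exists w, forall x, x < b -> exists y, y < w /\ Q x y.
Proof.
move=> DQ H.
pose P c := exists w, forall x, x < c -> x < b -> exists y, y < w /\ Q x y.
have {}H : forall c, P c.
  apply: sig_ind.
  - exists (fun e => forall x, x < e 1 -> x < b -> exists y, y < e 0 /\ Q x y).
    split; last by [].
    apply: (@D0_all (fun e => e 1) (fun x e => x < b -> exists y, y < e 0 /\ Q x y)).
      exact: Tm_var.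
    apply: D0_imp; first by apply: D0_lt; [apply: Tm_var|apply: Tm_cst].
    apply: (@D0_ex (fun e => e 1) (fun y e => Q (e 0) y)); first exact: Tm_var.
    exact: DQ.
  - by exists n0 => x L; nlin.
  - move=> c [w Hw]; case: (classic (c < b)) => [L|L].
      have [y Hy] := H c L; exists (w + y + n1) => x Lx Lb.
      case: (classic (x < c)) => [L'|L'].
        by have [y' [L1 L2]] := Hw x L' Lb; exists y'; split=> //; nlin.
      have -> : x = c by nlin.
      by exists y; split=> //; nlin.
    by exists w => x Lx Lb; apply: Hw => //; nlin.
by have [w Hw] := H b; exists w => x L; apply: Hw.
Qed.

(** Collection bounds the witnesses for all [x < f e] at once, which moves the existential
    quantifier in front of the bounded one. *)
Lemma Sig_ball_Tm f Q : Tm f -> Sig OK (fun e => Q (e 0) (fun i => e (S i))) ->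
  Sig OK (fun e => forall x, x < f e -> Q x e).
Proof.
move=> Tf [P [DP HP]].
pose s i (e : env) := match i with 0 => e 0 | 1 => e 1 | S (S j) => e (S (S (S j))) end.
exists (fun e => forall x, x < f (fun i => e (S i)) ->
   exists y, y < e 0 /\ P (fun i => s i (scons y (scons x e)))); split.
  apply: (@D0_all (fun e => f (fun i => e (S i))) (fun x e =>
     exists y, y < e 0 /\ P (fun i => s i (scons y (scons x e))))); first exact: Tm_lift.
  apply: (@D0_ex (fun e => e 1) (fun y e => P (fun i => s i (scons y e)))).
    exact: Tm_var.
  apply: (D0_ext (D0_sub (s := s) DP _)); first by case=> [|[|j]]; apply: Tm_var.
  by move=> e; apply: iff_refl_eq; congr P.
have E y z w e : (fun i => s i (scons z (scons y (scons w e)))) = scons z (scons y e).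
  by apply: functional_extensionality => -[|[|j]].
move=> e; split=> [H|[w Hw] x /Hw [y [_ Hy]]]; last first.
  by apply/(HP (scons x e)); exists y; rewrite E in Hy.
have [||w Hw] := @d0_collection (fun x y => P (scons y (scons x e))) (f e).
- apply: (D0_ext (D0_sub (s := fun i e' => match i with 0 => e' 0 | 1 => e' 1 | S (S j) => e j end) DP _)).
    by case=> [|[|j]]; [apply: Tm_var|apply: Tm_var|apply: Tm_cst].
  move=> e'; apply: iff_refl_eq; apply: (congr1 P).
  by apply: functional_extensionality => -[|[|j]].
- by move=> x /H /(HP (scons x e)).
- by exists w => x /Hw [y [L Hy]]; exists y; rewrite E.
Qed.

Lemma Fn_Tm f : Tm f -> Fn OK f.
Proof. by move=> Tf; apply/Sig_D0/D0_eq; [apply: Tm_var|apply: Tm_lift]. Qed.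

Lemma Fn_var k : Fn OK (fun e => e k).
Proof. exact/Fn_Tm/Tm_var. Qed.

Lemma Fn_cst x : Fn OK (fun _ => x).
Proof. exact/Fn_Tm/Tm_cst. Qed.

Lemma Fn_sub f (s : nat -> env -> N) : Fn OK f -> (forall i, Tm (s i)) ->
  Fn OK (fun e => f (fun i => s i e)).
Proof.
move=> Hf Hs; rewrite /Fn.
apply: (Sig_sub (s := fun i e => match i with 0 => e 0 | S j => s j (fun i => e (S i)) end) Hf).
by case=> [|j]; [apply: Tm_var|apply: Tm_lift].
Qed.

Lemma Fn_lift f : Fn OK f -> Fn OK (fun e => f (fun i => e (S i))).
Proof. by move/Fn_sub; apply=> i; apply: Tm_var. Qed.

Lemma Sig_let f Q : Fn OK f -> Sig OK (fun e => Q (e 0) (fun i => e (S i))) ->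
  Sig OK (fun e => Q (f e) e).
Proof.
move=> Hf HQ; apply: (Sig_ext (@Sig_ex (fun y e => y = f e /\ Q y e) _)).
  exact: Sig_and.
by move=> e; split=> [H|[y [-> ]]] //; exists (f e).
Qed.

Lemma Fn_let f g : Fn OK f -> Fn OK (fun e => g (e 0) (fun i => e (S i))) ->
  Fn OK (fun e => g (f e) e).
Proof.
move=> Hf Hg; rewrite /Fn.
apply: (@Sig_let (fun e => f (fun i => e (S i))) (fun y e => e 0 = g y (fun i => e (S i)))).
  exact: Fn_lift.
apply: (Sig_sub (s := fun i (e : env) =>
  match i with 0 => e 1 | 1 => e 0 | S (S j) => e (S (S j)) end) Hg).
by case=> [|[|j]]; apply: Tm_var.
Qed.

Lemma Del_ext P Q : Del OK P -> (forall e, Q e <-> P e) -> Del OK Q.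
Proof.
by move=> [H1 H2] E; split; [apply: Sig_ext H1 E|apply: Sig_ext H2 _ => e; rewrite E].
Qed.

Lemma Del_D0 P : D0 OK P -> Del OK P.
Proof. by move=> H; split; apply: Sig_D0 => //; apply: D0_not. Qed.

Lemma Del_sub P (s : nat -> env -> N) : Del OK P -> (forall i, Tm (s i)) ->
  Del OK (fun e => P (fun i => s i e)).
Proof. by move=> [H1 H2] Hs; split; [apply: Sig_sub H1 Hs|apply: Sig_sub H2 Hs]. Qed.

(** The value of a total function can be introduced by an existential quantifier both in a predicate
    and in its negation, so substitution of a function with Sigma01 graph preserves Delta01. *)
Lemma Del_let f Q : Fn OK f -> Del OK (fun e => Q (e 0) (fun i => e (S i))) ->
  Del OK (fun e => Q (f e) e).
Proof.
by move=> Hf [H1 H2]; split; [apply: Sig_let|apply: (@Sig_let f (fun y e => ~ Q y e))].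
Qed.

Lemma Fn_app1 F f : Fn OK (fun e => F (e 0)) -> Fn OK f -> Fn OK (fun e => F (f e)).
Proof. by move=> HF Hf; apply: (@Fn_let f (fun y _ => F y)). Qed.

Lemma Del_app1 (P : N -> Prop) f : Del OK (fun e => P (e 0)) -> Fn OK f -> Del OK (fun e => P (f e)).
Proof. by move=> HF Hf; apply: (@Del_let f (fun y _ => P y)). Qed.

Definition vswap i (e : env) := match i with 0 => e 1 | 1 => e 0 | S (S j) => e (S (S j)) end.

Lemma Tm_vswap i : Tm (vswap i).
Proof. by case: i => [|[|j]]; apply: Tm_var. Qed.

Lemma Fn_app2 F f g : Fn OK (fun e => F (e 0) (e 1)) -> Fn OK f -> Fn OK g ->
  Fn OK (fun e => F (f e) (g e)).
Proof.
move=> HF Hf Hg; apply: (@Fn_let f (fun y e => F y (g e))) => //.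
apply: (@Fn_let (fun e => g (fun i => e (S i))) (fun y e => F (e 0) y)); first exact: Fn_lift.
exact: (Fn_sub (s := vswap) HF Tm_vswap).
Qed.

Lemma Del_app2 (P : N -> N -> Prop) f g : Del OK (fun e => P (e 0) (e 1)) -> Fn OK f -> Fn OK g ->
  Del OK (fun e => P (f e) (g e)).
Proof.
move=> HF Hf Hg; apply: (@Del_let f (fun y e => P y (g e))) => //.
apply: (@Del_let (fun e => g (fun i => e (S i))) (fun y e => P (e 0) y)); first exact: Fn_lift.
exact: (Del_sub (s := vswap) HF Tm_vswap).
Qed.

Lemma Sig_app2 (P : N -> N -> Prop) f g : Sig OK (fun e => P (e 0) (e 1)) -> Fn OK f -> Fn OK g ->
  Sig OK (fun e => P (f e) (g e)).
Proof.
move=> HF Hf Hg; apply: (@Sig_let f (fun y e => P y (g e))) => //.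
apply: (@Sig_let (fun e => g (fun i => e (S i))) (fun y e => P (e 0) y)); first exact: Fn_lift.
exact: (Sig_sub (s := vswap) HF Tm_vswap).
Qed.

Lemma Fn_app3 F f g h : Fn OK (fun e => F (e 0) (e 1) (e 2)) ->
  Fn OK f -> Fn OK g -> Fn OK h -> Fn OK (fun e => F (f e) (g e) (h e)).
Proof.
move=> HF Hf Hg Hh; apply: (@Fn_let f (fun y e => F y (g e) (h e))) => //.
apply: (@Fn_let (fun e => g (fun i => e (S i)))
  (fun y e => F (e 0) y (h (fun i => e (S i))))); first exact: Fn_lift.
apply: (@Fn_let (fun e => h (fun i => e (S (S i)))) (fun y e => F (e 1) (e 0) y)).
  exact: (Fn_sub (s := fun i e => e (S (S i))) Hh (fun i => Tm_var _)).
apply: (Fn_sub (s := fun i (e : env) => match i with 0 => e 2 | 1 => e 1 | 2 => e 0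
  | j => e j end) HF).
by case=> [|[|[|j]]]; apply: Tm_var.
Qed.

Lemma Fn_add f g : Fn OK f -> Fn OK g -> Fn OK (fun e => f e + g e).
Proof. by apply: (@Fn_app2 (@madd R)); apply: Fn_Tm; apply: Tm_add; apply: Tm_var. Qed.

Lemma Fn_mul f g : Fn OK f -> Fn OK g -> Fn OK (fun e => f e * g e).
Proof. by apply: (@Fn_app2 (@mmul R)); apply: Fn_Tm; apply: Tm_mul; apply: Tm_var. Qed.

Lemma Del_eq f g : Fn OK f -> Fn OK g -> Del OK (fun e => f e = g e).
Proof. by apply: (@Del_app2 (@eq N)); apply: Del_D0; apply: D0_eq; apply: Tm_var. Qed.

Lemma Del_lt f g : Fn OK f -> Fn OK g -> Del OK (fun e => f e < g e).
Proof. by apply: (@Del_app2 (@mlt R)); apply: Del_D0; apply: D0_lt; apply: Tm_var. Qed.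

Lemma Del_mem f X : OK X -> Fn OK f -> Del OK (fun e => mmem (f e) X).
Proof.
move=> HX; apply: (@Del_app1 (fun x => mmem x X)); apply: Del_D0.
by apply: D0_mem => //; apply: Tm_var.
Qed.

Lemma Del_not P : Del OK P -> Del OK (fun e => ~ P e).
Proof.
by move=> [H1 H2]; split=> //; apply: Sig_ext H1 _ => e; split=> [/NNPP|H n].
Qed.

Lemma Del_le f g : Fn OK f -> Fn OK g -> Del OK (fun e => f e <= g e).
Proof. by move=> Hf Hg; apply: Del_not; apply: Del_lt. Qed.

Lemma Del_and P Q : Del OK P -> Del OK Q -> Del OK (fun e => P e /\ Q e).
Proof.
move=> [HP nP] [HQ nQ]; split; first exact: Sig_and.
apply: Sig_ext (Sig_or nP nQ) _ => e; split=> [n|[n|n] [p q]] //.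
by case: (classic (P e)) => p; [right=> q; apply: n|left].
Qed.

Lemma Del_or P Q : Del OK P -> Del OK Q -> Del OK (fun e => P e \/ Q e).
Proof.
move=> [HP nP] [HQ nQ]; split; first exact: Sig_or.
by apply: Sig_ext (Sig_and nP nQ) _ => e; split=> [n|[n n'] [p|q]] //;
  split=> p; apply: n; [left|right].
Qed.

Lemma Del_imp P Q : Del OK P -> Del OK Q -> Del OK (fun e => P e -> Q e).
Proof.
move=> /Del_not HP HQ; apply: Del_ext (Del_or HP HQ) _ => e.
by split=> [H|[n|q] p] //; case: (classic (P e)) => [/H|]; [right|left].
Qed.

Lemma Del_iff P Q : Del OK P -> Del OK Q -> Del OK (fun e => P e <-> Q e).
Proof. by move=> HP HQ; apply: Del_and; apply: Del_imp. Qed.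

Lemma Sig_ball f Q : Fn OK f -> Sig OK (fun e => Q (e 0) (fun i => e (S i))) ->
  Sig OK (fun e => forall x, x < f e -> Q x e).
Proof.
move=> Hf HQ; apply: (@Sig_let f (fun b e => forall x, x < b -> Q x e)) => //.
apply: (@Sig_ball_Tm (fun e => e 0) (fun x e => Q x (fun i => e (S i)))).
  exact: Tm_var.
apply: (Sig_sub (s := fun i (e : env) => match i with 0 => e 0 | S j => e (S (S j)) end) HQ).
by case=> [|j]; apply: Tm_var.
Qed.

Lemma Sig_bex f Q : Fn OK f -> Sig OK (fun e => Q (e 0) (fun i => e (S i))) ->
  Sig OK (fun e => exists x, x < f e /\ Q x e).
Proof.
move=> Hf HQ; apply: (@Sig_ex (fun x e => x < f e /\ Q x e)).
apply: Sig_and => //; apply: (proj1 (@Del_lt (fun e => e 0) (fun e => f (fun i => e (S i))) _ _)).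
  exact: Fn_var.
exact: Fn_lift.
Qed.

Lemma Del_ball f Q : Fn OK f -> Del OK (fun e => Q (e 0) (fun i => e (S i))) ->
  Del OK (fun e => forall x, x < f e -> Q x e).
Proof.
move=> Hf [HQ nQ]; split; first exact: Sig_ball.
apply: (Sig_ext (@Sig_bex f (fun x e => ~ Q x e) Hf nQ)) => e.
split=> [n|[x [L nq]] H]; last exact: nq (H x L).
by apply: NNPP => n'; apply: n => x L; apply: NNPP => nq; apply: n'; exists x.
Qed.

Lemma Del_bex f Q : Fn OK f -> Del OK (fun e => Q (e 0) (fun i => e (S i))) ->
  Del OK (fun e => exists x, x < f e /\ Q x e).
Proof.
move=> Hf /Del_not HQ; apply: Del_ext (Del_not (@Del_ball f (fun x e => ~ Q x e) Hf HQ)) _ => e.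
split=> [[x [L q]] H|n]; first exact: H L q.
by apply: NNPP => n'; apply: n => x L q; apply: n'; exists x.
Qed.

Lemma Del_cst (P : Prop) : Del OK (fun _ => P).
Proof.
case: (classic P) => p.
  apply: (@Del_ext (fun _ => n0 = n0 :> N)) => //; apply: Del_eq; exact: Fn_cst.
by apply: (@Del_ext (fun _ => n0 <> n0 :> N)) => //; apply/Del_not/Del_eq; exact: Fn_cst.
Qed.

Lemma Sig_Del P : Del OK P -> Sig OK P.
Proof. by case. Qed.

Lemma Fn_if P f g : Del OK P -> Fn OK f -> Fn OK g ->
  Fn OK (fun e => if asb (P e) then f e else g e).
Proof.
move=> [HP nP] Hf Hg; apply: Sig_ext (Sig_or (Sig_and (Sig_lift HP) Hf) (Sig_and (Sig_lift nP) Hg)) _.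
by move=> e; case: asbP => p; split=> [->|[[]|[]]] //; [left|right].
Qed.

Lemma sig_collection (Q : N -> N -> Prop) b : Sig OK (fun e => Q (e 0) (e 1)) ->
  (forall x, x < b -> exists y, Q x y) ->
  exists w, forall x, x < b -> exists y, y < w /\ Q x y.
Proof.
move=> [P [DP HP]] H.
have E x y : Q x y <-> exists z, P (scons z (scons x (scons y (fun _ => n0)))).
  exact: (HP (scons x (scons y (fun _ => n0)))).
have [||w Hw] := @d0_collection (fun x u => exists y, y < u /\ exists z, z < u /\
  P (scons z (scons x (scons y (fun _ => n0))))) b.
- apply: (@D0_ex (fun e => e 0) (fun y e => exists z, z < e 0 /\
    P (scons z (scons (e 1) (scons y (fun _ => n0)))))); first exact: Tm_var.
  apply: (@D0_ex (fun e => e 1) (fun z e => P (scons z (scons (e 2) (scons (e 0) (fun _ => n0)))))).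
    exact: Tm_var.
  apply: (D0_ext (D0_sub (s := fun i e => match i with 0 => e 0 | 1 => e 3 | 2 => e 1
    | S (S (S j)) => n0 end) DP _)).
    by case=> [|[|[|j]]]; [apply: Tm_var|apply: Tm_var|apply: Tm_var|apply: Tm_cst].
  move=> e'; apply: iff_refl_eq; apply: (congr1 P).
  by apply: functional_extensionality => -[|[|[|j]]].
- move=> x /H [y /E [z Hz]]; exists (y + z + n1), y; split; first by nlin.
  by exists z; split=> //; nlin.
- exists w => x /Hw [u [Lu [y [Ly [z [_ Hz]]]]]]; exists y; split; first by nlin.
  by apply/E; exists z.
Qed.

(** The least number principle for Pi01 predicates: without a least element, Sigma01 induction on
    [b] would show that nothing below [b] and up to [x] satisfies [P]. *)
Lemma least (P : N -> Prop) x : Sig OK (fun e => ~ P (e 0)) -> P x ->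
  exists y, y <= x /\ P y /\ forall z, z < y -> ~ P z.
Proof.
move=> HP Px; apply: NNPP => n.
have H : forall b, forall y, y < b -> y <= x -> ~ P y.
  apply: sig_ind.
  - apply: (@Sig_ball (fun e => e 0) (fun y e => y <= x -> ~ P y)); first exact: Fn_var.
    apply: (Sig_ext (Sig_or (Sig_sub (s := fun i e => e 0) HP (fun i => Tm_var 0))
      (Sig_Del (@Del_lt (fun _ => x) (fun e => e 0) (Fn_cst _) (Fn_var 0))))) => e.
    by rewrite /nle; split=> [H|[] //]; case: (classic (x < e 0)) => L; [right|left; apply: H].
  - by move=> y L; nlin.
  - move=> b IH y L Ly Py; apply: n; exists y; split=> //; split=> // z Lz.
    by apply: IH; nlin.
apply: (H (x + n1) x) => //; nlin.
Qed.

Lemma del_comp (P : N -> Prop) : Del OK (fun e => P (e 0)) ->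
  exists X, forall x, mmem x X <-> P x.
Proof.
move=> [[Q [[q [_ Hq]] HQ]] [Q' [[q' [_ Hq']] HQ']]].
have E x : (exists y, csat (scons y (scons x (fun _ => n0))) q) <-> P x.
  by rewrite (HQ (scons x (fun _ => n0))); split=> -[y /Hq Hy]; exists y.
have E' x : (exists y, csat (scons y (scons x (fun _ => n0))) q') <-> ~ P x.
  by rewrite (HQ' (scons x (fun _ => n0))); split=> -[y /Hq' Hy]; exists y.
(* The Pi01 equivalent is obtained by negating the matrix of the Sigma01 definition of the
   complement. *)
have [x|X HX] := @csat_comp R q (cimp q' cbot) (fun _ => n0).
  rewrite E; split=> [p y /= H|H]; first by have : ~ P x by apply/E'; exists y.
  by apply: NNPP => /E' [y Hy]; apply: (H y).
by exists X => x; rewrite HX E.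
Qed.

End Sets.
End Definability.

Lemma Sig_imp (R : rca0) OK (P Q : (nat -> dom R) -> Prop) :
  Del OK P -> Sig OK Q -> Sig OK (fun e => P e -> Q e).
Proof.
move=> /Del_not [HP _] HQ; apply: Sig_ext (Sig_or HP HQ) _ => e.
by split=> [H|[n|q] p] //; case: (classic (P e)) => [/H|]; [right|left].
Qed.

(* [df] proves definability by recursion on the shape of the predicate; [df_ext]
   is extended whenever a new notion has been shown definable. *)
Ltac df_ext := fail.
Ltac df_hyp :=
  match goal with
  | H : Fn _ ?f |- Fn _ ?f => exact H
  | H : Del _ ?f |- Del _ ?f => exact H
  | H : Fn _ ?f |- Fn _ (fun e => ?f (fun i => e (S i))) => apply (Fn_lift H)
  | H : Fn _ ?f |- Fn _ (fun e => ?f (fun i => e (S (S i)))) =>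
      apply (Fn_sub (s := fun i e => e (S (S i))) H (fun i => @Tm_var _ _))
  | H : Fn _ (fun e => ?F (e 0)) |- Fn _ (fun e => ?F _) => apply (Fn_app1 H)
  | H : Fn _ (fun e => ?F (e 0) (e 1)) |- Fn _ (fun e => ?F _ _) => apply (Fn_app2 H)
  | H : Fn _ (fun e => ?F (e 0) (e 1) (e 2)) |- Fn _ (fun e => ?F _ _ _) => apply (Fn_app3 H)
  | H : Del _ (fun e => ?F (e 0)) |- Del _ (fun e => ?F _) => apply (Del_app1 H)
  | H : Del _ (fun e => ?F (e 0) (e 1)) |- Del _ (fun e => ?F _ _) => apply (Del_app2 H)
  end.
Ltac df1 :=
  cbv beta;
  lazymatch goal with
  | |- Fn _ (fun _ => ?c) => apply Fn_cst
  | |- Fn _ (fun e => e _) => apply Fn_var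
  | |- Fn _ (fun _ => madd _ _) => apply Fn_add
  | |- Fn _ (fun _ => mmul _ _) => apply Fn_mul
  | |- Fn _ (fun _ => if asb _ then _ else _) => apply Fn_if
  | |- Del _ (fun _ => ?c) => apply Del_cst
  | |- Del _ (fun _ => _ /\ _) => apply Del_and
  | |- Del _ (fun _ => _ \/ _) => apply Del_or
  | |- Del _ (fun _ => ~ _) => apply Del_not
  | |- Del _ (fun _ => _ <-> _) => apply Del_iff
  | |- Del _ (fun _ => @eq (dom _) _ _) => apply Del_eq
  | |- Del _ (fun _ => mlt _ _) => apply Del_lt
  | |- Del _ (fun _ => nle _ _) => apply Del_le
  | |- Del _ (fun _ => forall x, mlt x _ -> _) => apply Del_ball
  | |- Del _ (fun _ => exists x, mlt x _ /\ _) => apply Del_bex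
  | |- Del _ (fun _ => _ -> _) => apply Del_imp
  | |- Sig _ (fun _ => exists _, _) => apply Sig_ex
  | |- Sig _ (fun _ => _ /\ _) => apply Sig_and
  | |- Sig _ (fun _ => _ \/ _) => apply Sig_or
  | |- Sig _ (fun _ => forall x, mlt x _ -> _) => apply Sig_ball
  | |- Sig _ (fun _ => ~ _) => apply Sig_Del
  | |- Sig _ (fun _ => _ -> _) => apply Sig_imp
  | |- _ => first [df_hyp | df_ext | lazymatch goal with |- Sig _ _ => apply Sig_Del end]
  end.
Ltac df := repeat df1.

(** * Pairs and finite sets *)

Section Coding.
Variable R : rca0.
Notation N := (dom R).
Notation env := (nat -> N).
Notation any := (@anyset R).
Implicit Types (x y z i j b c d m n s : N) (e : env).

Lemma n0_or x : x = n0 \/ n1 <= x.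
Proof. case: (classic (x < n1)) => H; [left|right] => //; nlin. Qed.

Lemma sub_ex x y : x <= y -> exists z, y = x + z.
Proof.
case: (classic (x < y)) => [/lt_add_ex [z <-]|L1 L2]; first by exists z.
by exists n0; nlin.
Qed.

Definition pr x y : N := (x + y) * (x + y) + x.

(** The code lies between [(x + y)^2] and [(x + y + 1)^2], the latter excluded, and so determines
    the sum. *)
Lemma pr_lt_sum x y x' y' : pr x y = pr x' y' -> x + y < x' + y' -> False.
Proof. by rewrite /pr => E L; nnlin. Qed.

Lemma pr_inj x y x' y' : pr x y = pr x' y' -> x = x' /\ y = y'.
Proof.
move=> E; have E1 : x + y = x' + y'.
  case: (classic (x + y < x' + y')) => [/(pr_lt_sum E) //|L].
  case: (classic (x' + y' < x + y)) => [/(pr_lt_sum (esym E)) //|L']; nlin.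
move: E; rewrite /pr E1 => E; split; nlin.
Qed.

Lemma nadd0 x : x + n0 = x.
Proof. nlin. Qed.

Lemma n0_le x : n0 <= x.
Proof. nlin. Qed.

Lemma le_addr x y : x <= x + y.
Proof. nlin. Qed.

Lemma le_sqr x : x <= x * x.
Proof. by case: (n0_or x) => [->|H]; [nlin|nnlin]. Qed.

Lemma pr_lel x y : x <= pr x y.
Proof. rewrite /pr; nnlin. Qed.

Lemma pr_ler x y : y <= pr x y.
Proof. have := @le_sqr (x + y); rewrite /pr => H; nlin. Qed.

Lemma pr_mono x y x' y' : x <= x' -> y <= y' -> pr x y <= pr x' y'.
Proof. rewrite /pr => H1 H2; nnlin. Qed.

Lemma Fn_pr OK f g : Fn OK f -> Fn OK g -> Fn OK (fun e : env => pr (f e) (g e)).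
Proof. by move=> Hf Hg; rewrite /pr; df. Qed.

Definition FinMem i c : Prop :=
  exists k m n, c = pr k (pr m n) /\ i < k /\ exists q, n = q * (m * (i + n1) + n1).

Lemma FinMem_pr i k m n :
  FinMem i (pr k (pr m n)) <-> i < k /\ exists q, n = q * (m * (i + n1) + n1).
Proof.
split=> [[k' [m' [n' [/pr_inj [-> /pr_inj [-> ->]] H]]]]|H] //.
by exists k, m, n.
Qed.

Lemma FinMem_lt i c : FinMem i c -> i < c.
Proof. by move=> [k [m [n [-> [L _]]]]]; have := @pr_lel k (pr m n) => H; nlin. Qed.

Lemma mul_succ_le q m i : q <= q * (m * (i + n1) + n1).
Proof.
have -> : q * (m * (i + n1) + n1) = q + q * (m * (i + n1)) by nlin.
exact: le_addr.
Qed.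

Lemma Del_FinMem OK f g : Fn OK f -> Fn OK g -> Del OK (fun e : env => FinMem (f e) (g e)).
Proof.
move=> Hf Hg; apply: (Del_app2 (P := FinMem)) => //.
(* The components never exceed the code, nor the quotient the third of them, so all quantifiers can
   be bounded. [pr] is written out because [df] handles only the arithmetic operations at this
   point. *)
pose B (e : env) := exists k, k < e 1 + n1 /\ exists m, m < e 1 + n1 /\ exists n, n < e 1 + n1 /\
  (e 1 = (k + (m + n) * (m + n) + m) * (k + (m + n) * (m + n) + m) + k /\ e 0 < k /\
  exists q, q < n + n1 /\ n = q * (m * (e 0 + n1) + n1)).
apply: (@Del_ext _ _ B) => [|e]; first by rewrite /B; df.
have A k m n : (k + (m + n) * (m + n) + m) * (k + (m + n) * (m + n) + m) + k = pr k (pr m n).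
  by rewrite /pr; nlin.
split=> [[k [m [n [E [L [q Eq]]]]]]|[k [_ [m [_ [n [_ [E [L [q [_ Eq]]]]]]]]]]].
  have H1 := @pr_lel k (pr m n); have H2 := @pr_ler k (pr m n).
  have H3 := @pr_lel m n; have H4 := @pr_ler m n; have H5 := @mul_succ_le q m (e 0).
  exists k; split; first by nlin.
  exists m; split; first by nlin.
  exists n; split; first by nlin.
  rewrite A; split=> //; split=> //.
  by exists q; split=> //; rewrite {1}Eq; nlin.
by exists k, m, n; rewrite -A; split=> //; split=> //; exists q.
Qed.
End Coding.

Ltac df_finite :=
  lazymatch goal with
  | |- Fn _ (fun _ => pr _ _) => apply Fn_pr
  | |- Del _ (fun _ => FinMem _ _) => apply Del_FinMem
  end.
Ltac df_ext ::= df_finite.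

(** * Coding of finite sets by coprime moduli, and least codes *)

Section FiniteSets.
Variable R : rca0.
Notation N := (dom R).
Notation env := (nat -> N).
Notation any := (@anyset R).
Implicit Types (x y z i j b c d m n s : N) (e : env).

(** A substitute for the factorial: primitive recursion is not yet available, since it rests on the
    coding that uses this [m]. *)
Lemma multiple_exists b : exists m, n0 < m /\ forall j, j < b -> exists q, m = q * (j + n1).
Proof.
move: b; apply: (@sig_ind R any); first by df.
  by exists n1; split=> [|j L]; nlin.
move=> b [m [m0 Hm]]; exists (m * (b + n1)); split; first by nnlin.
move=> j L; case: (classic (j < b)) => [/Hm [q ->]|L'].
  by exists (q * (b + n1)); nlin.
by exists m; have -> : j = b by nlin.
Qed.

Lemma dvd_sub a c d n : a * d + n = c * d -> exists q, n = q * d.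
Proof.
move=> E; case: (classic (a <= c)) => [/sub_ex [q Eq]|L]; first by exists q; rewrite Eq in E; nlin.
by exists n0; nnlin.
Qed.

(* The moduli [m (i + 1) + 1] are pairwise coprime when the differences of the
   indices divide [m]. *)
Lemma beta_coprime b m i j n : (forall t, t < b -> exists q, m = q * (t + n1)) ->
  i < b -> j < b -> i <> j ->
  (exists q, n * (m * (i + n1) + n1) = q * (m * (j + n1) + n1)) ->
  exists q, n = q * (m * (j + n1) + n1).
Proof.
move=> Hm Li Lj ne [q Eq].
(* Let [d] be the modulus of [j]. If [t + 1] divides [m] and [d] divides [n (t + 1)], then [d]
   divides [n m (j + 1) = n d - n], hence [n]. *)
have key t w : t < b -> n * (t + n1) = w * (m * (j + n1) + n1) ->
    exists q', n = q' * (m * (j + n1) + n1).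
  move=> /Hm [u Eu] Ew; apply: (@dvd_sub (u * w * (j + n1)) n).
  transitivity (u * (w * (m * (j + n1) + n1)) * (j + n1) + n); first by nring.
  rewrite -Ew; transitivity ((u * (t + n1)) * n * (j + n1) + n); first by nring.
  by rewrite -Eu; nring.
(* Elimination of [m] from the two moduli: [j + 1] times that of [i] exceeds [i + 1] times that of
   [j] by [j - i], so the modulus of [j] divides [n (j - i)]. *)
case: (classic (i < j)) => L.
  have [t Et] : exists t, j = i + n1 + t by apply: sub_ex; nlin.
  have [w Ew] := @dvd_sub (n * (i + n1)) (q * (j + n1)) (m * (j + n1) + n1) (n * (t + n1)) ltac:(
    transitivity (n * (m * (i + n1) + n1) * (j + n1)); [rewrite Et; nring|rewrite Eq; nring]).
  by apply: (key t w) => //; clear Eq Ew; nlin.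
have [t Et] : exists t, i = j + n1 + t.
  apply: sub_ex; case: (classic (j < i)) => L'; first by nlin.
  by case: ne; clear Eq; nlin.
have [w Ew] := @dvd_sub (q * (j + n1)) (n * (i + n1)) (m * (j + n1) + n1) (n * (t + n1)) ltac:(
  transitivity (n * (m * (i + n1) + n1) * (j + n1) + n * (t + n1)); [rewrite Eq; nring|rewrite Et; nring]).
by apply: (key t w) => //; clear Eq Ew; nlin.
Qed.

(** With [b] and [m] fixed, induction on [x] multiplies [n] by the modulus of each new element; by
    coprimality this changes no other membership. *)
Lemma code_exists (P : N -> Prop) b : Del any (fun e => P (e 0)) ->
  exists c, forall i, FinMem i c <-> i < b /\ P i.
Proof.
move=> HP; have [m [m0 Hm]] := multiple_exists b.
suff H : forall x, exists n, forall i, i < b ->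
    (FinMem i (pr b (pr m n)) <-> i < x /\ P i).
  have [n Hn] := H b; exists (pr b (pr m n)) => i; split=> [Hi|[L p]]; last exact/Hn.
  have L : i < b by move/FinMem_pr: Hi => [].
  exact: (proj1 (Hn i L) Hi).
apply: (@sig_ind R any); first by df.
  (* The empty product codes the empty set because every modulus is at least 2. *)
  exists n1 => i Li; rewrite FinMem_pr; split=> [[_ [q Eq]]|[L _]]; last by nlin.
  have A : n1 <= m * (i + n1) by nnlin.
  move: Eq; move: (m * (i + n1)) A => w A Eq.
  case: (n0_or q) => [E|L]; first by rewrite E in Eq; nlin.
  by nnlin.
move=> x [n Hn]; case: (classic (x < b /\ P x)) => [[Lx Px]|nP]; last first.
  exists n => i Li; rewrite (Hn i Li); split=> -[L p]; split=> //; first by nlin.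
  case: (classic (i < x)) => // L'; case: nP.
  by have <- : i = x by nlin.
exists (n * (m * (x + n1) + n1)) => i Li; rewrite FinMem_pr.
have {Hn} := Hn i Li; rewrite FinMem_pr => Hn.
case: (classic (i = x)) => [->|ne].
  by split=> [_|_]; split=> //; [nlin|exists n].
have E : i < x + n1 <-> i < x.
  by split=> L; [apply: NNPP => L'; apply: ne; nlin|nlin].
rewrite E -Hn; split=> -[_ [q Eq]]; split=> //.
  by apply: (@beta_coprime b m x i) => //; [move=> E'; apply: ne|exists q].
by exists (q * (m * (x + n1) + n1)); rewrite Eq; nring.
Qed.

Definition FinCode c : Prop := forall d, d < c -> ~ forall i, FinMem i d <-> FinMem i c.

(** Members are below their code, so a bounded comparison decides extensional equality; this makes
    [FinCode] a Delta01 predicate. *)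
Definition same_set c d : Prop := forall i, i < c + d -> (FinMem i c <-> FinMem i d).

Lemma same_setE c d : same_set c d <-> forall i, FinMem i c <-> FinMem i d.
Proof.
split=> [H i|H i _ //].
by split=> Hi; have L := FinMem_lt Hi; apply/H => //; nlin.
Qed.

Lemma FinCodeE c : FinCode c <-> forall d, d < c -> ~ same_set d c.
Proof. by split=> H d L; move: (H d L); rewrite same_setE. Qed.

Lemma Del_FinCode OK f : Fn OK f -> Del OK (fun e : env => FinCode (f e)).
Proof.
move=> Hf; apply: (Del_app1 (P := FinCode)) => //.
apply: (@Del_ext _ _ (fun e => forall d, d < e 0 -> ~ same_set d (e 0))).
  by rewrite /same_set; df.
by move=> e; apply: FinCodeE.
Qed.

Lemma FinCode_ext c d : FinCode c -> FinCode d -> (forall i, FinMem i c <-> FinMem i d) -> c = d.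
Proof.
move=> Hc Hd H.
case: (classic (c < d)) => [L|L1]; first by case: (Hd c L).
case: (classic (d < c)) => [L|L2]; last by nlin.
by case: (Hc d L) => i; rewrite H.
Qed.

Lemma FinCode_exists c : exists d, FinCode d /\ forall i, FinMem i d <-> FinMem i c.
Proof.
have [|d [_ [Hd Ld]]] := @least R any (fun d => same_set d c) c _ (fun i _ => iff_refl _).
  by rewrite /same_set; df.
exists d; split; last exact: (proj1 (same_setE _ _) Hd).
apply/FinCodeE => d' L /(proj1 (same_setE _ _)) H; apply: (Ld d' L).
by apply/same_setE => i; rewrite H; apply: (proj1 (same_setE _ _) Hd).
Qed.

(** Least codes are unique, which gives this choice a definable graph ([Fn_code]) and admits it in
    later inductions. *)
Definition code b (P : N -> Prop) : N :=
  epsilon (inhabits n0) (fun c => FinCode c /\ forall i, FinMem i c <-> i < b /\ P i).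

Lemma code_spec b P : Del any (fun e => P (e 0)) ->
  FinCode (code b P) /\ forall i, FinMem i (code b P) <-> i < b /\ P i.
Proof.
move=> HP; apply: (epsilon_spec (inhabits n0)
  (fun c => FinCode c /\ forall i, FinMem i c <-> i < b /\ P i)).
have [c Hc] := code_exists b HP; have [d [Hd Ed]] := FinCode_exists c.
by exists d; split=> // i; rewrite Ed.
Qed.

Lemma code_unique b P c : Del any (fun e => P (e 0)) ->
  FinCode c -> (forall i, FinMem i c <-> i < b /\ P i) -> c = code b P.
Proof.
move=> HP Hc H; have [H1 H2] := code_spec b HP.
by apply: FinCode_ext => // i; rewrite H H2.
Qed.

Lemma Sig_weaken (OK OK' : sets R -> Prop) (P : env -> Prop) :
  (forall X, OK X -> OK' X) -> Sig OK P -> Sig OK' P.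
Proof. by move=> H [Q [[q [Hq HQ]] HP]]; exists Q; split=> //; exists q; split=> // X /Hq /H. Qed.

Lemma Del_any OK (P : env -> Prop) : Del OK P -> Del any P.
Proof. by move=> [H1 H2]; split; [apply: Sig_weaken H1|apply: Sig_weaken H2]. Qed.

Lemma Fn_any OK (f : env -> N) : Fn OK f -> Fn any f.
Proof. exact: Sig_weaken. Qed.

(* Specializes all variables but the first to the values given by [e]. *)
Lemma Del_inst (P : N -> env -> Prop) OK e :
  Del OK (fun e => P (e 0) (fun k => e (S k))) -> Del any (fun e' => P (e' 0) e).
Proof.
move/(@Del_any _ _)/(Del_sub (s := fun k e' => match k with 0 => e' 0 | S j => e j end)); apply.
by case=> [|j]; [apply: Tm_var|apply: Tm_cst].
Qed.

Lemma Fn_inst2 (f : N -> N -> env -> N) OK e :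
  Fn OK (fun e => f (e 0) (e 1) (fun k => e (S (S k)))) -> Fn any (fun e' => f (e' 0) (e' 1) e).
Proof.
move/(@Fn_any _ _)/(Fn_sub (s := fun k e' => match k with 0 => e' 0 | 1 => e' 1 | S (S j) => e j end)); apply.
by case=> [|[|j]]; [apply: Tm_var|apply: Tm_var|apply: Tm_cst].
Qed.

Lemma Fn_code OK f (P : N -> env -> Prop) : Fn OK f ->
  Del OK (fun e => P (e 0) (fun k => e (S k))) ->
  Fn OK (fun e => code (f e) (fun i => P i e)).
Proof.
move=> Hf HP; apply: (@Sig_ext _ _ (fun e => FinCode (e 0) /\ forall i, i < e 0 + f (fun k => e (S k)) ->
  (FinMem i (e 0) <-> i < f (fun k => e (S k)) /\ P i (fun k => e (S k))))).
  apply: Sig_Del; apply: Del_and; first by apply: Del_FinCode; df.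
  have HP' : Del OK (fun e => P (e 0) (fun k => e (S (S k)))).
    apply: (Del_sub (s := fun k (e : env) => match k with 0 => e 0 | S j => e (S (S j)) end) HP).
    by case=> [|j]; apply: Tm_var.
  by df.
move=> e; set e' := fun k => e (S k).
have He := Del_inst e' HP; have [H1 H2] := @code_spec (f e') (fun i => P i e') He.
split=> [->|[H3 H4]]; first by split=> // i _; apply: H2.
apply: code_unique => // i; split=> [Hi|[L p]]; last by apply/H4; [nlin|].
by apply/(H4 i) => //; have := FinMem_lt Hi => L; nlin.
Qed.
End FiniteSets.

(** * Sequences and primitive recursion *)

Definition ind {R : rca0} (P : Prop) : dom R := if asb P then n1 else n0.

Ltac df_codes :=
  lazymatch goal with
  | |- Fn _ (fun _ => pr _ _) => apply Fn_pr
  | |- Fn _ (fun _ => ind _) => apply Fn_if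
  | |- Del _ (fun _ => FinMem _ _) => apply Del_FinMem
  | |- Del _ (fun _ => FinCode _) => apply Del_FinCode
  | |- Fn _ (fun _ => code _ _) => apply Fn_code
  end.
Ltac df_ext ::= df_codes.

Section Sequences.
Variable R : rca0.
Notation N := (dom R).
Notation env := (nat -> N).
Notation any := (@anyset R).
Implicit Types (x y z i j a b c d m n s t l : N) (e : env).

Lemma ind_true (P : Prop) : P -> ind P = n1 :> N.
Proof. by rewrite /ind; case: asbP. Qed.

Lemma ind_false (P : Prop) : ~ P -> ind P = n0 :> N.
Proof. by rewrite /ind; case: asbP. Qed.

Lemma ind_or (P : Prop) : (P /\ ind P = n1 :> N) \/ (~ P /\ ind P = n0 :> N).
Proof. by rewrite /ind; case: asbP; [left|right]. Qed.

Lemma ind_ext (P Q : Prop) : (P <-> Q) -> ind P = ind Q :> N.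
Proof. by move=> H; rewrite (propositional_extensionality _ _ H). Qed.

Lemma n01 : n0 <> n1 :> N.
Proof. by move=> E; nlin. Qed.

(** Bounded minimization; [b] itself is the answer when the search fails. *)
Definition mub b (P : N -> Prop) : N := epsilon (inhabits n0)
  (fun x => (x < b /\ P x /\ forall y, y < x -> ~ P y) \/ (x = b /\ forall y, y < b -> ~ P y)).

Lemma mub_spec b (P : N -> Prop) : Del any (fun e => P (e 0)) -> let x := mub b P in
  (x < b /\ P x /\ forall y, y < x -> ~ P y) \/ (x = b /\ forall y, y < b -> ~ P y).
Proof.
move=> HP; cbv zeta; pose Q x := (x < b /\ P x /\ forall y, y < x -> ~ P y) \/
  (x = b /\ forall y, y < b -> ~ P y).
apply: (epsilon_spec (inhabits n0) Q).
case: (classic (exists x, x < b /\ P x)) => [[x [L p]]|H].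
  have [|y [Ly [py Hy]]] := @least R any P x _ p; first by df.
  by exists y; left; split=> //; nlin.
by exists b; right; split=> // y L p; apply: H; exists y.
Qed.

Lemma Fn_mub OK f (P : N -> env -> Prop) : Fn OK f ->
  Del OK (fun e => P (e 0) (fun k => e (S k))) -> Fn OK (fun e => mub (f e) (fun x => P x e)).
Proof.
move=> Hf HP.
have HP' : Del OK (fun e => P (e 0) (fun k => e (S (S k)))).
  apply: (Del_sub (s := fun k (e : env) => match k with 0 => e 0 | S j => e (S (S j)) end) HP).
  by case=> [|j]; apply: Tm_var.
apply: (@Sig_ext _ _ (fun e => let b := f (fun k => e (S k)) in
  (e 0 < b /\ P (e 0) (fun k => e (S k)) /\ forall y, y < e 0 -> ~ P y (fun k => e (S k))) \/
  (e 0 = b /\ forall y, y < b -> ~ P y (fun k => e (S k))))).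
  by cbv zeta; df.
move=> e; cbv zeta; set e' := fun k => e (S k).
have := @mub_spec (f e') (fun x => P x e') (Del_inst e' HP); cbv zeta => H.
split=> [->//|[[L1 [p H1]]|[-> H1]]]; last first.
  by case: H => [[L [p _]]|[-> _]] //; case: (H1 _ L).
case: H => [[L2 [p' H2]]|[_ H2]]; last by case: (H2 _ L1).
apply: nle_anti => L; first by apply: (H1 _ L).
by apply: (H2 _ L).
Qed.

Definition Entry s i a : Prop := FinMem (pr i a) s.

Lemma Del_Entry OK f g h : Fn OK f -> Fn OK g -> Fn OK h ->
  Del OK (fun e : env => Entry (f e) (g e) (h e)).
Proof. by move=> Hf Hg Hh; rewrite /Entry; df. Qed.

Lemma Entry_lt s i a : Entry s i a -> i < s /\ a < s.
Proof.
by move/FinMem_lt => L; have := @pr_lel R i a; have := @pr_ler R i a; split; nlin.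
Qed.

Definition IsSeq s l : Prop :=
  FinCode s /\ (forall z, FinMem z s -> exists i a, i < l /\ z = pr i a) /\
  (forall i, i < l -> exists a, Entry s i a /\ forall b, Entry s i b -> b = a).

(** Collection bounds the values below [l] by some [w], so the graph is a Delta01 set of pairs below
    [pr l w + n1] and has a code. *)
Lemma seq_exists f l : Fn any (fun e => f (e 0)) ->
  exists s, IsSeq s l /\ forall i a, Entry s i a <-> i < l /\ a = f i.
Proof.
move=> Hf.
have [||w Hw] := @sig_collection R any (fun i y => y = f i) l.
- by df.
- by move=> i _; exists (f i).
have HP : Del any (fun e => exists i, i < l /\ e 0 = pr i (f i)) by df.
have [H1 H2] := @code_spec R (pr l w + n1) (fun z => exists i, i < l /\ z = pr i (f i)) HP.
set s := code _ _ in H1 H2.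
have HE i a : Entry s i a <-> i < l /\ a = f i.
  rewrite /Entry H2; split=> [[_ [j [L /pr_inj [-> ->]]]] //|[L ->]].
  split; last by exists i.
  have [y [Ly Ey]] := Hw i L.
  by have := @pr_mono R i (f i) l w; move=> M; have := M ltac:(nlin) ltac:(rewrite -Ey; nlin) => M'; nlin.
exists s; split=> //; split=> //; split=> [z /H2 [_ [i [L ->]]]|i L]; first by exists i, (f i).
by exists (f i); split; [apply/HE|move=> b /HE []].
Qed.

Definition val s i : N := mub s (fun a => Entry s i a).

Lemma val_eq s i a : Entry s i a -> (forall b, Entry s i b -> b = a) -> val s i = a.
Proof.
move=> H U; have [|[_ [H1 _]]|[_ H1]] := @mub_spec s (fun a => Entry s i a).
- by apply: Del_Entry; df.
- exact: U.
- by case: (H1 a); first by case: (Entry_lt H).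
Qed.

Lemma IsSeq_val s l i : IsSeq s l -> i < l -> Entry s i (val s i) /\ forall a, Entry s i a -> a = val s i.
Proof. by move=> [_ [_ H]] /H [a [Ha Ua]]; rewrite (val_eq Ha Ua). Qed.

Lemma Fn_val OK f g : Fn OK f -> Fn OK g -> Fn OK (fun e => val (f e) (g e)).
Proof.
move=> Hf Hg; rewrite /val; apply: (@Fn_mub OK f (fun a e => Entry (f e) (g e) a)) => //.
by apply: Del_Entry; df.
Qed.

Definition is_prec a (g : N -> N -> N) n y s : Prop :=
  val s n0 = a /\ (forall i, i < n -> val s (i + n1) = g i (val s i)) /\ y = val s n.

Definition prec a (g : N -> N -> N) n : N :=
  epsilon (inhabits n0) (fun y => exists s, is_prec a g n y s).
End Sequences.

Ltac df_sequences :=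
  first [ lazymatch goal with
  | |- Del _ (fun _ => Entry _ _ _) => apply Del_Entry
  | |- Fn _ (fun _ => val _ _) => apply Fn_val
  | |- Fn _ (fun _ => mub _ _) => apply Fn_mub
  end | df_codes ].
Ltac df_ext ::= df_sequences.

(** * Primitive recursion along coded computations *)

Section Recursion.
Variable R : rca0.
Notation N := (dom R).
Notation env := (nat -> N).
Notation any := (@anyset R).
Implicit Types (x y z i j a b c d m n s t l : N) (e : env).

Lemma is_prec_exists a (g : N -> N -> N) n : Fn any (fun e => g (e 0) (e 1)) ->
  exists y s, is_prec a g n y s.
Proof.
move=> Hg; suff [s [H1 H2]] : exists s, val s n0 = a /\ forall i, i < n -> val s (i + n1) = g i (val s i).
  by exists (val s n), s.
move: n; apply: (@sig_ind R any); first by df.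
  have [|s [Hs E]] := @seq_exists R (fun _ => a) n1; first by df.
  exists s; split=> [|i L]; last by nlin.
  by apply: val_eq => [|b /E []] //; apply/E; split=> //; nlin.
move=> n [s [H0 HS]].
(* A code cannot be extended in place: the old values and the new one are coded afresh. *)
pose f i := if asb (i <= n) then val s i else g n (val s n).
have [|s' [Hs' E]] := @seq_exists R f (n + n1 + n1); first by rewrite /f; df.
have V i : i < n + n1 + n1 -> val s' i = f i.
  by move=> L; apply: val_eq => [|b /E []] //; apply/E.
exists s'; split.
  rewrite V; last by nlin.
  by rewrite /f; case: asbP => // L; exfalso; nlin.
move=> i L; rewrite !V; try nlin; rewrite /f; case: asbP => L1; case: asbP => L2; try (exfalso; nlin).
  by apply: HS; nlin.
by have -> : i = n by nlin.
Qed.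

Lemma is_prec_unique a (g : N -> N -> N) n y s y' s' : Fn any (fun e => g (e 0) (e 1)) ->
  is_prec a g n y s -> is_prec a g n y' s' -> y = y'.
Proof.
move=> Hg [H0 [HS ->]] [H0' [HS' ->]].
suff H : forall i, i <= n -> val s i = val s' i by apply: H; nlin.
apply: (@sig_ind R any); first by df.
  by rewrite H0 H0'.
by move=> i IH L; rewrite HS ?HS' ?IH //; nlin.
Qed.

Lemma precP a (g : N -> N -> N) n y : Fn any (fun e => g (e 0) (e 1)) ->
  (y = prec a g n <-> exists s, is_prec a g n y s).
Proof.
move=> Hg; have := epsilon_spec (inhabits n0) (fun y => exists s, is_prec a g n y s)
  (is_prec_exists a n Hg).
rewrite -/(prec a g n) => -[s Hs]; split=> [->|[s' Hs']]; first by exists s.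
exact: is_prec_unique Hg Hs' Hs.
Qed.

Lemma prec0 a (g : N -> N -> N) : Fn any (fun e => g (e 0) (e 1)) -> prec a g n0 = a.
Proof. by move=> Hg; have /(precP _ _ _ Hg) [s [<- [_ ->]]] := erefl (prec a g n0). Qed.

Lemma precS a (g : N -> N -> N) n : Fn any (fun e => g (e 0) (e 1)) ->
  prec a g (n + n1) = g n (prec a g n).
Proof.
move=> Hg; have /(precP _ _ _ Hg) [s [H0 [HS ->]]] := erefl (prec a g (n + n1)).
rewrite HS; last by nlin.
congr (g n _); apply/(precP _ _ _ Hg); exists s; split=> //; split=> // i L.
by apply: HS; nlin.
Qed.

Lemma Fn_env2 OK (g : N -> N -> env -> N) f h :
  Fn OK (fun e => g (e 0) (e 1) (fun k => e (S (S k)))) -> Fn OK f -> Fn OK h ->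
  Fn OK (fun e => g (f e) (h e) e).
Proof.
move=> Hg Hf Hh; apply: (@Fn_let _ _ f (fun y e => g y (h e) e)) => //.
apply: (@Fn_let _ _ (fun e => h (fun k => e (S k))) (fun y e => g (e 0) y (fun k => e (S k)))).
  exact: Fn_lift.
exact: (Fn_sub (s := @vswap R) Hg (@Tm_vswap R)).
Qed.

Lemma Fn_prec OK f (g : N -> N -> env -> N) h : Fn OK f ->
  Fn OK (fun e => g (e 0) (e 1) (fun k => e (S (S k)))) -> Fn OK h ->
  Fn OK (fun e => prec (f e) (fun i r => g i r e) (h e)).
Proof.
move=> Hf Hg Hh.
apply: (@Sig_ext _ _ (fun e => exists s, val s n0 = f (fun k => e (S k)) /\
  (forall i, i < h (fun k => e (S k)) -> val s (i + n1) = g i (val s i) (fun k => e (S k))) /\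
  e 0 = val s (h (fun k => e (S k))))); last first.
  by move=> e; apply: precP; apply: Fn_inst2 Hg.
have Hg' : Fn OK (fun e => g (e 0) (val (e 1) (e 0)) (fun k => e (S (S (S k))))).
  apply: (@Fn_env2 OK (fun x y e => g x y (fun k => e (S (S (S k)))))); try df.
  apply: (Fn_sub (s := fun k (e : env) => match k with 0 => e 0 | 1 => e 1
    | S (S j) => e (S (S (S (S (S j))))) end) Hg).
  by case=> [|[|j]]; apply: Tm_var.
by df.
Qed.

Definition Sum (f : N -> N) n : N := prec n0 (fun i r => r + f i) n.
Definition exp2 n : N := prec n1 (fun _ r => n2 * r) n.

Lemma Fn_Sum OK (f : N -> env -> N) h : Fn OK (fun e => f (e 0) (fun k => e (S k))) -> Fn OK h ->
  Fn OK (fun e => Sum (fun i => f i e) (h e)).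
Proof.
move=> Hf Hh; apply: (@Fn_prec OK (fun _ => n0) (fun i r e => r + f i e)) => //; try df.
apply: (Fn_sub (s := fun k (e : env) => match k with 0 => e 0 | S j => e (S (S j)) end) Hf).
by case=> [|j]; apply: Tm_var.
Qed.

Lemma Fn_exp2 OK h : Fn OK h -> Fn OK (fun e => exp2 (h e)).
Proof. by move=> Hh; apply: (@Fn_prec OK (fun _ => n1) (fun i r e => n2 * r)) => //; df. Qed.
End Recursion.

Ltac df_sums :=
  first [ lazymatch goal with
  | |- Fn _ (fun _ => Sum _ _) => apply Fn_Sum
  | |- Fn _ (fun _ => exp2 _) => apply Fn_exp2
  end | df_sequences ].
Ltac df_ext ::= df_sums.

(** * Powers of two and finite sums *)

Section Sums.
Variable R : rca0.
Notation N := (dom R).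
Notation env := (nat -> N).
Notation any := (@anyset R).
Implicit Types (x y z i j a b c d m n s t l : N) (e : env).

Lemma exp2_0 : exp2 n0 = n1 :> N.
Proof. by apply: prec0; df. Qed.

Lemma exp2_S n : exp2 (n + n1) = n2 * exp2 n.
Proof. by apply: precS; df. Qed.

Lemma exp2_gt n : n < exp2 n.
Proof.
move: n; apply: (@sig_ind R any); first by df.
  by rewrite exp2_0; nlin.
by move=> n L; rewrite exp2_S; nlin.
Qed.

Lemma exp2_pos n : n0 < exp2 n.
Proof. by have := exp2_gt n => L; nlin. Qed.

Lemma exp2_add m n : exp2 (m + n) = exp2 m * exp2 n.
Proof.
move: n; apply: (@sig_ind R any); first by df.
  by rewrite exp2_0; rewrite nadd0; nlin.
move=> n IH; have -> : m + (n + n1) = (m + n) + n1 by nlin.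
by rewrite !exp2_S IH; nring.
Qed.

Lemma exp2_mono m n : m <= n -> exp2 m <= exp2 n.
Proof.
by move=> /(@sub_ex R) [k ->]; rewrite exp2_add; have := exp2_pos m; have := exp2_pos k => *; nnlin.
Qed.

Section Summands.
Variables (f g : N -> N).
Hypotheses (Hf : Fn any (fun e => f (e 0))) (Hg : Fn any (fun e => g (e 0))).

Lemma Sum0 : Sum f n0 = n0.
Proof. by apply: prec0; df. Qed.

Lemma SumS n : Sum f (n + n1) = Sum f n + f n.
Proof. by apply: precS; df. Qed.
End Summands.

Section Laws.
Variables (f g : N -> N).
Hypotheses (Hf : Fn any (fun e => f (e 0))) (Hg : Fn any (fun e => g (e 0))).

Lemma Sum_le n : (forall i, i < n -> f i <= g i) -> Sum f n <= Sum g n.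
Proof.
move=> H; suff : forall m, m <= n -> Sum f m <= Sum g m by apply; nlin.
apply: (@sig_ind R any); first by df.
  by rewrite !Sum0 // => _; nlin.
by move=> m IH L; rewrite !SumS //; have := IH ltac:(nlin); have := H m ltac:(nlin) => *; nlin.
Qed.

Lemma Sum_D n : Sum (fun i => f i + g i) n = Sum f n + Sum g n.
Proof.
move: n; apply: (@sig_ind R any); first by df.
  by rewrite !Sum0 //; df; nlin.
by move=> n IH; rewrite !SumS // ?IH //; df; nring.
Qed.

Lemma Sum_scale c n : Sum (fun i => c * f i) n = c * Sum f n.
Proof.
move: n; apply: (@sig_ind R any); first by df.
  by rewrite !Sum0 //; df; nlin.
by move=> n IH; rewrite !SumS // ?IH //; df; nring.
Qed.

Lemma Sum_cat m n : Sum f (m + n) = Sum f m + Sum (fun i => f (m + i)) n.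
Proof.
move: n; apply: (@sig_ind R any); first by df.
  by rewrite !Sum0 //; df; rewrite nadd0; nlin.
move=> n IH; have -> : m + (n + n1) = (m + n) + n1 by nlin.
by rewrite !SumS // ?IH //; df; nring.
Qed.

Lemma Sum_ge k n : k < n -> f k <= Sum f n.
Proof.
move: n; apply: (@sig_ind R any); first by df.
  by move=> L; nlin.
move=> n IH L; rewrite SumS //; case: (classic (k < n)) => [/IH L'|L']; first by nlin.
have -> : k = n by nlin.
by nlin.
Qed.

End Laws.

Lemma Sum_ext (f g : N -> N) n : Fn any (fun e => f (e 0)) -> Fn any (fun e => g (e 0)) ->
  (forall i, i < n -> f i = g i) -> Sum f n = Sum g n.
Proof.
by move=> Hf Hg H; apply: nle_anti; apply: Sum_le => // i /H ->; nlin.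
Qed.

Lemma Sum_zero (f : N -> N) n : Fn any (fun e => f (e 0)) ->
  (forall i, i < n -> f i = n0) -> Sum f n = n0.
Proof.
move=> Hf H; rewrite (@Sum_ext f (fun i => n0 * f i)) //; first by rewrite Sum_scale //; nlin.
  by df.
by move=> i /H ->; nlin.
Qed.

Lemma Sum_single (f : N -> N) k n : Fn any (fun e => f (e 0)) -> k < n ->
  (forall i, i < n -> i <> k -> f i = n0) -> Sum f n = f k.
Proof.
move=> Hf L0 H; have [w Ew] : exists w, n = (k + n1) + w by apply: sub_ex; nlin.
rewrite Ew Sum_cat // SumS // Sum_zero //; last first.
  by move=> i L; apply: H; [rewrite Ew; nlin|move=> E; nlin].
rewrite [Sum (fun i => _) _]Sum_zero; [by nlin|by df|].
by move=> i L; apply: H; [rewrite Ew; nlin|move=> E; nlin].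
Qed.

Lemma Sum_exch (f : N -> N -> N) m n : Fn any (fun e => f (e 0) (e 1)) ->
  Sum (fun i => Sum (fun j => f i j) m) n = Sum (fun j => Sum (fun i => f i j) n) m.
Proof.
move=> Hf; move: n; apply: (@sig_ind R any); first by df.
  rewrite Sum0; last by df.
  rewrite Sum_zero //; first by df.
  by move=> i _; rewrite Sum0 //; df.
move=> n IH; rewrite SumS; last by df.
rewrite IH -Sum_D; [|by df|by df].
by apply: Sum_ext => [||i _]; [df|df|rewrite SumS //; df].
Qed.
End Sums.

(** * Strings *)

Section Strings.
Variable R : rca0.
Notation N := (dom R).
Notation env := (nat -> N).
Notation any := (@anyset R).
Implicit Types (x y z i j a b c d m n s t l : N) (e : env).

Lemma Del_IsSeq OK f g : Fn OK f -> Fn OK g -> Del OK (fun e : env => IsSeq (f e) (g e)).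
Proof.
move=> Hf Hg; apply: (Del_app2 (P := @IsSeq R)) => //.
apply: (@Del_ext _ _ (fun e => FinCode (e 0) /\
  (forall z, z < e 0 -> FinMem z (e 0) -> exists i, i < e 1 /\ exists a, a < e 0 /\ z = pr i a) /\
  (forall i, i < e 1 -> exists a, a < e 0 /\ Entry (e 0) i a /\
     forall b, b < e 0 -> Entry (e 0) i b -> b = a))); first by df.
move=> e; split=> -[H1 [H2 H3]]; split=> //; split=> [z|i L].
- move=> L Hz; have [i [a [Li E]]] := H2 z Hz; exists i; split=> //.
  exists a; split=> //; have := @pr_ler R i a; rewrite -E => *; nlin.
- have [a [Ha U]] := H3 i L; exists a; split; first by case: (Entry_lt Ha).
  by split=> // b _; apply: U.
- move=> Hz; have [i [L [a [_ E]]]] := H2 z (FinMem_lt Hz) Hz.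
  by exists i, a.
- have [a [_ [Ha U]]] := H3 i L; exists a; split=> // b Hb.
  by apply: U => //; case: (Entry_lt Hb).
Qed.

Definition IsString s l : Prop := IsSeq s l /\ forall i a, Entry s i a -> a = n0 \/ a = n1.

Lemma Del_IsString OK f g : Fn OK f -> Fn OK g -> Del OK (fun e : env => IsString (f e) (g e)).
Proof.
move=> Hf Hg; apply: (Del_app2 (P := IsString)) => //.
apply: (@Del_ext _ _ (fun e => IsSeq (e 0) (e 1) /\
  forall i, i < e 0 -> forall a, a < e 0 -> Entry (e 0) i a -> a = n0 \/ a = n1)).
  by apply: Del_and; [apply: Del_IsSeq; df|df].
move=> e; split=> -[H1 H2]; split=> // i a; last by move=> H; have [L1 L2] := Entry_lt H; apply: H2 H.
by move=> a' _; apply: H2.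
Qed.

Definition mkstr l (P : N -> Prop) : N :=
  code (pr l n1 + n1) (fun z => exists i, i < l /\ z = pr i (ind (P i))).

Lemma Fn_mkstr OK f (P : N -> env -> Prop) : Fn OK f ->
  Del OK (fun e => P (e 0) (fun k => e (S k))) -> Fn OK (fun e => mkstr (f e) (fun i => P i e)).
Proof.
move=> Hf HP; rewrite /mkstr.
have HP' : Del OK (fun e => P (e 0) (fun k => e (S (S k)))).
  apply: (Del_sub (s := fun k (e : env) => match k with 0 => e 0 | S j => e (S (S j)) end) HP).
  by case=> [|j]; apply: Tm_var.
by df.
Qed.

Lemma ind_le1 (P : Prop) : (ind P : N) <= n1.
Proof. by case: (@ind_or R P) => [[_ ->]|[_ ->]]; nlin. Qed.

Lemma mkstr_entry l (P : N -> Prop) i a : Del any (fun e => P (e 0)) ->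
  Entry (mkstr l P) i a <-> i < l /\ a = ind (P i).
Proof.
move=> HP; have [|_ H2] := @code_spec R (pr l n1 + n1) (fun z => exists i, i < l /\ z = pr i (ind (P i))).
  by df.
rewrite /Entry H2; split=> [[_ [j [L /pr_inj [-> ->]]]] //|[L ->]]; split; last by exists i.
by have := @pr_mono R i (ind (P i)) l n1 ltac:(nlin) (@ind_le1 _) => M; nlin.
Qed.

Lemma mkstr_string l (P : N -> Prop) : Del any (fun e => P (e 0)) -> IsString (mkstr l P) l.
Proof.
move=> HP; have HE := mkstr_entry _ _ _ HP.
have [|H1 H2] := @code_spec R (pr l n1 + n1) (fun z => exists i, i < l /\ z = pr i (ind (P i))).
  by df.
split; last by move=> i a /HE [_ ->]; case: (@ind_or R (P i)) => -[_ ->]; [right|left].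
split=> //; split=> [z /H2 [_ [i [L ->]]]|i L]; first by exists i, (ind (P i)).
by exists (ind (P i)); split; [apply/HE|move=> b /HE []].
Qed.

Lemma mkstr_bit l (P : N -> Prop) i : Del any (fun e => P (e 0)) -> i < l ->
  Entry (mkstr l P) i n1 <-> P i.
Proof.
move=> HP L; rewrite mkstr_entry //; split=> [[_]|p]; last by rewrite ind_true.
by case: (@ind_or R (P i)) => [[//]|[_ ->]] E; case: (@n01 R).
Qed.

Lemma IsString_bit s l i : IsString s l -> i < l -> ~ Entry s i n1 -> Entry s i n0.
Proof.
move=> [[_ [_ H]] B] /H [a [Ha _]] n.
by case: (B _ _ Ha) => E; rewrite E in Ha.
Qed.

Lemma IsString_entry s l i a : IsString s l -> Entry s i a -> i < l.
Proof. by move=> [[_ [H _]] _] /H [j [b [L /pr_inj [-> _]]]]. Qed.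

Lemma IsString_fun s l i a b : IsString s l -> Entry s i a -> Entry s i b -> a = b.
Proof.
move=> Hs Ha Hb; have L := IsString_entry Hs Ha.
by move: Hs => [[_ [_ H]] _]; have [c [_ U]] := H i L; rewrite (U _ Ha) (U _ Hb).
Qed.

Lemma string_sub s t l : IsString s l -> IsString t l ->
  (forall i, i < l -> (Entry s i n1 <-> Entry t i n1)) -> forall z, FinMem z s -> FinMem z t.
Proof.
move=> Hs Ht H z Hz; case: (Hs) => [[_ [Hz' _]] B].
have [i [a [L E]]] := Hz' z Hz; rewrite E in Hz *.
case: (B i a Hz) => Ea; rewrite Ea in Hz *; last exact/H.
by apply: (IsString_bit Ht L) => /(H i L) H1; case: (@n01 R); exact: (IsString_fun Hs Hz H1).
Qed.

Lemma string_ext s t l : IsString s l -> IsString t l ->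
  (forall i, i < l -> (Entry s i n1 <-> Entry t i n1)) -> s = t.
Proof.
move=> Hs Ht H; apply: FinCode_ext; [by case: Hs => [[]]|by case: Ht => [[]]|].
move=> z; split; first exact: string_sub Hs Ht H _.
by apply: string_sub Ht Hs _ _ => i /H ->.
Qed.

Lemma string_le s l : IsString s l -> l <= s.
Proof.
move=> [[_ [_ H]] _]; case: (@n0_or R l) => [->|L]; first by nlin.
have [k Ek] := sub_ex L.
have [a [Ha _]] : exists a, Entry s k a /\ forall b, Entry s k b -> b = a by apply: H; nlin.
by have [L1 _] := Entry_lt Ha; nlin.
Qed.

Lemma string_len_le s l l' : IsString s l -> IsString s l' -> l <= l'.
Proof.
move=> [[_ [_ H]] _] Hs'; rewrite /nle => L; have [a [Ha _]] := H l' L.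
by have := IsString_entry Hs' Ha => L'; nlin.
Qed.

Lemma string_len_unique s l l' : IsString s l -> IsString s l' -> l = l'.
Proof. by move=> H H'; apply: nle_anti; apply: string_len_le; eassumption. Qed.

Definition len s : N := mub (s + n1) (fun l => IsString s l).

Lemma len_eq s l : IsString s l -> len s = l.
Proof.
move=> H; have [|[_ [H' _]]|[_ H']] := @mub_spec R (s + n1) (fun l => IsString s l).
- by apply: Del_IsString; df.
- exact: string_len_unique H' H.
- by case: (H' l) => //; have := string_le H => *; nlin.
Qed.

Lemma Fn_len OK f : Fn OK f -> Fn OK (fun e : env => len (f e)).
Proof.
move=> Hf; rewrite /len; apply: (@Fn_mub R OK (fun e => f e + n1) (fun l e => IsString (f e) l)); first by df.
by apply: Del_IsString; df.
Qed.

Definition Prefix s t : Prop := forall z, FinMem z s -> FinMem z t.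

Lemma Del_Prefix OK f g : Fn OK f -> Fn OK g -> Del OK (fun e : env => Prefix (f e) (g e)).
Proof.
move=> Hf Hg; apply: (Del_app2 (P := Prefix)) => //.
apply: (@Del_ext _ _ (fun e => forall z, z < e 0 -> FinMem z (e 0) -> FinMem z (e 1))); first by df.
by move=> e; split=> H z; [move=> _; apply: H|move=> Hz; apply: H => //; apply: FinMem_lt].
Qed.

Lemma PrefixE s t l k : IsString s l -> IsString t k ->
  (Prefix s t <-> l <= k /\ forall i, i < l -> (Entry s i n1 <-> Entry t i n1)).
Proof.
move=> Hs Ht; split=> [H|[L H] z Hz].
  have L : l <= k.
    rewrite /nle => L; case: (Hs) => [[_ [_ Hk]] _]; have [a [/H Ha _]] := Hk k L.
    by have L' := IsString_entry Ht Ha; nlin.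
  split=> // i Li; split=> [/H //|H1]; apply: NNPP => n.
  have /H H0 := IsString_bit Hs Li n.
  by case: (@n01 R); exact: (IsString_fun Ht H0 H1).
case: (Hs) => [[_ [Hz' _]] B]; have [i [a [Li E]]] := Hz' z Hz; rewrite E in Hz *.
case: (B i a Hz) => Ea; rewrite Ea in Hz *; last exact/H.
apply: (IsString_bit Ht); first by nlin.
by move/(H i Li) => H1; case: (@n01 R); exact: (IsString_fun Hs Hz H1).
Qed.

Definition snoc s a : N := mkstr (len s + n1) (fun i => (i < len s /\ Entry s i n1) \/ (i = len s /\ a = n1)).

Lemma Fn_snoc OK f g : Fn OK f -> Fn OK g -> Fn OK (fun e : env => snoc (f e) (g e)).
Proof.
move=> Hf Hg; rewrite /snoc.
have H1 := Fn_len Hf.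
apply: (@Fn_mkstr OK (fun e => len (f e) + n1)
  (fun i e => (i < len (f e) /\ Entry (f e) i n1) \/ (i = len (f e) /\ g e = n1))); first by df.
have H2 : Fn OK (fun e => len (f (fun k => e (S k)))) by exact: (Fn_lift H1).
by df.
Qed.

Lemma snoc_string s l a : IsString s l -> IsString (snoc s a) (l + n1).
Proof. by move=> H; rewrite /snoc (len_eq H); apply: mkstr_string; df. Qed.

Lemma snoc_bit s l a i : IsString s l -> i < l -> (Entry (snoc s a) i n1 <-> Entry s i n1).
Proof.
move=> H L; rewrite /snoc (len_eq H).
rewrite (@mkstr_bit _ (fun i => (i < l /\ Entry s i n1) \/ (i = l /\ a = n1))); [|by df|by nlin].
by split=> [[[]|[E]] //|H1]; [rewrite E in L; nlin|left].
Qed.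

Lemma snoc_last s l a : IsString s l -> (Entry (snoc s a) l n1 <-> a = n1).
Proof.
move=> H; rewrite /snoc (len_eq H).
rewrite (@mkstr_bit _ (fun i => (i < l /\ Entry s i n1) \/ (i = l /\ a = n1))); [|by df|by nlin].
by split=> [[[L]|[_]] //|H1]; [nlin|right].
Qed.

(** Binary digit [i] of [x], by division with remainder by [2^i]; the bounds on quotient and
    remainder make it Delta01. *)
Definition xbit x i : Prop := exists q, q < x + n1 /\ exists r, r < exp2 i /\ x = exp2 i * (n2 * q + n1) + r.

Lemma xbit_small x l : x < exp2 l -> ~ xbit x l.
Proof.
move=> L [q [_ [r [_ E]]]]; have E' : x = exp2 l + (exp2 l * (n2 * q) + r) by rewrite {1}E; nring.
by have := @le_addr R (exp2 l) (exp2 l * (n2 * q) + r); rewrite -E'.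
Qed.

Lemma xbit_top x l : x < exp2 l -> xbit (exp2 l + x) l.
Proof.
move=> L; exists n0; split; first by have := exp2_pos l => *; nlin.
by exists x; split=> //; nring.
Qed.

Lemma xbit_add x i l : i < l -> (xbit (exp2 l + x) i <-> xbit x i).
Proof.
move=> L; have [w Ew] : exists w, l = i + n1 + w by apply: sub_ex; nlin.
have El : exp2 l = exp2 i * (n2 * exp2 w) by rewrite Ew exp2_add exp2_S; nring.
have p := exp2_pos i.
have q_le u v : u <= exp2 i * (n2 * u + n1) + v.
  have H : u <= exp2 i * u by nnlin.
  by nlin.
rewrite El; split=> -[q [Lq [r [Lr E]]]].
  case: (classic (exp2 w <= q)) => [/sub_ex [v Ev]|Lw].
    have E' : x = exp2 i * (n2 * v + n1) + r by rewrite Ev in E; nlin.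
    exists v; split; last by exists r.
    by have := q_le v r; rewrite -E' => *; nlin.
  have [v Ev] : exists v, exp2 w = q + n1 + v by apply: sub_ex; nlin.
  exfalso; move: (exp2 i) E Lr p => p E Lr p0; rewrite Ev in E.
  have H := @n0_le R (p * v).
  by nlin.
have E' : exp2 i * (n2 * exp2 w) + x = exp2 i * (n2 * (q + exp2 w) + n1) + r by rewrite E; nring.
exists (q + exp2 w); split; last by exists r.
by have := q_le (q + exp2 w) r; rewrite -E' => *; nlin.
Qed.

(** The numbers below [2^L] enumerate the strings of length [L], least significant digit first.
    Appending a bit to the string of [x] then keeps [x] or adds [2^l] to it, so sums over strings
    split along initial segments of the numbers. *)
Definition str L x : N := mkstr L (fun i => xbit x i).

Lemma Del_xbit OK f g : Fn OK f -> Fn OK g -> Del OK (fun e : env => xbit (f e) (g e)).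
Proof. by move=> Hf Hg; rewrite /xbit; df. Qed.

Lemma Fn_str OK f g : Fn OK f -> Fn OK g -> Fn OK (fun e : env => str (f e) (g e)).
Proof.
move=> Hf Hg; apply: (@Fn_mkstr OK f (fun i e => xbit (g e) i)) => //.
by apply: Del_xbit; df.
Qed.

Lemma Del_xbit0 x : Del any (fun e : env => xbit x (e 0)).
Proof. by apply: Del_xbit; df. Qed.

Lemma str_string L x : IsString (str L x) L.
Proof. exact/mkstr_string/Del_xbit0. Qed.

Lemma str_bit L x i : i < L -> (Entry (str L x) i n1 <-> xbit x i).
Proof. by move=> H; apply: mkstr_bit => //; apply: Del_xbit0. Qed.

Lemma str_S0 l x : x < exp2 l -> str (l + n1) x = snoc (str l x) n0.
Proof.
move=> L; have H := str_string l x; have H' := snoc_string n0 H.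
apply: (string_ext (str_string _ _) H') => i Li; rewrite str_bit //.
case: (classic (i < l)) => [L'|L']; first by rewrite (snoc_bit _ H L') str_bit.
have -> : i = l by nlin.
by rewrite (snoc_last _ H); split=> [/(xbit_small L) //|E]; case: (@n01 R).
Qed.

Lemma str_S1 l x : x < exp2 l -> str (l + n1) (exp2 l + x) = snoc (str l x) n1.
Proof.
move=> L; have H := str_string l x; have H' := snoc_string n1 H.
apply: (string_ext (str_string _ _) H') => i Li; rewrite str_bit //.
case: (classic (i < l)) => [L'|L']; first by rewrite (snoc_bit _ H L') str_bit // xbit_add.
have -> : i = l by nlin.
by rewrite (snoc_last _ H); split=> // _; apply: xbit_top.
Qed.

Lemma exp2_split l x : x < exp2 (l + n1) -> x < exp2 l \/ exists y, y < exp2 l /\ x = exp2 l + y.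
Proof.
rewrite exp2_S => L; case: (classic (x < exp2 l)) => [|L']; first by left.
have [y Ey] : exists y, x = exp2 l + y by apply: sub_ex.
by right; exists y; split=> //; nlin.
Qed.

Lemma str_surj s L : IsString s L -> exists x, x < exp2 L /\ s = str L x.
Proof.
(* The number is built from the bits of [s] one at a time; a bit 1 at position [l] adds [exp2 l]. *)
move=> Hs; suff H : forall l, l <= L -> exists x, x < exp2 l /\
    forall i, i < l -> (xbit x i <-> Entry s i n1).
  have [x [Lx Hx]] := H L ltac:(nlin); exists x; split=> //.
  by apply: (string_ext Hs (str_string _ _)) => i Li; rewrite str_bit // Hx.
have D := fun OK f g => @Del_xbit OK f g.
apply: (@sig_ind R any).
  apply: Sig_imp; first by df.
  apply: Sig_ex; apply: Sig_and; first by df.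
  apply: Sig_ball; first by df.
  apply: Sig_Del; apply: Del_iff; last by df.
  by apply: Del_xbit; df.
- by move=> _; exists n0; split; [rewrite exp2_0; nlin|move=> i L'; nlin].
move=> l IH Ll; have [x [Lx Hx]] := IH ltac:(nlin).
case: (classic (Entry s l n1)) => b.
  exists (exp2 l + x); split; first by rewrite exp2_S; nlin.
  move=> i Li; case: (classic (i < l)) => L'; first by rewrite xbit_add // Hx.
  have -> : i = l by nlin.
  by split=> // _; apply: xbit_top.
exists x; split; first by rewrite exp2_S; nlin.
move=> i Li; case: (classic (i < l)) => L'; first by rewrite Hx.
have -> : i = l by nlin.
by split=> // /(xbit_small Lx).
Qed.

Lemma str_inj L x y : x < exp2 L -> y < exp2 L -> str L x = str L y -> x = y.
Proof.
move=> Lx Ly E; have {E} : forall i, i < L -> (xbit x i <-> xbit y i).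
  by move=> i Li; rewrite -(str_bit _ Li) E str_bit.
move: x Lx y Ly; suff : forall L x, x < exp2 L -> forall y, y < exp2 L ->
  (forall i, i < L -> (xbit x i <-> xbit y i)) -> x = y by move=> H *; apply: (H L).
apply: (@sig_ind R any).
  apply: Sig_Del; apply: Del_ball; first by df.
  apply: Del_ball; first by df.
  apply: Del_imp; last by df.
  apply: Del_ball; first by df.
  by apply: Del_iff; apply: Del_xbit; df.
- by rewrite exp2_0 => x Lx y Ly _; nlin.
move=> l IH x Lx y Ly H.
have Hl : xbit x l <-> xbit y l by apply: H; nlin.
case: (exp2_split Lx) => [Lx'|[x' [Lx' Ex]]]; case: (exp2_split Ly) => [Ly'|[y' [Ly' Ey]]].
- by apply: IH => // i Li; apply: H; nlin.
- by case: (xbit_small Lx'); apply/Hl; rewrite Ey; apply: xbit_top.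
- by case: (xbit_small Ly'); apply/Hl; rewrite Ex; apply: xbit_top.
rewrite Ex Ey; congr (_ + _); apply: IH => // i Li.
by have := H i ltac:(nlin); rewrite Ex Ey !xbit_add.
Qed.
End Strings.

Ltac df_strings :=
  first [ lazymatch goal with
  | |- Del _ (fun _ => IsSeq _ _) => apply Del_IsSeq
  | |- Del _ (fun _ => IsString _ _) => apply Del_IsString
  | |- Del _ (fun _ => Prefix _ _) => apply Del_Prefix
  | |- Fn _ (fun _ => len _) => apply Fn_len
  | |- Fn _ (fun _ => snoc _ _) => apply Fn_snoc
  | |- Fn _ (fun _ => str _ _) => apply Fn_str
  | |- Fn _ (fun _ => mkstr _ _) => apply Fn_mkstr
  end | df_sums ].
Ltac df_ext ::= df_strings.

(** * Counting the strings of a given length *)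

Section Counting.
Variable R : rca0.
Notation N := (dom R).
Notation env := (nat -> N).
Notation any := (@anyset R).
Implicit Types (x y z i j a b c d m n s t l : N) (e : env).

(** Inequalities between measures become inequalities between such counts at a common level, which
    are Delta01 and open to induction. *)
Definition cnt (P : N -> Prop) L : N := Sum (fun x => ind (P (str L x))) (exp2 L).

Lemma Fn_cnt OK f (P : N -> env -> Prop) : Fn OK f ->
  Del OK (fun e => P (e 0) (fun k => e (S k))) -> Fn OK (fun e => cnt (fun s => P s e) (f e)).
Proof.
move=> Hf HP; rewrite /cnt.
apply: (@Fn_Sum R OK (fun x e => ind (P (str (f e) x) e))); last by df.
apply: Fn_if; [|by df|by df].
apply: (@Del_let R OK (fun e => str (f (fun k => e (S k))) (e 0)) (fun s e => P s (fun k => e (S k)))).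
  by df.
apply: (Del_sub (s := fun k (e : env) => match k with 0 => e 0 | S j => e (S (S j)) end) HP).
by case=> [|j]; apply: Tm_var.
Qed.

Lemma Fn_ind_str (P : N -> Prop) L : Del any (fun e => P (e 0)) ->
  Fn any (fun e => ind (P (str L (e 0)))).
Proof. by move=> HP; df. Qed.

Section Laws.
Variables (P Q : N -> Prop).
Hypotheses (HP : Del any (fun e => P (e 0))) (HQ : Del any (fun e => Q (e 0))).

Lemma cnt_le L : (forall s, IsString s L -> P s -> Q s) -> cnt P L <= cnt Q L.
Proof.
move=> H; apply: Sum_le; try exact: Fn_ind_str.
move=> x _; case: (@ind_or R (P (str L x))) => -[p ->]; last exact: n0_le.
by rewrite ind_true; [nlin|apply: H => //; apply: str_string].
Qed.

Lemma cnt_ext L : (forall s, IsString s L -> (P s <-> Q s)) -> cnt P L = cnt Q L.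
Proof.
move=> H; apply: Sum_ext; try exact: Fn_ind_str.
by move=> x _; apply: ind_ext; apply: H; apply: str_string.
Qed.

Lemma cnt_S L : cnt P (L + n1) = cnt (fun s => P (snoc s n0)) L + cnt (fun s => P (snoc s n1)) L.
Proof.
rewrite /cnt exp2_S; have -> : n2 * exp2 L = exp2 L + exp2 L by nring.
rewrite Sum_cat; last exact: Fn_ind_str.
congr (_ + _); apply: Sum_ext; try by df.
  by move=> x Lx; rewrite str_S0.
by move=> x Lx; rewrite str_S1.
Qed.

(** The predicate is decided by the first [L] bits, so each further level doubles the count. *)
Lemma cnt_scale L k : (forall s l a, IsString s l -> L <= l -> (P (snoc s a) <-> P s)) ->
  cnt P (L + k) = exp2 k * cnt P L.
Proof.
move=> H; move: k; apply: (@sig_ind R any).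
- apply: Sig_Del; apply: Del_eq; last by df.
  apply: (@Fn_cnt any (fun e => L + e 0) (fun s _ => P s)); first by df.
  exact: HP.
- by rewrite nadd0 exp2_0; nring.
move=> k IH; have -> : L + (k + n1) = (L + k) + n1 by nlin.
have E a : cnt (fun s => P (snoc s a)) (L + k) = cnt P (L + k).
  apply: Sum_ext; try by df.
  move=> x _; apply: ind_ext; apply: (H _ (L + k)); first exact: str_string.
  exact: le_addr.
by rewrite cnt_S !E IH exp2_S; nring.
Qed.

Lemma cnt_single L s : IsString s L -> (forall t, IsString t L -> (P t <-> t = s)) -> cnt P L = n1.
Proof.
move=> /str_surj [x [Lx ->]] H; rewrite /cnt (@Sum_single R _ x) //.
- by apply: ind_true; apply/H => //; apply: str_string.
- exact: Fn_ind_str.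
move=> y Ly ne; apply: ind_false => /(H _ (str_string _ _)) /(str_inj Ly Lx) //.
Qed.

End Laws.

Lemma cnt_disj (P Q : N -> Prop) L : Del any (fun e => P (e 0)) -> Del any (fun e => Q (e 0)) ->
  (forall s, IsString s L -> P s -> ~ Q s) -> cnt (fun s => P s \/ Q s) L = cnt P L + cnt Q L.
Proof.
move=> HP HQ H; rewrite /cnt -Sum_D; try exact: Fn_ind_str.
apply: Sum_ext; try by df.
move=> x _; have Hx := str_string L x.
case: (@ind_or R (P (str L x))) => -[p ->]; case: (@ind_or R (Q (str L x))) => -[q ->].
- by case: (H _ Hx p).
- by rewrite ind_true; [rewrite nadd0|left].
- by rewrite ind_true; [nlin|right].
- by rewrite ind_false; [nlin|case].
Qed.

Lemma prefix_trans s t l : Prefix s t -> Prefix t l -> Prefix s l.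
Proof. by move=> H H' z /H /H'. Qed.

Lemma prefix_snoc s l a : IsString s l -> Prefix s (snoc s a).
Proof.
move=> H; apply/(PrefixE H (snoc_string a H)); split; first by nlin.
by move=> i L; rewrite (snoc_bit _ H).
Qed.

Lemma prefix_len s t l k : IsString s l -> IsString t k -> Prefix s t -> l <= k.
Proof. by move=> Hs Ht /(PrefixE Hs Ht) []. Qed.

Lemma prefix_same_len s t l : IsString s l -> IsString t l -> Prefix s t -> s = t.
Proof. by move=> Hs Ht /(PrefixE Hs Ht) [_ H]; apply: (string_ext Hs Ht). Qed.

Lemma prefix_snocE s t l k a : IsString s l -> IsString t k -> l <= k ->
  (Prefix s (snoc t a) <-> Prefix s t).
Proof.
move=> Hs Ht L; split=> [/(PrefixE Hs (snoc_string a Ht)) [_ H]|H].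
  apply/(PrefixE Hs Ht); split=> // i Li; rewrite (H i Li) (snoc_bit _ Ht) //; nlin.
by apply: prefix_trans H _; apply: prefix_snoc Ht.
Qed.

Lemma prefix_comparable s t u l k : IsString s l -> IsString t k -> l <= k ->
  Prefix s u -> Prefix t u -> (exists m, IsString u m) -> Prefix s t.
Proof.
move=> Hs Ht L H1 H2 [m Hu]; apply/(PrefixE Hs Ht); split=> // i Li.
move/(PrefixE Hs Hu): H1 => [_ H1]; move/(PrefixE Ht Hu): H2 => [_ H2].
by rewrite H1 // H2 //; nlin.
Qed.

Lemma cnt_prefix s l k : IsString s l -> cnt (Prefix s) (l + k) = exp2 k.
Proof.
move=> Hs; rewrite cnt_scale.
- rewrite (@cnt_single _ _ l s) //; [by nring|by df|].
  by move=> t Ht; split=> [/(prefix_same_len Hs Ht) ->|->].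
- by df.
- by move=> t l' a Ht L; apply: prefix_snocE Hs Ht L.
Qed.

Lemma snoc_split s t l k : IsString s l -> IsString t k -> l < k -> Prefix s t ->
  Prefix (snoc s n0) t \/ Prefix (snoc s n1) t.
Proof.
move=> Hs Ht L /(PrefixE Hs Ht) [_ H].
have K a : (Entry t l n1 <-> a = n1) -> Prefix (snoc s a) t.
  move=> Ha; apply/(PrefixE (snoc_string a Hs) Ht); split; first by nlin.
  move=> i Li; case: (classic (i < l)) => L'; first by rewrite (snoc_bit _ Hs L') H.
  have -> : i = l by nlin.
  by rewrite (snoc_last _ Hs) Ha.
case: (classic (Entry t l n1)) => b; [right|left]; apply: K; split=> //.
by move=> E; case: (@n01 R).
Qed.

Lemma snoc_disj s t l k : IsString s l -> IsString t k -> l < k ->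
  Prefix (snoc s n0) t -> ~ Prefix (snoc s n1) t.
Proof.
move=> Hs Ht L /(PrefixE (snoc_string _ Hs) Ht) [_ H0] /(PrefixE (snoc_string _ Hs) Ht) [_ H1].
have Ll : l < l + n1 by nlin.
have := H0 l Ll; rewrite -H1 // !(snoc_last _ Hs) => -[_ E].
by case: (@n01 R); exact: E.
Qed.
End Counting.

(** * Rationals and measures of finite sets of strings *)

Section Rationals.
Variable R : rca0.
Notation N := (dom R).
Notation K := (rfield R).
Notation env := (nat -> N).
Notation any := (@anyset R).
Implicit Types (x y z i j a b c d m n s t l p q : N) (e : env) (u v : K).

Definition rv a b c : K := ((emb a - emb b) / emb c)%R.

Lemma emb_pos c : n0 < c -> (0 < emb c)%R.
Proof. by move/lt_emb; rewrite emb0. Qed.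

Lemma rv_le a b c a' b' c' : n0 < c -> n0 < c' ->
  (a * c' + b' * c <= a' * c + b * c' <-> (rv a b c <= rv a' b' c')%R).
Proof.
move=> /emb_pos Hc /emb_pos Hc'; rewrite le_iff !(embD, embM) /rv.
rewrite ler_pdivrMr // mulrAC ler_pdivlMr // !mulrBl.
by split=> H; lra.
Qed.

Lemma rv_lt a b c a' b' c' : n0 < c -> n0 < c' ->
  (a * c' + b' * c < a' * c + b * c' <-> (rv a b c < rv a' b' c')%R).
Proof.
move=> /emb_pos Hc /emb_pos Hc'; rewrite lt_emb !(embD, embM) /rv.
rewrite ltr_pdivrMr // mulrAC ltr_pdivlMr // !mulrBl.
by split=> H; lra.
Qed.

Lemma rv_eq a b c a' b' c' : n0 < c -> n0 < c' ->
  (a * c' + b' * c = a' * c + b * c' <-> rv a b c = rv a' b' c').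
Proof.
move=> Hc Hc'; split=> E.
  apply/eqP; rewrite eq_le; apply/andP; split; apply/rv_le => //; nlin.
by apply: nle_anti; apply/rv_le => //; rewrite E.
Qed.

Lemma rv_add a b c a' b' c' : n0 < c -> n0 < c' ->
  rv (a * c' + a' * c) (b * c' + b' * c) (c * c') = (rv a b c + rv a' b' c')%R.
Proof.
move=> /emb_pos Hc /emb_pos Hc'; rewrite /rv !(embD, embM).
field; apply/andP; split; exact: lt0r_neq0.
Qed.

Lemma rv_mul a b c a' b' c' : n0 < c -> n0 < c' ->
  rv (a * a' + b * b') (a * b' + b * a') (c * c') = (rv a b c * rv a' b' c')%R.
Proof.
move=> /emb_pos Hc /emb_pos Hc'; rewrite /rv !(embD, embM).
field; apply/andP; split; exact: lt0r_neq0.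
Qed.

Definition half n : K := (emb (exp2 n))^-1%R.

Lemma emb_exp2_pos n : (0 < emb (exp2 n))%R.
Proof. exact/emb_pos/exp2_pos. Qed.

Lemma half_pos n : (0 < half n)%R.
Proof. by rewrite invr_gt0; apply: emb_exp2_pos. Qed.

Lemma half_rv n : half n = rv n1 n0 (exp2 n).
Proof. by rewrite /rv emb1 emb0 subr0 mul1r. Qed.

Lemma halfK n : (half n * emb (exp2 n) = 1)%R.
Proof. by rewrite mulVf //; apply/lt0r_neq0/emb_exp2_pos. Qed.

Lemma half_add m n : half (m + n) = (half m * half n)%R.
Proof. by rewrite /half exp2_add embM invfM. Qed.

Lemma half1 : half n1 = 2^-1%R.
Proof.
rewrite /half; have -> : n1 = n0 + n1 :> N by nlin.
rewrite exp2_S exp2_0 embM embD !emb1; congr (_ ^-1)%R; ring.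
Qed.

Lemma half_S n : half (n + n1) = (half n / 2)%R.
Proof. by rewrite half_add half1. Qed.

Lemma half_mono m n : m <= n -> (half n <= half m)%R.
Proof.
move=> /(@exp2_mono R) /le_iff H; rewrite lef_pV2 // posrE; exact: emb_exp2_pos.
Qed.

(** Field elements lie outside the model; a field-valued function counts as definable when definable
    functions represent its values as fractions, and comparisons of such functions are then
    Delta01. *)
Definition FnK (OK : sets R -> Prop) (f : env -> K) : Prop :=
  exists (a b c : env -> N), [/\ Fn OK a, Fn OK b, Fn OK c, (forall e, n0 < c e) &
    forall e, f e = rv (a e) (b e) (c e)].

Lemma FnK_emb OK f : Fn OK f -> FnK OK (fun e => emb (f e)).
Proof.
move=> H; exists f, (fun _ => n0), (fun _ => n1); split; try by df.
- by move=> e; nlin.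
- by move=> e; rewrite /rv emb0 emb1 subr0 divr1.
Qed.

Lemma FnK_add OK (f g : env -> K) : FnK OK f -> FnK OK g -> FnK OK (fun e => f e + g e)%R.
Proof.
move=> [a [b [c [H1 H2 H3 H4 H5]]]] [a' [b' [c' [H1' H2' H3' H4' H5']]]].
exists (fun e => a e * c' e + a' e * c e), (fun e => b e * c' e + b' e * c e), (fun e => c e * c' e).
split; try by df.
- by move=> e; have := H4 e; have := H4' e => *; nnlin.
- by move=> e; rewrite H5 H5' rv_add.
Qed.

Lemma FnK_mul OK (f g : env -> K) : FnK OK f -> FnK OK g -> FnK OK (fun e => f e * g e)%R.
Proof.
move=> [a [b [c [H1 H2 H3 H4 H5]]]] [a' [b' [c' [H1' H2' H3' H4' H5']]]].
exists (fun e => a e * a' e + b e * b' e), (fun e => a e * b' e + b e * a' e), (fun e => c e * c' e).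
split; try by df.
- by move=> e; have := H4 e; have := H4' e => *; nnlin.
- by move=> e; rewrite H5 H5' rv_mul.
Qed.

Lemma FnK_half OK f : Fn OK f -> FnK OK (fun e => half (f e)).
Proof.
move=> H; exists (fun _ => n1), (fun _ => n0), (fun e => exp2 (f e)); split; try by df.
- by move=> e; apply: exp2_pos.
- by move=> e; apply: half_rv.
Qed.

Lemma Del_leK OK (f g : env -> K) : FnK OK f -> FnK OK g -> Del OK (fun e => (f e <= g e)%R).
Proof.
move=> [a [b [c [H1 H2 H3 H4 H5]]]] [a' [b' [c' [H1' H2' H3' H4' H5']]]].
apply: (@Del_ext _ _ (fun e => a e * c' e + b' e * c e <= a' e * c e + b e * c' e)); first by df.
by move=> e; rewrite H5 H5' -rv_le.
Qed.

Lemma Del_ltK OK (f g : env -> K) : FnK OK f -> FnK OK g -> Del OK (fun e => (f e < g e)%R).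
Proof.
move=> Hf Hg; apply: (@Del_ext _ _ (fun e => ~ (g e <= f e)%R)); first by apply/Del_not/Del_leK.
by move=> e; rewrite ltNge; split=> /negP.
Qed.

Definition RatCode q : Prop := exists a, a < q + n1 /\ exists b, b < q + n1 /\ exists c, c < q + n1 /\
  (n0 < c /\ q = pr (pr a b) c).

Definition rnum q : N := mub (q + n1) (fun a => exists b, b < q + n1 /\ exists c, c < q + n1 /\
  (n0 < c /\ q = pr (pr a b) c)).
Definition rneg q : N := mub (q + n1) (fun b => exists a, a < q + n1 /\ exists c, c < q + n1 /\
  (n0 < c /\ q = pr (pr a b) c)).
Definition rden q : N := mub (q + n1) (fun c => n0 < c /\ exists a, a < q + n1 /\ exists b, b < q + n1 /\
  q = pr (pr a b) c).
Definition ratv q : K := rv (rnum q) (rneg q) (rden q).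

Lemma pr_bounds a b c : a < pr (pr a b) c + n1 /\ b < pr (pr a b) c + n1 /\ c < pr (pr a b) c + n1.
Proof.
have H1 := @pr_lel R (pr a b) c; have H2 := @pr_ler R (pr a b) c.
have H3 := @pr_lel R a b; have H4 := @pr_ler R a b.
by split; [|split]; nlin.
Qed.

Lemma RatCodeE q : RatCode q <-> exists a b c, n0 < c /\ q = pr (pr a b) c.
Proof.
split=> [[a [_ [b [_ [c [_ H]]]]]]|[a [b [c [Hc ->]]]]]; first by exists a, b, c.
have [H1 [H2 H3]] := pr_bounds a b c.
by exists a; split=> //; exists b; split=> //; exists c.
Qed.

Lemma ratv_pr a b c : n0 < c -> ratv (pr (pr a b) c) = rv a b c.
Proof.
move=> Hc; have [H1 [H2 H3]] := pr_bounds a b c; rewrite /ratv; congr rv.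
- have [|[_ [[b' [_ [c' [_ [_ /pr_inj [/pr_inj [E _] _]]]]]] _]]|[_ H]] := @mub_spec R
    (pr (pr a b) c + n1) (fun a' => exists b', b' < pr (pr a b) c + n1 /\
    exists c', c' < pr (pr a b) c + n1 /\ (n0 < c' /\ pr (pr a b) c = pr (pr a' b') c')) => //.
  + by df.
  + by case: (H a) => //; exists b; split=> //; exists c.
- have [|[_ [[b' [_ [c' [_ [_ /pr_inj [/pr_inj [_ E] _]]]]]] _]]|[_ H]] := @mub_spec R
    (pr (pr a b) c + n1) (fun b' => exists a', a' < pr (pr a b) c + n1 /\
    exists c', c' < pr (pr a b) c + n1 /\ (n0 < c' /\ pr (pr a b) c = pr (pr a' b') c')) => //.
  + by df.
  + by case: (H b) => //; exists a; split=> //; exists c.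
- have [|[_ [[_ [b' [_ [c' [_ /pr_inj [_ E]]]]]] _]]|[_ H]] := @mub_spec R
    (pr (pr a b) c + n1) (fun c' => n0 < c' /\ exists a', a' < pr (pr a b) c + n1 /\
    exists b', b' < pr (pr a b) c + n1 /\ pr (pr a b) c = pr (pr a' b') c') => //.
  + by df.
  + by case: (H c) => //; split=> //; exists a; split=> //; exists b.
Qed.

(** If [q] codes no rational, the failed search returns [q + n1], so the denominator is positive in
    every case. *)
Lemma rden_pos q : n0 < rden q.
Proof.
rewrite /rden; set P := fun c => _.
have [|[_ [[H _] _]]|[-> _]] := @mub_spec R (q + n1) P => //; last by nlin.
by rewrite /P; df.
Qed.

Lemma FnK_ratv OK f : Fn OK f -> FnK OK (fun e => ratv (f e)).
Proof.
move=> H; exists (fun e => rnum (f e)), (fun e => rneg (f e)), (fun e => rden (f e)); split=> //.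
- by apply: (Fn_app1 (F := rnum)) => //; rewrite /rnum; df.
- by apply: (Fn_app1 (F := rneg)) => //; rewrite /rneg; df.
- by apply: (Fn_app1 (F := rden)) => //; rewrite /rden; df.
- by move=> e; apply: rden_pos.
Qed.

End Rationals.

(** * The measure of a finite set as a proportion of covered strings *)

Section Measure.
Variable R : rca0.
Notation N := (dom R).
Notation K := (rfield R).
Notation env := (nat -> N).
Notation any := (@anyset R).
Implicit Types (x y z i j a b c d m n s t l p q B L : N) (e : env) (u v : K).

Definition AllStr B : Prop := forall s, FinMem s B -> exists l, IsString s l.
Definition Lens B L : Prop := forall s l, FinMem s B -> IsString s l -> l <= L.
Definition Cov B t : Prop := exists s, s < B /\ (FinMem s B /\ Prefix s t).
Definition Minimal B s : Prop := FinMem s B /\ forall t, t < B -> FinMem t B -> Prefix t s -> t = s.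

Lemma CovE B t : Cov B t <-> exists s, FinMem s B /\ Prefix s t.
Proof.
split=> [[s [_ H]]|[s [H1 H2]]]; exists s => //.
by split=> //; apply: FinMem_lt.
Qed.

Lemma MinimalE B s : Minimal B s <-> FinMem s B /\ forall t, FinMem t B -> Prefix t s -> t = s.
Proof. by split=> -[H1 H2]; split=> // t; [move=> H; apply: H2 => //; apply: FinMem_lt|move=> _; apply: H2]. Qed.

Lemma Lens_code B : Lens B B.
Proof. by move=> s l /FinMem_lt H1 /(@string_le R) H2; nlin. Qed.

Lemma Del_Cov OK f g : Fn OK f -> Fn OK g -> Del OK (fun e => Cov (f e) (g e)).
Proof. by move=> Hf Hg; rewrite /Cov; df. Qed.

Lemma Del_Minimal OK f g : Fn OK f -> Fn OK g -> Del OK (fun e => Minimal (f e) (g e)).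
Proof. by move=> Hf Hg; rewrite /Minimal; df. Qed.

(** A member of least length among the initial segments of [t] is minimal, since a proper initial
    segment of it in [B] would be shorter. *)
Lemma minimal_prefix B t L : AllStr B -> IsString t L -> Cov B t -> exists s, Minimal B s /\ Prefix s t.
Proof.
move=> HB Ht /CovE [s [Hs Ps]]; have [l Hl] := HB s Hs.
have [||l0 [_ [[s0 [_ [Hs0 [Hl0 P0]]]] U]]] :=
  @least R any (fun l => exists s, s < B /\ (FinMem s B /\ (IsString s l /\ Prefix s t))) l.
- by df.
- by exists s; split=> //; apply: FinMem_lt.
exists s0; split=> //; apply/MinimalE; split=> // r Hr Pr; have [lr Hlr] := HB r Hr.
have Lr := prefix_len Hlr Hl0 Pr.
have E : lr = l0.
  apply: nle_anti => //; rewrite /nle => Lt; apply: (U lr Lt).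
  exists r; split; first exact: FinMem_lt.
  by split=> //; split=> //; apply: prefix_trans Pr P0.
by rewrite E in Hlr; apply: prefix_same_len Hlr Hl0 Pr.
Qed.

Lemma minimal_unique B s s' t : AllStr B -> Minimal B s -> Minimal B s' ->
  Prefix s t -> Prefix s' t -> (exists L, IsString t L) -> s = s'.
Proof.
move=> HB /MinimalE [H1 U1] /MinimalE [H2 U2] P1 P2 Ht.
have [l Hl] := HB s H1; have [l' Hl'] := HB s' H2.
case: (classic (l <= l')) => L.
  by apply: U2 => //; apply: prefix_comparable Hl Hl' L P1 P2 Ht.
by apply/esym/U1 => //; apply: (prefix_comparable Hl' Hl _ P2 P1 Ht); nlin.
Qed.

Definition part B L n : N := Sum (fun s => ind (Minimal B s) * cnt (Prefix s) L) n.

Lemma Fn_Prefix_cnt OK f g : Fn OK f -> Fn OK g -> Fn OK (fun e => cnt (Prefix (f e)) (g e)).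
Proof.
move=> Hf Hg; apply: (@Fn_cnt R OK g (fun s e => Prefix (f e) s)) => //.
by apply: Del_Prefix; df.
Qed.

Lemma Fn_Cov_cnt OK f g : Fn OK f -> Fn OK g -> Fn OK (fun e => cnt (Cov (f e)) (g e)).
Proof.
move=> Hf Hg; apply: (@Fn_cnt R OK g (fun s e => Cov (f e) s)) => //.
by apply: Del_Cov; df.
Qed.

Lemma Fn_part_term OK f g h : Fn OK f -> Fn OK g -> Fn OK h ->
  Fn OK (fun e => ind (Minimal (f e) (h e)) * cnt (Prefix (h e)) (g e)).
Proof.
move=> Hf Hg Hh; apply: Fn_mul; last exact: Fn_Prefix_cnt.
by apply: Fn_if; [apply: Del_Minimal|df|df].
Qed.

Lemma Fn_part OK f g h : Fn OK f -> Fn OK g -> Fn OK h -> Fn OK (fun e => part (f e) (g e) (h e)).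
Proof.
move=> Hf Hg Hh.
apply: (@Fn_Sum R OK (fun s e => ind (Minimal (f e) s) * cnt (Prefix s) (g e))) => //.
by apply: Fn_part_term; df.
Qed.

Lemma part_S B L n : part B L (n + n1) = part B L n + ind (Minimal B n) * cnt (Prefix n) L.
Proof. by rewrite /part SumS //; apply: Fn_part_term; df. Qed.

Lemma part_0 B L : part B L n0 = n0.
Proof. by rewrite /part Sum0 //; apply: Fn_part_term; df. Qed.

(** Double counting of the pairs of a minimal string and an extension of it of length [L]: a covered
    string extends exactly one minimal string, any other string none. *)
Lemma measure_sum B L : AllStr B -> part B L B = cnt (Cov B) L.
Proof.
move=> HB.
have D1 : Del any (fun e => Minimal B (e 0)) by apply: Del_Minimal; df.
have D2 : Del any (fun e => Cov B (e 0)) by apply: Del_Cov; df.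
transitivity (Sum (fun s => Sum (fun x => ind (Minimal B s) * ind (Prefix s (str L x))) (exp2 L)) B).
  apply: Sum_ext.
  - by apply: Fn_part_term; df.
  - by df.
  - by move=> s _; rewrite Sum_scale //; df.
rewrite (@Sum_exch R (fun s x => ind (Minimal B s) * ind (Prefix s (str L x)))); last by df.
apply: Sum_ext; try by df.
move=> x _; have Hx := str_string L x.
case: (classic (Cov B (str L x))) => C; last first.
  rewrite (ind_false _ C); apply: Sum_zero; first by df.
  move=> s Ls; case: (classic (Minimal B s)) => M; last by rewrite (ind_false _ M); nring.
  rewrite (@ind_false R (Prefix s (str L x))); first by nring.
  by move=> P; apply: C; apply/CovE; exists s; split=> //; case/MinimalE: M.
have [s0 [M0 P0]] := minimal_prefix HB Hx C.
rewrite (ind_true _ C) (@Sum_single R _ s0).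
- by rewrite !ind_true //; nring.
- by df.
- by case/MinimalE: M0 => /FinMem_lt.
move=> s Ls ne; case: (classic (Minimal B s)) => M; last by rewrite (ind_false _ M); nring.
rewrite (@ind_false R (Prefix s (str L x))); first by nring.
move=> P; apply: ne; apply: (minimal_unique HB M M0 P P0).
by exists L.
Qed.

Lemma Cov_snoc B L s l a : AllStr B -> Lens B L -> IsString s l -> L <= l ->
  (Cov B (snoc s a) <-> Cov B s).
Proof.
move=> HB HL Hs Ll; rewrite !CovE; split=> -[t [Ht P]]; exists t; split=> //.
  have [k Hk] := HB t Ht; have Lk := HL t k Ht Hk; have L' : k <= l by nlin.
  exact: (proj1 (prefix_snocE a Hk Hs L') P).
have [k Hk] := HB t Ht; have Lk := HL t k Ht Hk; have L' : k <= l by nlin.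
exact: (proj2 (prefix_snocE a Hk Hs L') P).
Qed.

Lemma cnt_Cov_scale B L k : AllStr B -> Lens B L -> cnt (Cov B) (L + k) = exp2 k * cnt (Cov B) L.
Proof.
move=> HB HL; apply: cnt_scale; first by apply: Del_Cov; df.
by move=> s l a Hs Ll; apply: Cov_snoc HB HL Hs Ll.
Qed.

(** The code [B] doubles as a level, because the strings in the set are no longer than their codes
    and these are below [B]. Agreement with the sum over minimal strings is [FinMeasureE]. *)
Definition mu B : K := (emb (cnt (Cov B) B) * half B)%R.

Lemma FnK_mu OK f : Fn OK f -> FnK OK (fun e => mu (f e)).
Proof. by move=> H; apply: FnK_mul; [apply: FnK_emb; apply: Fn_Cov_cnt|apply: FnK_half]. Qed.

Lemma cnt_half_scale B L k : AllStr B -> Lens B L ->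
  (emb (cnt (Cov B) (L + k)) * half (L + k) = emb (cnt (Cov B) L) * half L)%R.
Proof.
move=> HB HL; rewrite cnt_Cov_scale // embM half_add.
transitivity (emb (cnt (Cov B) L) * half L * (half k * emb (exp2 k)))%R; first by ring.
by rewrite halfK mulr1.
Qed.

Lemma mu_cnt B L : AllStr B -> Lens B L -> (mu B = emb (cnt (Cov B) L) * half L)%R.
Proof.
move=> HB HL; have HL' := @Lens_code B; rewrite /mu; case: (classic (L <= B)) => H.
  by have [k Ek] := sub_ex H; have := cnt_half_scale k HB HL; rewrite -Ek.
have [k ->] : exists k, L = B + k by apply: sub_ex; nlin.
by rewrite cnt_half_scale.
Qed.
End Measure.

(** * Truth of the coded notions *)

(* For a sentence [p], satisfaction of [db p] is convertible to [sem] of the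
   instance of [p] at the two domains of the model. *)
Fixpoint sem (M : model) (p : pform (dom M) (sets M)) : Prop :=
  match p with
  | pbot => False
  | peq s t => tval (fun x => x) s = tval (fun x => x) t
  | plt s t => mlt (tval (fun x => x) s) (tval (fun x => x) t)
  | pmem t X => mmem (tval (fun x => x) t) X
  | pimp p q => sem p -> sem q
  | pallN p => forall x, sem (p x)
  | pallS p => forall X, sem (p X)
  end.

Section Congruence.
Variable R : rca0.
Notation N := (dom R).
Notation fm := (pform N (sets R)).
Notation ev := (@tval R N (fun x => x)).
Implicit Types (p q : fm).

Lemma sem_and p q P Q : (sem p <-> P) -> (sem q <-> Q) -> (sem (pand p q) <-> P /\ Q).
Proof.
move=> <- <-; split=> /= [H|[Hp Hq] H]; last exact: H.
by split; apply: NNPP => n; apply: H => // Hp Hq; apply: n.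
Qed.

Lemma sem_or p q P Q : (sem p <-> P) -> (sem q <-> Q) -> (sem (por p q) <-> P \/ Q).
Proof.
move=> <- <-; split=> /= [H|[Hp|Hq] H] //.
by case: (classic (sem p)) => [|/H]; [left|right].
Qed.

Lemma sem_imp p q P Q : (sem p <-> P) -> (sem q <-> Q) -> (sem (pimp p q) <-> (P -> Q)).
Proof. by move=> <- <-. Qed.

Lemma sem_iff p q P Q : (sem p <-> P) -> (sem q <-> Q) -> (sem (piff p q) <-> (P <-> Q)).
Proof. by move=> Hp Hq; apply: sem_and; apply: sem_imp. Qed.

Lemma sem_not p P : (sem p <-> P) -> (sem (pnot p) <-> ~ P).
Proof. by move=> <-. Qed.

Lemma sem_all (p : term N -> fm) (P : N -> Prop) :
  (forall x, sem (p (tvar x)) <-> P x) -> (sem (allN p) <-> forall x, P x).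
Proof. by move=> H; split=> H' x; apply/H/H'. Qed.

Lemma sem_ex (p : term N -> fm) (P : N -> Prop) :
  (forall x, sem (p (tvar x)) <-> P x) -> (sem (exN p) <-> exists x, P x).
Proof.
move=> H; split=> /= [H'|[x /H Hx] H']; last exact: (H' x).
by apply: NNPP => n; apply: H' => x /H Hx; apply: n; exists x.
Qed.

Lemma sem_ex1 (p : term N -> fm) (P : N -> Prop) :
  (forall x, sem (p (tvar x)) <-> P x) ->
  (sem (ex1N p) <-> exists x, P x /\ forall y, P y -> y = x).
Proof.
move=> H; apply: sem_ex => x; apply: sem_and => //.
by apply: sem_all => y; apply: sem_imp.
Qed.

Lemma sem_allS (p : sets R -> fm) (P : sets R -> Prop) :
  (forall X, sem (p X) <-> P X) -> (sem (pallS p) <-> forall X, P X).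
Proof. by move=> H; split=> H' x; apply/H/H'. Qed.

Lemma sem_exS (p : sets R -> fm) (P : sets R -> Prop) :
  (forall X, sem (p X) <-> P X) -> (sem (exS p) <-> exists X, P X).
Proof.
move=> H; split=> /= [H'|[x /H Hx] H']; last exact: (H' x).
by apply: NNPP => n; apply: H' => x /H Hx; apply: n; exists x.
Qed.

Lemma sem_le s t : sem (ple s t) <-> ev s <= ev t.
Proof.
have E : sem (ple s t) <-> (ev s < ev t \/ ev s = ev t) by apply: sem_or.
rewrite E; split=> [[L|->]|L]; [by nlin|by nlin|].
by case: (classic (ev s < ev t)) => L'; [left|right; nlin].
Qed.
End Congruence.

(* [sm] pushes [sem] through the connectives and quantifiers, against a
   proposition of the same shape. *)
Ltac sm_ext := fail.
Ltac sm1 :=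
  cbv beta;
  lazymatch goal with
  | |- sem (pand _ _) <-> _ => eapply sem_and
  | |- sem (por _ _) <-> _ => eapply sem_or
  | |- sem (piff _ _) <-> _ => eapply sem_iff
  | |- sem (pnot _) <-> _ => eapply sem_not
  | |- sem (pimp _ _) <-> _ => eapply sem_imp
  | |- sem (ex1N _) <-> _ => eapply sem_ex1; intro
  | |- sem (exN _) <-> _ => eapply sem_ex; intro
  | |- sem (exS _) <-> _ => eapply sem_exS; intro
  | |- sem (allN _) <-> _ => eapply sem_all; intro
  | |- sem (pallS _) <-> _ => eapply sem_allS; intro
  | |- sem (ple _ _) <-> _ => eapply sem_le
  | |- sem (plt _ _) <-> _ => eapply iff_refl
  | |- sem (peq _ _) <-> _ => eapply iff_refl
  | |- sem (pmem _ _) <-> _ => eapply iff_refl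
  | |- _ => sm_ext
  end.
Ltac sm := repeat sm1.

Section FiniteSetNotions.
Variable R : rca0.
Notation N := (dom R).
Notation K := (rfield R).
Notation any := (@anyset R).
Notation tm := (term N).
Notation fm := (pform N (sets R)).
Notation ev := (@tval R N (fun x => x)).
Notation rat := (@Defs.rat N).

Lemma sem_fin_mem (i c : tm) : sem (fin_mem i c : fm) <-> FinMem (ev i) (ev c).
Proof. rewrite /fin_mem /FinMem; sm. Qed.

Lemma sem_fin_code (c : tm) : sem (fin_code c : fm) <-> FinCode (ev c).
Proof. rewrite /fin_code /FinCode; sm; apply: sem_fin_mem. Qed.

Lemma sem_entry (s i a : tm) : sem (entry s i a : fm) <-> Entry (ev s) (ev i) (ev a).
Proof. exact: sem_fin_mem. Qed.
End FiniteSetNotions.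

Ltac sm_ext ::=
  lazymatch goal with
  | |- sem (fin_mem _ _) <-> _ => eapply sem_fin_mem
  | |- sem (fin_code _) <-> _ => eapply sem_fin_code
  | |- sem (entry _ _ _) <-> _ => eapply sem_entry
  end.

Section StringNotions.
Variable R : rca0.
Notation N := (dom R).
Notation K := (rfield R).
Notation any := (@anyset R).
Notation tm := (term N).
Notation fm := (pform N (sets R)).
Notation ev := (@tval R N (fun x => x)).

Lemma sem_is_seq (s l : tm) : sem (is_seq s l : fm) <-> IsSeq (ev s) (ev l).
Proof. rewrite /is_seq /IsSeq; sm. Qed.

Lemma sem_prefix (s t : tm) : sem (prefix s t : fm) <-> Prefix (ev s) (ev t).
Proof. rewrite /prefix /Prefix; sm. Qed.

Lemma sem_is_string (s l : tm) : sem (is_string s l : fm) <-> IsString (ev s) (ev l).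
Proof. rewrite /is_string /IsString; sm; apply: sem_is_seq. Qed.

Lemma sem_string (s : tm) : sem (Defs.string s : fm) <-> exists l, IsString (ev s) l.
Proof. rewrite /Defs.string; sm; apply: sem_is_string. Qed.

Definition IsSnoc (s a t : N) : Prop :=
  exists l, IsString s l /\ IsString t (l + n1) /\ Prefix s t /\ Entry t l a.

Lemma sem_snoc (s a t : tm) : sem (Defs.snoc s a t : fm) <-> IsSnoc (ev s) (ev a) (ev t).
Proof.
rewrite /Defs.snoc /IsSnoc; sm; [apply: sem_is_string|apply: sem_is_string|apply: sem_prefix].
Qed.

Lemma IsSnocE s l a t : IsString s l -> a = n0 \/ a = n1 -> (IsSnoc s a t <-> t = snoc s a).
Proof.
move=> Hs Ha; have Hs' := snoc_string a Hs; split=> [[l' [Hl [Ht [P E]]]]|->].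
  have El := string_len_unique Hl Hs; rewrite El in Hl Ht E.
  apply: (string_ext Ht Hs') => i Li; case: (classic (i < l)) => L.
    by rewrite (snoc_bit _ Hs L); move/(PrefixE Hs Ht): P => [_ H]; rewrite H.
  have -> : i = l by nlin.
  rewrite (snoc_last _ Hs); split=> [H|H]; last by rewrite -H.
  exact: IsString_fun Ht E H.
exists l; split=> //; split=> //; split; first exact: prefix_snoc Hs.
case: Ha => Ea; subst a; last exact/(snoc_last _ Hs).
apply: (IsString_bit Hs'); first by nlin.
by move/(snoc_last _ Hs) => E; case: (@n01 R).
Qed.

Definition rstr (X : sets R) n : N := mkstr n (fun i => mmem i X).

Lemma Del_mem_any (X : sets R) : Del any (fun e => mmem (e 0) X).
Proof. by apply: Del_mem => //; df. Qed.

Lemma rstr_string X n : IsString (rstr X n) n.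
Proof. exact/mkstr_string/Del_mem_any. Qed.

Lemma rstr_bit X n i : i < n -> (Entry (rstr X n) i n1 <-> mmem i X).
Proof. by move=> L; apply: mkstr_bit => //; apply: Del_mem_any. Qed.

Lemma sem_restriction (X : sets R) (n s : tm) :
  sem (restriction X n s : fm) <-> ev s = rstr X (ev n).
Proof.
have E : sem (restriction X n s : fm) <-> IsString (ev s) (ev n) /\
    forall i, i < ev n -> (Entry (ev s) i n1 <-> mmem i X).
  by rewrite /restriction; sm; apply: sem_is_string.
rewrite E; split=> [[H1 H2]|->]; last first.
  by split=> [|i L]; [apply: rstr_string|rewrite rstr_bit].
apply: (string_ext H1 (rstr_string _ _)) => i L.
by rewrite H2 // rstr_bit.
Qed.

Lemma rstr_prefix X l n : l <= n -> Prefix (rstr X l) (rstr X n).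
Proof.
move=> L; apply/(PrefixE (rstr_string X l) (rstr_string X n)); split=> // i Li.
by rewrite !rstr_bit //; nlin.
Qed.

Lemma sem_pow2 (n e : tm) : sem (pow2 n e : fm) <-> ev e = exp2 (ev n).
Proof.
have E : sem (pow2 n e : fm) <-> exists s, IsSeq s (ev n + n1) /\ Entry s n0 n1 /\
    (forall i a, i < ev n -> Entry s i a -> Entry s (i + n1) (n2 * a)) /\ Entry s (ev n) (ev e).
  rewrite /pow2; sm; apply: sem_is_seq.
rewrite E; split=> [[s [Hs [H0 [HS He]]]]|->].
  suff H : forall i, i <= ev n -> Entry s i (exp2 i).
    have [|_ U] := @IsSeq_val R s _ (ev n) Hs; first by nlin.
    by rewrite (U _ He) (U _ (H _ _)) //; nlin.
  apply: (@sig_ind R any); first by df.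
    by rewrite exp2_0.
  by move=> i IH L; rewrite exp2_S; apply: HS; [nlin|apply: IH; nlin].
have [|s [Hs HE]] := @seq_exists R (@exp2 R) (ev n + n1); first by df.
exists s; split=> //; split; first by apply/HE; rewrite exp2_0; split=> //; nlin.
split=> [i a L /HE [_ ->]|]; last by apply/HE; split=> //; nlin.
by apply/HE; rewrite exp2_S; split=> //; nlin.
Qed.

Definition rok (u : Defs.rat) : Prop := n0 < ev (rat_den u).
Definition rvt (u : Defs.rat) : K := rv (ev (rat_pos u)) (ev (rat_neg u)) (ev (rat_den u)).

Lemma sem_rat_le (u v : Defs.rat) : rok u -> rok v ->
  (sem (rat_le u v : fm) <-> (rvt u <= rvt v)%R).
Proof. by move=> Hu Hv; rewrite /rat_le /rvt -rv_le // sem_le. Qed.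

Lemma sem_rat_lt (u v : Defs.rat) : rok u -> rok v ->
  (sem (rat_lt u v : fm) <-> (rvt u < rvt v)%R).
Proof. by move=> Hu Hv; rewrite /rvt -rv_lt. Qed.

Lemma sem_rat_eq (u v : Defs.rat) : rok u -> rok v ->
  (sem (rat_eq u v : fm) <-> rvt u = rvt v).
Proof. by move=> Hu Hv; rewrite /rvt -rv_eq. Qed.

Lemma rok_add u v : rok u -> rok v -> rok (rat_add u v).
Proof. rewrite /rok /= => H1 H2; nnlin. Qed.

Lemma rvt_add u v : rok u -> rok v -> rvt (rat_add u v) = (rvt u + rvt v)%R.
Proof. by move=> Hu Hv; rewrite /rvt -rv_add. Qed.

Lemma rvt_opp u : rvt (rat_opp u) = (- rvt u)%R.
Proof. by rewrite /rvt /rv /= -mulNr opprB. Qed.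

Lemma rvt_nat k : rvt (rat_nat k) = emb (ev k).
Proof. by rewrite /rvt /rv /= emb0 emb1 subr0 divr1. Qed.

Lemma rok_nat k : rok (rat_nat k).
Proof. rewrite /rok /=; nlin. Qed.

Lemma sem_ex_rat (p : Defs.rat -> fm) (P : K -> Prop) :
  (forall u, rok u -> (sem (p u) <-> P (rvt u))) ->
  (sem (ex_rat p) <-> exists a b c, n0 < c /\ P (rv a b c)).
Proof.
move=> H; rewrite /ex_rat; eapply sem_ex => a; eapply sem_ex => b; eapply sem_ex => c.
split=> [Hs|[L Hp]].
  have [L Hp] : n0 < c /\ sem (p (Rat (tvar a) (tvar b) (tvar c))).
    by move: Hs; apply: (proj1 (sem_and _ _)).
  by split=> //; apply/(H (Rat (tvar a) (tvar b) (tvar c))).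
apply: (proj2 (sem_and (iff_refl _) (iff_refl _))); split=> //.
exact/(H (Rat (tvar a) (tvar b) (tvar c))).
Qed.

Lemma sem_with_rat (q : tm) (p : Defs.rat -> fm) (P : K -> Prop) :
  (forall u, rok u -> (sem (p u) <-> P (rvt u))) ->
  (sem (with_rat q p) <-> RatCode (ev q) /\ P (ratv (ev q))).
Proof.
move=> H; pose A a b c := n0 < c /\ ev q = pr (pr a b) c /\ P (rv a b c).
have E : sem (with_rat q p) <-> exists a b c, A a b c.
  rewrite /with_rat /ex_rat; eapply sem_ex => a; eapply sem_ex => b; eapply sem_ex => c.
  split=> [Hs|[L [Eq Hp]]].
    have [L [Eq Hp]] : n0 < c /\ ev q = pr (pr a b) c /\ sem (p (Rat (tvar a) (tvar b) (tvar c))).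
      by move: Hs; apply: (proj1 (sem_and (iff_refl _) (sem_and (iff_refl _) (iff_refl _)))).
    by split=> //; split=> //; apply/(H (Rat (tvar a) (tvar b) (tvar c))).
  apply: (proj2 (sem_and (iff_refl _) (sem_and (iff_refl _) (iff_refl _)))).
  by split=> //; split=> //; apply/(H (Rat (tvar a) (tvar b) (tvar c))).
rewrite E RatCodeE; split=> [[a [b [c [L [Eq Hp]]]]]|[[a [b [c [L Eq]]]] Hp]].
  by split; [exists a, b, c|rewrite Eq ratv_pr].
by exists a, b, c; split=> //; split=> //; rewrite Eq ratv_pr in Hp.
Qed.

Lemma sem_with_exp2_neg (n : tm) (p : Defs.rat -> fm) (P : K -> Prop) :
  (forall u, rok u -> (sem (p u) <-> P (rvt u))) ->
  (sem (with_exp2_neg n p) <-> P (half (ev n))).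
Proof.
move=> H; have A e : n0 < e -> sem (p (Rat tone tzero (tvar e))) <-> P (rv n1 n0 e).
  exact: (H (Rat tone tzero (tvar e))).
have E : sem (with_exp2_neg n p) <-> exists e, e = exp2 (ev n) /\ sem (p (Rat tone tzero (tvar e))).
  by rewrite /with_exp2_neg; sm; [apply: sem_pow2|apply: iff_refl].
rewrite E half_rv; split=> [[e [-> /A]]|H']; first by apply; apply: exp2_pos.
by exists (exp2 (ev n)); split=> //; apply/A => //; apply: exp2_pos.
Qed.
End StringNotions.

Ltac sm_base :=
  lazymatch goal with
  | |- sem (fin_mem _ _) <-> _ => eapply sem_fin_mem
  | |- sem (fin_code _) <-> _ => eapply sem_fin_code
  | |- sem (entry _ _ _) <-> _ => eapply sem_entry
  | |- sem (is_seq _ _) <-> _ => eapply sem_is_seq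
  | |- sem (prefix _ _) <-> _ => eapply sem_prefix
  | |- sem (is_string _ _) <-> _ => eapply sem_is_string
  | |- sem (Defs.string _) <-> _ => eapply sem_string
  | |- sem (Defs.snoc _ _ _) <-> _ => eapply sem_snoc
  | |- sem (restriction _ _ _) <-> _ => eapply sem_restriction
  | |- sem (pow2 _ _) <-> _ => eapply sem_pow2
  end.
Ltac sm_ext ::= sm_base.

Ltac df_set :=
  first [ lazymatch goal with
  | |- Del _ (fun _ => mmem _ _) => apply Del_mem; [first [exact I | assumption]|]
  | |- Del _ (fun _ => Cov _ _) => apply Del_Cov
  | |- Del _ (fun _ => Minimal _ _) => apply Del_Minimal
  | |- Del _ (fun _ => is_true (_ <= _)%R) => apply Del_leK
  | |- Del _ (fun _ => is_true (_ < _)%R) => apply Del_ltK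
  | |- FnK _ (fun _ => emb _) => apply FnK_emb
  | |- FnK _ (fun _ => half _) => apply FnK_half
  | |- FnK _ (fun _ => mu _) => apply FnK_mu
  | |- FnK _ (fun _ => ratv _) => apply FnK_ratv
  | |- FnK _ (fun _ => (_ + _)%R) => apply FnK_add
  | |- FnK _ (fun _ => (_ * _)%R) => apply FnK_mul
  | |- Fn _ (fun _ => cnt (Cov _) _) => apply Fn_Cov_cnt
  | |- Fn _ (fun _ => cnt (Prefix _) _) => apply Fn_Prefix_cnt
  | |- Fn _ (fun _ => cnt _ _) => apply Fn_cnt
  | |- Fn _ (fun _ => part _ _ _) => apply Fn_part
  end | df_strings ].
Ltac df_ext ::= df_set.

(** * Sets that are Delta01 in [Z] are computable from [Z] *)

Section Eval.
Variable R : rca0.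
Notation N := (dom R).
Notation env := (nat -> N).
Notation any := (@anyset R).
Variable Z : sets R.
Implicit Types (x y z i j a b c d m n s t l p q u v r : N) (e : env).

Definition cn (k : nat) : N := @tval R N (fun x => x) (num k).

Definition EvalStep (E : N -> N -> N -> Prop) c x y : Prop :=
  (exists k, c = pr (cn 0) k /\ y = k) \/
  (c = pr (cn 1) n0 /\ y = x) \/
  (c = pr (cn 2) n0 /\ y = x + n1) \/
  (c = pr (cn 3) n0 /\ exists v, x = pr y v) \/
  (c = pr (cn 4) n0 /\ exists u, x = pr u y) \/
  (c = pr (cn 5) n0 /\ ((mmem x Z /\ y = n1) \/ (~ mmem x Z /\ y = n0))) \/
  (exists a b u v, c = pr (cn 6) (pr a b) /\ E a x u /\ E b x v /\ y = pr u v) \/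
  (exists a b u, c = pr (cn 7) (pr a b) /\ E b x u /\ E a u y) \/
  (exists a b u n, c = pr (cn 8) (pr a b) /\ x = pr u n /\
     ((n = n0 /\ E a u y) \/
      (exists m r, n = m + n1 /\ E c (pr u m) r /\ E b (pr u (pr m r)) y))) \/
  (exists a, c = pr (cn 9) a /\ E a (pr x y) n0 /\
     forall n, n < y -> exists v, E a (pr x n) (v + n1)).

Definition Valid d l : Prop := IsSeq d l /\
  forall i c u v, Entry d i (pr c (pr u v)) ->
    EvalStep (fun c' u' v' => exists j, j < i /\ Entry d j (pr c' (pr u' v'))) c u v.

Definition Has d q : Prop := exists i, Entry d i q.

Definition EvalP c x y : Prop := exists d l, Valid d l /\ Has d (pr c (pr x y)).

Lemma EvalStep_mono (E E' : N -> N -> N -> Prop) c x y :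
  (forall c u v, E c u v -> E' c u v) -> EvalStep E c x y -> EvalStep E' c x y.
Proof.
move=> H; case=> [H0|[H0|[H0|[H0|[H0|[H0|[H0|[H0|[H0|H0]]]]]]]]].
- by left.
- by right; left.
- by do 2 right; left.
- by do 3 right; left.
- by do 4 right; left.
- by do 5 right; left.
- do 6 right; left; move: H0 => [a [b [u [v [E1 [/H E2 [/H E3 E4]]]]]]].
  by exists a, b, u, v.
- do 7 right; left; move: H0 => [a [b [u [E1 [/H E2 /H E3]]]]].
  by exists a, b, u.
- do 8 right; left; move: H0 => [a [b [u [n [E1 [E2 E3]]]]]].
  exists a, b, u, n; split=> //; split=> //.
  case: E3 => [[E3 /H E4]|[m [r [E3 [/H E4 /H E5]]]]]; [by left|right].
  by exists m, r.
- do 9 right; move: H0 => [a [E1 [/H E2 E3]]].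
  exists a; split=> //; split=> // n /E3 [v /H E4].
  by exists v.
Qed.

Lemma Sig_Valid OK f g : OK Z -> Fn OK f -> Fn OK g -> Sig OK (fun e => Valid (f e) (g e)).
Proof.
move=> HZ Hf Hg; apply: (Sig_app2 (P := Valid)) => //.
apply: (@Sig_ext _ _ (fun e => IsSeq (e 0) (e 1) /\ forall i, i < e 0 -> forall c, c < e 0 ->
  forall u, u < e 0 -> forall v, v < e 0 -> Entry (e 0) i (pr c (pr u v)) ->
  EvalStep (fun c' u' v' => exists j, j < i /\ Entry (e 0) j (pr c' (pr u' v'))) c u v)).
  by rewrite /EvalStep; df.
move=> e; split=> -[H1 H2]; split=> // i; last first.
  move=> c u v H; have [L1 L2] := Entry_lt H.
  have L3 := @pr_lel R c (pr u v); have L4 := @pr_ler R c (pr u v).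
  have L5 := @pr_lel R u v; have L6 := @pr_ler R u v.
  by apply: H2 H => //; nlin.
by move=> _ c _ u _ v _; apply: H2.
Qed.

Lemma Sig_Has OK f g : Fn OK f -> Fn OK g -> Sig OK (fun e => Has (f e) (g e)).
Proof. by move=> Hf Hg; rewrite /Has; df. Qed.

Lemma Sig_EvalP f g h : Fn any f -> Fn any g -> Fn any h ->
  Sig any (fun e => EvalP (f e) (g e) (h e)).
Proof.
move=> Hf Hg Hh; rewrite /EvalP; apply: Sig_ex; apply: Sig_ex; apply: Sig_and.
  by apply: Sig_Valid => //; df.
by apply: Sig_Has; df.
Qed.

(** Truncated subtraction, from which the Boolean operations on characteristic functions are
    built. *)
Definition nsub x y : N := mub x (fun z => x <= y + z).

Lemma Fn_nsub OK f g : Fn OK f -> Fn OK g -> Fn OK (fun e : env => nsub (f e) (g e)).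
Proof. by move=> Hf Hg; apply: (Fn_app2 (F := nsub)) => //; rewrite /nsub; df. Qed.

Lemma nsub_le x y : y <= x -> y + nsub x y = x.
Proof.
move=> L; have [|[H1 [H2 H3]]|[H1 H3]] := @mub_spec R x (fun z => x <= y + z); first by df.
  rewrite -/(nsub x y) in H1 H2 H3; apply: nle_anti => //; rewrite /nle => L'.
  have [w Ew] := sub_ex L; apply: (H3 w); rewrite {1}Ew in L'; first by nlin.
  by rewrite -Ew; nlin.
rewrite -/(nsub x y) in H1; rewrite H1.
case: (@n0_or R y) => [->|L']; first by nlin.
have [w Ew] := sub_ex L; case: (H3 w); first by nlin.
by rewrite -Ew; nlin.
Qed.

Lemma nsub_gt x y : x <= y -> nsub x y = n0.
Proof.
move=> L; have [|[H1 [H2 H3]]|[H1 H3]] := @mub_spec R x (fun z => x <= y + z); first by df.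
  rewrite -/(nsub x y) in H1 H2 H3; case: (@n0_or R (nsub x y)) => // L'.
  by case: (H3 n0); nlin.
rewrite -/(nsub x y) in H1; rewrite H1; case: (@n0_or R x) => // L'.
by case: (H3 n0); nlin.
Qed.

(** Concatenation keeps every claim justified, because justifications refer only to earlier claims
    and the positions of the second computation are shifted uniformly. *)
Lemma valid_app d l d' l' : Valid d l -> Valid d' l' -> exists d'' l'', Valid d'' l'' /\
  (forall q, Has d q -> Has d'' q) /\ (forall q, Has d' q -> Has d'' q).
Proof.
move=> [Hd Vd] [Hd' Vd'].
pose f i := if asb (i < l) then val d i else val d' (nsub i l).
have [|s [Hs HE]] := @seq_exists R f (l + l').
  by have H := @Fn_nsub any; rewrite /f; df; apply: H; df.
have A i q : Entry d i q -> Entry s i q /\ i < l.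
  move=> H; have Li : i < l.
    by case: Hd => _ [Hz _]; have [j [b [L /pr_inj [-> _]]]] := Hz _ H.
  split=> //; apply/HE; split; first by nlin.
  rewrite /f; case: asbP => // _; by have [_ U] := IsSeq_val Hd Li; apply: U.
have B i q : Entry d' i q -> Entry s (l + i) q.
  move=> H; have Li : i < l'.
    by case: Hd' => _ [Hz _]; have [j [b [L /pr_inj [-> _]]]] := Hz _ H.
  apply/HE; split; first by nlin.
  rewrite /f; case: asbP => [L|_]; first by nlin.
  have -> : nsub (l + i) l = i by have := @nsub_le (l + i) l (@le_addr _ _ _) => *; nlin.
  by have [_ U] := IsSeq_val Hd' Li; apply: U.
exists s, (l + l'); split; last first.
  by split=> q [i Hi]; [exists i; case: (A _ _ Hi)|exists (l + i); apply: B].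
split=> // i c u v /HE [Li Ef].
move: Ef; rewrite /f; case: asbP => L Ef.
  have [H _] := IsSeq_val Hd L; rewrite -Ef in H.
  apply: EvalStep_mono (Vd _ _ _ _ H) => c' u' v' [j [Lj Hj]].
  by exists j; split=> //; case: (A _ _ Hj).
have Ei : l + nsub i l = i by apply: nsub_le.
have L' : nsub i l < l' by nlin.
have [H _] := IsSeq_val Hd' L'; rewrite -Ef in H.
apply: EvalStep_mono (Vd' _ _ _ _ H) => c' u' v' [j [Lj Hj]].
exists (l + j); split; last exact: B.
by rewrite -Ei; nlin.
Qed.

Lemma valid_add d l c x y : Valid d l -> EvalStep (fun c u v => Has d (pr c (pr u v))) c x y ->
  exists d' l', Valid d' l' /\ (forall q, Has d q -> Has d' q) /\ Has d' (pr c (pr x y)).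
Proof.
move=> [Hd Vd] St; pose f i := if asb (i < l) then val d i else pr c (pr x y).
have [|s [Hs HE]] := @seq_exists R f (l + n1); first by rewrite /f; df.
have A i q : Entry d i q -> Entry s i q /\ i < l.
  move=> H; have Li : i < l.
    by case: Hd => _ [Hz _]; have [j [b [L /pr_inj [-> _]]]] := Hz _ H.
  split=> //; apply/HE; split; first by nlin.
  rewrite /f; case: asbP => // _; by have [_ U] := IsSeq_val Hd Li; apply: U.
exists s, (l + n1); split; last first.
  split; first by move=> q [i Hi]; exists i; case: (A _ _ Hi).
  exists l; apply/HE; split; first by nlin.
  by rewrite /f; case: asbP => // L; nlin.
split=> // i c' u v /HE [Li Ef].
move: Ef; rewrite /f; case: asbP => L Ef.
  have [H _] := IsSeq_val Hd L; rewrite -Ef in H.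
  apply: EvalStep_mono (Vd _ _ _ _ H) => c2 u' v' [j [Lj Hj]].
  by exists j; split=> //; case: (A _ _ Hj).
move/pr_inj: Ef => [-> /pr_inj [-> ->]].
apply: EvalStep_mono St => c2 u' v' [j Hj].
by have [H Lj] := A _ _ Hj; exists j; split=> //; nlin.
Qed.

Lemma valid_nil : exists d l, Valid d l.
Proof.
have [|s [Hs HE]] := @seq_exists R (fun _ => n0) n0; first by df.
by exists s, n0; split=> // i c u v /HE [L _]; nlin.
Qed.

Lemma EvalP_step (E : N -> N -> N -> Prop) d l c x y : Valid d l ->
  (forall c u v, E c u v -> Has d (pr c (pr u v))) -> EvalStep E c x y -> EvalP c x y.
Proof.
move=> Vd HE St; have [d' [l' [V [_ H]]]] := valid_add Vd (EvalStep_mono HE St).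
by exists d', l'.
Qed.

Lemma EvalP_axiom c x y : EvalStep (fun _ _ _ => False) c x y -> EvalP c x y.
Proof. by have [d [l V]] := valid_nil; apply: EvalP_step V _. Qed.

Lemma EvalP_2 c1 x1 y1 c2 x2 y2 : EvalP c1 x1 y1 -> EvalP c2 x2 y2 -> exists d l,
  Valid d l /\ Has d (pr c1 (pr x1 y1)) /\ Has d (pr c2 (pr x2 y2)).
Proof.
move=> [d [l [V H]]] [d' [l' [V' H']]]; have [s [k [Vs [A B]]]] := valid_app V V'.
by exists s, k; split=> //; split; [apply: A|apply: B].
Qed.

Definition icst k := pr (cn 0) k.
Definition iid := pr (cn 1) n0.
Definition isucc := pr (cn 2) n0.
Definition ifst := pr (cn 3) n0.
Definition isnd := pr (cn 4) n0.
Definition ipair a b := pr (cn 6) (pr a b).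
Definition icomp a b := pr (cn 7) (pr a b).
Definition irec a b := pr (cn 8) (pr a b).
Definition imu a := pr (cn 9) a.

Lemma EvalP_cst k x : EvalP (icst k) x k.
Proof. by apply: EvalP_axiom; left; exists k. Qed.
Lemma EvalP_id x : EvalP iid x x.
Proof. by apply: EvalP_axiom; right; left. Qed.
Lemma EvalP_succ x : EvalP isucc x (x + n1).
Proof. by apply: EvalP_axiom; do 2 right; left. Qed.
Lemma EvalP_fst x y : EvalP ifst (pr x y) x.
Proof. by apply: EvalP_axiom; do 3 right; left; split=> //; exists y. Qed.
Lemma EvalP_snd x y : EvalP isnd (pr x y) y.
Proof. by apply: EvalP_axiom; do 4 right; left; split=> //; exists x. Qed.

Lemma EvalP_pair a b x u v : EvalP a x u -> EvalP b x v -> EvalP (ipair a b) x (pr u v).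
Proof.
move=> Ha Hb; have [d [l [V [H1 H2]]]] := EvalP_2 Ha Hb.
apply: (EvalP_step V (E := fun c u v => Has d (pr c (pr u v)))) => //.
by do 6 right; left; exists a, b, u, v.
Qed.

Lemma EvalP_comp a b x u y : EvalP b x u -> EvalP a u y -> EvalP (icomp a b) x y.
Proof.
move=> Ha Hb; have [d [l [V [H1 H2]]]] := EvalP_2 Ha Hb.
apply: (EvalP_step V (E := fun c u v => Has d (pr c (pr u v)))) => //.
by do 7 right; left; exists a, b, u.
Qed.

Lemma EvalP_rec0 a b u y : EvalP a u y -> EvalP (irec a b) (pr u n0) y.
Proof.
move=> [d [l [V H]]].
apply: (EvalP_step V (E := fun c u v => Has d (pr c (pr u v)))) => //.
by do 8 right; left; exists a, b, u, n0; split=> //; split=> //; left.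
Qed.

Lemma EvalP_recS a b u m r y : EvalP (irec a b) (pr u m) r -> EvalP b (pr u (pr m r)) y ->
  EvalP (irec a b) (pr u (m + n1)) y.
Proof.
move=> Ha Hb; have [d [l [V [H1 H2]]]] := EvalP_2 Ha Hb.
apply: (EvalP_step V (E := fun c u v => Has d (pr c (pr u v)))) => //.
do 8 right; left; exists a, b, u, (m + n1); split=> //; split=> //; right.
by exists m, r.
Qed.

Lemma EvalP_mu a x y : EvalP a (pr x y) n0 ->
  (forall n, n < y -> exists v, EvalP a (pr x n) (v + n1)) -> EvalP (imu a) x y.
Proof.
move=> H0 H.
(* The computations for all [n < y] are merged into one by Sigma01 induction on the bound. The
   condition [n < y] occurs twice because only its first occurrence is generalized. *)
have [d [l [V Hd]]] : exists d l, Valid d l /\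
    forall n, n < y -> n < y -> exists v, Has d (pr a (pr (pr x n) (v + n1))).
  move: {1}y; apply: (@sig_ind R any).
  - apply: Sig_ex; apply: Sig_ex; apply: Sig_and; first by apply: Sig_Valid => //; df.
    by rewrite /Has; df.
  - by have [d [l V]] := valid_nil; exists d, l; split=> // n L; nlin.
  - move=> k [d [l [V Hk]]]; case: (classic (k < y)) => Lk; last first.
      by exists d, l; split=> // n Ln Ly; apply: Hk => //; nlin.
    have [v [d' [l' [V' Hv]]]] := H k Lk; have [s [j [Vs [A B]]]] := valid_app V V'.
    exists s, j; split=> // n Ln Ly; case: (classic (n < k)) => L.
      by have [w Hw] := Hk n L Ly; exists w; apply: A.
    have En : n = k by nlin.
    by exists v; rewrite En; apply: B.
have [d0 [l0 [V0 H0']]] := H0; have [s [j [Vs [A B]]]] := valid_app V V0.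
apply: (EvalP_step Vs (E := fun c u v => Has s (pr c (pr u v)))) => //.
do 9 right; exists a; split=> //; split; first exact: B.
by move=> n L; have [v Hv] := Hd n L L; exists v; apply: A.
Qed.

(* Primitive recursion, along the values of a function known to be definable. *)
Lemma EvalP_rec a b u (H : N -> N) : Fn any (fun e => H (e 0)) -> EvalP a u (H n0) ->
  (forall m, EvalP b (pr u (pr m (H m))) (H (m + n1))) ->
  forall n, EvalP (irec a b) (pr u n) (H n).
Proof.
move=> HH H0 HS; apply: (@sig_ind R any).
- by apply: Sig_EvalP; df.
- exact: EvalP_rec0.
- by move=> m IH; apply: EvalP_recS IH (HS m).
Qed.

Definition Ix1 (F : N -> N) : Prop := exists a, forall x, EvalP a x (F x).
Definition Ix2 (F : N -> N -> N) : Prop := exists a, forall x y, EvalP a (pr x y) (F x y).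

Lemma Ix2_add : Ix2 (@madd R).
Proof.
exists (irec iid (icomp isucc (icomp isnd isnd))) => x; apply: EvalP_rec; first by df.
  by rewrite nadd0; apply: EvalP_id.
move=> m; have -> : x + (m + n1) = (x + m) + n1 by nlin.
apply: EvalP_comp (EvalP_succ _); apply: EvalP_comp (EvalP_snd _ _) (EvalP_snd _ _).
Qed.

Lemma Ix2_mul : Ix2 (@mmul R).
Proof.
have [a Ha] := Ix2_add.
exists (irec (icst n0) (icomp a (ipair (icomp isnd isnd) ifst))) => x.
apply: EvalP_rec; first by df.
  rewrite (_ : x * n0 = n0); last by nring.
  exact: EvalP_cst.
move=> m; have -> : x * (m + n1) = x * m + x by nring.
apply: EvalP_comp (Ha _ _); apply: EvalP_pair; last exact: EvalP_fst.
exact: EvalP_comp (EvalP_snd _ _) (EvalP_snd _ _).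
Qed.

Lemma Ix1_pred : Ix1 (fun x => nsub x n1).
Proof.
exists (icomp (irec (icst n0) (icomp ifst isnd)) (ipair (icst n0) iid)) => x.
apply: EvalP_comp; first by apply: EvalP_pair; [apply: EvalP_cst|apply: EvalP_id].
move: x; apply: (@EvalP_rec _ _ n0 (fun x => nsub x n1)); first by apply: Fn_nsub; df.
  by rewrite nsub_gt; [apply: EvalP_cst|nlin].
move=> m; have -> : nsub (m + n1) n1 = m.
  by have := @nsub_le (m + n1) n1 ltac:(nlin) => E; nlin.
by apply: EvalP_comp (EvalP_snd _ _) (EvalP_fst _ _).
Qed.

Lemma Ix2_nsub : Ix2 nsub.
Proof.
have [a Ha] := Ix1_pred; exists (irec iid (icomp a (icomp isnd isnd))) => x.
apply: EvalP_rec; first by apply: Fn_nsub; df.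
  have -> : nsub x n0 = x by have := @nsub_le x n0 ltac:(nlin) => E; nlin.
  exact: EvalP_id.
move=> m; have -> : nsub x (m + n1) = nsub (nsub x m) n1.
  case: (classic (m < x)) => L.
    have E1 := @nsub_le x m ltac:(nlin); have E2 := @nsub_le x (m + n1) ltac:(nlin).
    by have E3 := @nsub_le (nsub x m) n1 ltac:(nlin); nlin.
  by rewrite [nsub x (m + n1)]nsub_gt ?[nsub x m]nsub_gt ?nsub_gt //; nlin.
by apply: EvalP_comp (Ha _); apply: EvalP_comp (EvalP_snd _ _) (EvalP_snd _ _).
Qed.

(* The argument vector [(e 0, ..., e (k - 1))]. *)
Fixpoint cv (k : nat) (e : env) : N :=
  match k with 0 => n0 | S k => pr (e 0) (cv k (fun h => e (S h))) end.

Definition Rec (k : nat) (f : env -> N) : Prop := exists c, forall e, EvalP c (cv k e) (f e).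

Lemma Rec_var (k i : nat) : Nat.lt i k -> Rec k (fun e => e i).
Proof.
elim: k i => [|k IH] [|i] L; try lia; first by exists ifst => e; apply: EvalP_fst.
have [|c Hc] := IH i; first by lia.
exists (icomp c isnd) => e; apply: EvalP_comp (EvalP_snd _ _) _.
exact: (Hc (fun h => e (S h))).
Qed.

Lemma Rec_cst k x : Rec k (fun _ => x).
Proof. by exists (icst x) => e; apply: EvalP_cst. Qed.

Lemma Rec_app1 k F f : Ix1 F -> Rec k f -> Rec k (fun e => F (f e)).
Proof. by move=> [a Ha] [b Hb]; exists (icomp a b) => e; apply: EvalP_comp (Hb e) (Ha _). Qed.

Lemma Rec_app2 k F f g : Ix2 F -> Rec k f -> Rec k g -> Rec k (fun e => F (f e) (g e)).
Proof.
move=> [a Ha] [b Hb] [c Hc]; exists (icomp a (ipair b c)) => e.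
by apply: EvalP_comp (Ha _ _); apply: EvalP_pair.
Qed.

Lemma Rec_ext k f g : Rec k f -> (forall e, g e = f e) -> Rec k g.
Proof. by move=> [c Hc] E; exists c => e; rewrite E. Qed.

Definition RecP k (P : env -> Prop) : Prop := Rec k (fun e => ind (P e)).

Lemma RecP_ext k (P Q : env -> Prop) : RecP k P -> (forall e, Q e <-> P e) -> RecP k Q.
Proof. by move=> H E; apply: Rec_ext H _ => e; apply: ind_ext. Qed.

Lemma ind_nsub_lt x y : ind (x < y) = nsub n1 (nsub n1 (nsub y x)).
Proof.
case: (classic (x < y)) => L.
  rewrite ind_true // [nsub n1 (nsub y x)]nsub_gt; last by have := @nsub_le y x ltac:(nlin) => E; nlin.
  by have := @nsub_le n1 n0 ltac:(nlin) => E; nlin.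
rewrite ind_false // [nsub y x]nsub_gt; last by nlin.
have -> : nsub n1 n0 = n1 by have := @nsub_le n1 n0 ltac:(nlin) => E; nlin.
by rewrite nsub_gt //; nlin.
Qed.

Lemma nsub10 : nsub n1 n0 = n1.
Proof. by have := @nsub_le n1 n0 ltac:(nlin) => E; nlin. Qed.

Lemma nsub11 : nsub n1 n1 = n0.
Proof. by rewrite nsub_gt //; nlin. Qed.

Lemma RecP_lt k f g : Rec k f -> Rec k g -> RecP k (fun e => f e < g e).
Proof.
move=> Hf Hg; apply: (@Rec_ext _ (fun e => nsub n1 (nsub n1 (nsub (g e) (f e))))).
  apply: (Rec_app2 Ix2_nsub); first exact: Rec_cst.
  apply: (Rec_app2 Ix2_nsub); first exact: Rec_cst.
  exact: (Rec_app2 Ix2_nsub).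
by move=> e; apply: ind_nsub_lt.
Qed.

Lemma RecP_imp k P Q : RecP k P -> RecP k Q -> RecP k (fun e => P e -> Q e).
Proof.
move=> HP HQ; apply: (@Rec_ext _ (fun e => nsub n1 (ind (P e) * nsub n1 (ind (Q e))))).
  apply: (Rec_app2 Ix2_nsub); first exact: Rec_cst.
  apply: (Rec_app2 Ix2_mul); first exact: HP.
  by apply: (Rec_app2 Ix2_nsub); [apply: Rec_cst|exact: HQ].
have m10 : n1 * n0 = n0 :> N by nring.
have m11 : n1 * n1 = n1 :> N by nring.
have m00 : n0 * n0 = n0 :> N by nring.
have m01 : n0 * n1 = n0 :> N by nring.
move=> e; case: (@ind_or R (P e)) => -[p ->]; case: (@ind_or R (Q e)) => -[q ->]; rewrite ?nsub10 ?nsub11.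
- by rewrite ind_true // m10 nsub10.
- by rewrite ind_false ?m11 ?nsub11 // => H; apply: q; apply: H.
- by rewrite ind_true // m00 nsub10.
- by rewrite ind_true // m01 nsub10.
Qed.

Lemma RecP_bot k : RecP k (fun _ => False).
Proof. by apply: (@Rec_ext _ (fun _ => n0)); [apply: Rec_cst|move=> e; rewrite ind_false]. Qed.

Lemma RecP_eq k f g : Rec k f -> Rec k g -> RecP k (fun e => f e = g e).
Proof.
move=> Hf Hg.
have H : RecP k (fun e => (f e < g e -> False) -> (g e < f e -> False) -> False).
  by do 2 (apply: RecP_imp; first by apply: RecP_imp; [apply: RecP_lt|apply: RecP_bot]); apply: RecP_bot.
apply: (RecP_ext (RecP_imp H (RecP_bot k))) => e; split=> [->|n]; first by apply=> L; nlin.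
by apply: nle_anti => L; apply: n => n1' n2'; [apply: n2'|apply: n1'].
Qed.

(** The characteristic function of a bounded quantifier is a product of characteristic functions,
    computed by primitive recursion on the bound. *)
Lemma RecP_all k f P : Fn any f -> (forall e, Del any (fun e' => P (scons (e' 0) e))) ->
  Rec k f -> RecP (S k) P -> RecP k (fun e => forall y, y < f e -> P (scons y e)).
Proof.
move=> Ff DP [a Ha] [b Hb]; have [c Hc] := Ix2_mul.
exists (icomp (irec (icst n1) (icomp c (ipair (icomp isnd isnd)
  (icomp b (ipair (icomp ifst isnd) ifst))))) (ipair iid a)) => e.
apply: EvalP_comp; first by apply: EvalP_pair; [apply: EvalP_id|apply: Ha].
move: (f e); have D := DP e.
apply: (@EvalP_rec _ _ (cv k e) (fun n => ind (forall y, y < n -> P (scons y e)))); first by df.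
  by rewrite ind_true; [apply: EvalP_cst|move=> y L; nlin].
move=> m; have -> : ind (forall y, y < m + n1 -> P (scons y e)) =
    ind (forall y, y < m -> P (scons y e)) * ind (P (scons m e)) :> N.
  case: (@ind_or R (forall y, y < m -> P (scons y e))) => -[p ->];
    case: (@ind_or R (P (scons m e))) => -[q ->].
  - rewrite ind_true; first by nring.
    move=> y L; case: (classic (y < m)) => [/p //|L'].
    by have -> : y = m by nlin.
  - by rewrite ind_false; [nring|move=> H; apply: q; apply: H; nlin].
  - by rewrite ind_false; [nring|move=> H; apply: p => y L; apply: H; nlin].
  - by rewrite ind_false; [nring|move=> H; apply: q; apply: H; nlin].
apply: EvalP_comp (Hc _ _); apply: EvalP_pair.
  exact: EvalP_comp (EvalP_snd _ _) (EvalP_snd _ _).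
apply: EvalP_comp (Hb (scons m e)); apply: EvalP_pair; last exact: EvalP_fst.
exact: EvalP_comp (EvalP_snd _ _) (EvalP_fst _ _).
Qed.

Definition TLe (X : sets R) : Prop := exists c, forall n,
  (mmem n X -> EvalP c n n1) /\ (~ mmem n X -> EvalP c n n0).

Lemma TLe_ix X : TLe X -> Ix1 (fun n => ind (mmem n X)).
Proof.
move=> [c Hc]; exists c => n; have [H1 H2] := Hc n.
by case: (@ind_or R (mmem n X)) => -[p ->]; [apply: H1|apply: H2].
Qed.

Lemma Rec_term k (t : term (nat + N)) : Nat.le (tcbound t) k -> Rec k (fun e => cval e t).
Proof.
elim: t => [[i|x]| | |t IHt u IHu|t IHt u IHu] /= L.
- by apply: Rec_var; lia.
- exact: Rec_cst.
- exact: Rec_cst.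
- exact: Rec_cst.
- by apply: (Rec_app2 Ix2_add); [apply: IHt|apply: IHu]; lia.
- by apply: (Rec_app2 Ix2_mul); [apply: IHt|apply: IHu]; lia.
Qed.

Lemma RecP_csat k (q : cform N (sets R)) : (forall X, In X (csets q) -> TLe X) ->
  Nat.le (cbound q) k -> RecP k (fun e => csat e q).
Proof.
elim: q k => [|t u|t u|t X|p IHp q IHq|t p IHp] k HX /= L.
- exact: RecP_bot.
- by apply: RecP_eq; apply: Rec_term; lia.
- by apply: RecP_lt; apply: Rec_term; lia.
- apply: (Rec_app1 (TLe_ix (HX X (or_introl erefl)))); exact: Rec_term.
- by apply: RecP_imp; [apply: IHp|apply: IHq]; try lia; move=> X Xin; apply: HX;
    apply: in_or_app; auto.
- apply: (@RecP_all k (fun e => cval e t) (fun e => csat e p)); [|move=> e|by apply: Rec_term; lia|by apply: IHp => //; lia].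
    by apply: Fn_Tm; exists t.
  apply: Del_D0; apply: (@D0_sub R any (fun e => csat e p)
    (fun k e' => match k with 0 => e' 0 | S j => e j end)).
    by exists p.
  by case=> [|j]; [apply: Tm_var|apply: Tm_cst].
Qed.

(* Search for a witness of either of the two Sigma01 definitions. *)
Lemma TLe_Del OK (P : N -> Prop) (X : sets R) : (forall X, OK X -> TLe X) ->
  Del OK (fun e => P (e 0)) -> (forall x, mmem x X <-> P x) -> TLe X.
Proof.
move=> HOK [[Q1 [[q1 [O1 E1]] D1]] [Q2 [[q2 [O2 E2]] D2]]] HX.
pose k := Nat.max (cbound q1) (cbound q2).
have [c1 Hc1] : RecP (S (S k)) (fun e => csat e q1).
  by apply: RecP_csat => [Y /O1 /HOK //|]; rewrite /k; lia.
have [c2 Hc2] : RecP (S (S k)) (fun e => csat e q2).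
  by apply: RecP_csat => [Y /O2 /HOK //|]; rewrite /k; lia.
pose e0 : env := fun _ => n0; pose C := cv k e0.
have [ca Hca] := Ix2_add; have [cs Hcs] := Ix2_nsub.
have P1 x : P x <-> exists y, csat (scons y (scons x e0)) q1.
  by rewrite (D1 (scons x e0)); split=> -[y Hy]; exists y; apply/E1.
have P2 x : ~ P x <-> exists y, csat (scons y (scons x e0)) q2.
  by rewrite (D2 (scons x e0)); split=> -[y Hy]; exists y; apply/E2.
(* [nsub n1 (G x y)] vanishes exactly when [y] witnesses [P x] or its negation, so the search for a
   zero halts at every [x], and [q1] at the number found decides [P x]. *)
pose G x y : N := ind (csat (scons y (scons x e0)) q1) + ind (csat (scons y (scons x e0)) q2).
pose arg := ipair isnd (ipair ifst (icst C)).
pose srch := icomp cs (ipair (icst n1) (icomp ca (ipair (icomp c1 arg) (icomp c2 arg)))).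
have Harg x y : EvalP arg (pr x y) (cv (S (S k)) (scons y (scons x e0))).
  apply: EvalP_pair; first exact: EvalP_snd.
  by apply: EvalP_pair; [apply: EvalP_fst|apply: EvalP_cst].
have Hsrch x y : EvalP srch (pr x y) (nsub n1 (G x y)).
  apply: EvalP_comp (Hcs _ _); apply: EvalP_pair; first exact: EvalP_cst.
  apply: EvalP_comp (Hca _ _); apply: EvalP_pair;
    by [apply: EvalP_comp (Harg _ _) (Hc1 _)|apply: EvalP_comp (Harg _ _) (Hc2 _)].
exists (icomp c1 (ipair (imu srch) (ipair iid (icst C)))) => x.
pose F y := csat (scons y (scons x e0)) q1 \/ csat (scons y (scons x e0)) q2.
have [y0 Hy0] : exists y, F y.
  by case: (classic (P x)) => [/P1|/P2] [y Hy]; exists y; [left|right].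
have D (q : cform N (sets R)) : Del any (fun e => csat (scons (e 0) (scons x e0)) q).
  apply: Del_D0; apply: (@D0_ext _ any (fun e => csat (fun i : nat =>
    match i with 0 => e 0 | 1 => x | _ => n0 end) q)).
    apply: (@D0_sub R any (fun e => csat e q)
      (fun k e' => match k with 0 => e' 0 | 1 => x | _ => n0 end)); first by exists q.
    by case=> [|[|j]]; [apply: Tm_var|apply: Tm_cst|apply: Tm_cst].
  move=> e; apply: iff_refl_eq; apply: (congr1 (fun e => csat e q)).
  by apply: functional_extensionality => -[|[|j]].
have [|y [_ [Fy Uy]]] := @least R any F y0 _ Hy0.
  by apply: Sig_Del; apply: Del_not; apply: Del_or; apply: D.
have Hmu : EvalP (imu srch) x y.
  apply: EvalP_mu => [|n /Uy nF].
    have -> : n0 = nsub n1 (G x y) by rewrite nsub_gt //; rewrite /G; case: Fy => H;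
      rewrite (ind_true _ H); nlin.
    exact: Hsrch.
  exists n0; have -> : n0 + n1 = nsub n1 (G x n).
    rewrite /G !ind_false; [|by move=> H; apply: nF; right|by move=> H; apply: nF; left].
    by rewrite nadd0 nsub10; nlin.
  exact: Hsrch.
have Hres : EvalP (icomp c1 (ipair (imu srch) (ipair iid (icst C)))) x
    (ind (csat (scons y (scons x e0)) q1)).
  apply: EvalP_comp (Hc1 (scons y (scons x e0))); apply: EvalP_pair => //.
  by apply: EvalP_pair; [apply: EvalP_id|apply: EvalP_cst].
rewrite HX; split=> [p|np].
  have n2' : ~ csat (scons y (scons x e0)) q2 by move=> H; have : ~ P x by apply/P2; exists y.
  by rewrite ind_true in Hres; last by case: Fy.
by rewrite ind_false in Hres; last by move=> H; apply: np; apply/P1; exists y.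
Qed.
End Eval.

(** * Tests and randomness *)

Ltac sm_rat :=
  lazymatch goal with
  | |- sem (with_rat ?t ?p) <-> RatCode ?q /\ ?Q =>
      let P := eval pattern (ratv q) in Q in
      lazymatch P with ?G _ => apply: (@sem_with_rat _ t p G) => ? ?; cbv beta end
  end.
Ltac sm_half n :=
  lazymatch goal with
  | |- sem (with_exp2_neg ?t ?p) <-> ?Q =>
      let P := eval pattern (half n) in Q in
      lazymatch P with ?G _ => apply: (@sem_with_exp2_neg _ t p G) => ? ?; cbv beta end
  end.

Section Tests.
Variable R : rca0.
Notation N := (dom R).
Notation K := (rfield R).
Notation env := (nat -> N).
Notation any := (@anyset R).
Notation tm := (term N).
Notation fm := (pform N (sets R)).
Notation ev := (@tval R N (fun x => x)).
Implicit Types (X Z F M T : sets R) (B l L n i m k c : N).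

Lemma sem_eval_step Z (E : tm -> tm -> tm -> fm) (E' : N -> N -> N -> Prop) (c x y : tm) :
  (forall s t u, sem (E s t u) <-> E' (ev s) (ev t) (ev u)) ->
  sem (eval_step Z E c x y) <-> EvalStep Z E' (ev c) (ev x) (ev y).
Proof. by move=> H; rewrite /eval_step /EvalStep; sm; apply: H. Qed.

Lemma sem_eval Z (c x y : tm) : sem (eval Z c x y) <-> EvalP Z (ev c) (ev x) (ev y).
Proof.
have E : sem (eval Z c x y) <-> exists d l, IsSeq d l /\
    (forall i c u v, Entry d i (pr c (pr u v)) ->
    EvalStep Z (fun c' u' v' => exists j, j < i /\ Entry d j (pr c' (pr u' v'))) c u v) /\
    exists i, Entry d i (pr (ev c) (pr (ev x) (ev y))).
  rewrite /eval; sm.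
  by apply: sem_eval_step => s t u; sm.
rewrite E; split=> [[d [l [H1 [H2 H3]]]]|[d [l [[H1 H2] H3]]]]; by exists d, l.
Qed.

Lemma sem_turing_le X Z : sem (turing_le X Z : fm) <-> TLe Z X.
Proof. rewrite /turing_le /TLe; sm; apply: sem_eval. Qed.

(** Stages and measures have their intended reading only for codes that are functional and list
    strings, which the first conjunct of a test guarantees. *)
Lemma sem_and_dep (p q : fm) (P Q : Prop) :
  (sem p <-> P) -> (P -> (sem q <-> Q)) -> (sem (pand p q) <-> P /\ Q).
Proof.
move=> HP HQ; have E := sem_and HP (iff_refl (sem q)); rewrite E.
by split=> -[p' q']; split=> //; apply/(HQ p').
Qed.

Definition DSeq F : Prop := (forall z, mmem z F -> exists n i b, z = pr (pr n i) b) /\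
  forall n i, exists b, mmem (pr (pr n i) b) F /\ forall b', mmem (pr (pr n i) b') F -> b' = b.

Lemma sem_double_seq F : sem (double_seq F : fm) <-> DSeq F.
Proof. rewrite /double_seq /DSeq; sm. Qed.

Definition Fval F n i : N := epsilon (inhabits n0) (fun b => mmem (pr (pr n i) b) F).

Lemma FvalE F n i b : DSeq F -> (b = Fval F n i <-> mmem (pr (pr n i) b) F).
Proof.
move=> [_ /(_ n i) [c [Hc U]]].
have := epsilon_spec (inhabits n0) (fun b => mmem (pr (pr n i) b) F) (ex_intro _ c Hc).
by rewrite -/(Fval F n i) => H; split=> [-> //|/U ->]; rewrite (U _ H).
Qed.

Lemma Fn_Fval OK F f g : DSeq F -> OK F -> Fn OK f -> Fn OK g ->
  Fn OK (fun e : env => Fval F (f e) (g e)).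
Proof.
move=> HF OF Hf Hg; apply: (Fn_app2 (F := Fval F)) => //.
apply: (@Sig_ext _ _ (fun e => mmem (pr (pr (e 1) (e 2)) (e 0)) F)); first by df.
by move=> e; apply: FvalE.
Qed.

Definition OpenSeq Z F : Prop := DSeq F /\
  (forall n i, FinCode (Fval F n i) /\ AllStr (Fval F n i)) /\ TLe Z F.

Lemma sem_open_seq Z F : sem (open_seq Z F : fm) <-> OpenSeq Z F.
Proof.
have E : sem (open_seq Z F : fm) <-> DSeq F /\
    (forall n i b, mmem (pr (pr n i) b) F -> FinCode b /\ forall s, FinMem s b -> exists l, IsString s l) /\
    TLe Z F.
  rewrite /open_seq; sm; [apply: sem_double_seq|apply: sem_turing_le].
rewrite E /OpenSeq; split=> -[H1 [H2 H3]]; split=> //; split=> //.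
- by move=> n i; apply: (H2 n i); apply/FvalE.
- by move=> n i b /(FvalE n i b H1) ->; apply: H2.
Qed.

(** Members are below their codes, so the sum of the codes of the stages bounds the whole union. *)
Definition ostage F n m : N :=
  code (Sum (fun i => Fval F n i) (m + n1)) (fun s => exists i, i < m + n1 /\ FinMem s (Fval F n i)).

Lemma Fn_ostage OK F f g : DSeq F -> OK F -> Fn OK f -> Fn OK g ->
  Fn OK (fun e : env => ostage F (f e) (g e)).
Proof.
move=> HF OF Hf Hg; apply: (Fn_app2 (F := ostage F)) => //.
have H := fun f g => @Fn_Fval OK F f g HF OF.
by rewrite /ostage; df; apply: H; df.
Qed.

Lemma ostage_spec F n m : DSeq F -> FinCode (ostage F n m) /\
  forall s, FinMem s (ostage F n m) <-> exists i, i <= m /\ FinMem s (Fval F n i).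
Proof.
move=> HF; have H f g := @Fn_Fval any F f g HF I.
have [|H1 H2] := @code_spec R (Sum (fun i => Fval F n i) (m + n1))
  (fun s => exists i, i < m + n1 /\ FinMem s (Fval F n i)).
  by df; apply: H; df.
split=> // s; rewrite H2; split=> [[_ [i [L Hi]]]|[i [L Hi]]].
  by exists i; split=> //; nlin.
have L' : i < m + n1 by nlin.
split; last by exists i.
have := @Sum_ge R (fun i => Fval F n i) ltac:(by apply: H; df) i _ L'.
by have := FinMem_lt Hi => *; nlin.
Qed.

Lemma sem_open_stage F (n m c : tm) : DSeq F ->
  (sem (open_stage F n m c) <-> ev c = ostage F (ev n) (ev m)).
Proof.
move=> HF; have E : sem (open_stage F n m c) <-> FinCode (ev c) /\ forall s,
    FinMem s (ev c) <-> exists i b, i <= ev m /\ mmem (pr (pr (ev n) i) b) F /\ FinMem s b.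
  rewrite /open_stage; sm.
have [H1 H2] := ostage_spec (ev n) (ev m) HF; rewrite E; split=> [[H3 H4]|->].
  apply: FinCode_ext => // s; rewrite H4 H2; split=> [[i [b [L [/(FvalE _ _ _ HF) -> Hs]]]]|[i [L Hi]]].
    by exists i.
  by exists i, (Fval F (ev n) i); split=> //; split=> //; apply/(FvalE _ _ _ HF).
split=> // s; rewrite H2; split=> [[i [L Hi]]|[i [b [L [/(FvalE _ _ _ HF) -> Hs]]]]]; last by exists i.
by exists i, (Fval F (ev n) i); split=> //; split=> //; apply/(FvalE _ _ _ HF).
Qed.

Lemma ostage_str Z F n m : OpenSeq Z F -> AllStr (ostage F n m).
Proof. by move=> [HF [H _]] s /(proj2 (ostage_spec n m HF)) [i [_ /(proj2 (H n i))]]. Qed.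

Lemma ostage_mono F n m m' s : DSeq F -> m <= m' -> FinMem s (ostage F n m) -> FinMem s (ostage F n m').
Proof.
move=> HF L /(proj2 (ostage_spec n m HF)) [i [Li Hi]].
by apply/(proj2 (ostage_spec n m' HF)); exists i; split=> //; nlin.
Qed.

Definition OMem X F n : Prop := exists m l, FinMem (rstr X l) (ostage F n m).

Lemma sem_open_mem X F (n : tm) : DSeq F -> (sem (open_mem X F n) <-> OMem X F (ev n)).
Proof.
move=> HF; have E : sem (open_mem X F n) <-> exists i b s l,
    mmem (pr (pr (ev n) i) b) F /\ FinMem s b /\ s = rstr X l.
  rewrite /open_mem; sm; apply: sem_restriction.
rewrite E; split=> [[i [b [s [l [/(FvalE _ _ _ HF) -> [Hs Es]]]]]]|[m [l /(proj2 (ostage_spec _ _ HF)) [i [_ Hi]]]]].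
  exists i, l; apply/(proj2 (ostage_spec _ _ HF)); exists i; rewrite -Es; split=> //; nlin.
by exists i, (Fval F (ev n) i), (rstr X l), l; split=> //; apply/(FvalE _ _ _ HF).
Qed.

Lemma sem_minimal (B s : tm) : sem (minimal B s : fm) <-> Minimal (ev B) (ev s).
Proof.
rewrite MinimalE /minimal; sm.
Qed.

Definition FinMeasure (B : N) (u : K) : Prop := exists s, IsSeq s (B + n1) /\
  (exists p, Entry s n0 p /\ (RatCode p /\ ratv p = 0%R)) /\
  (forall i, i < B -> exists p q, Entry s i p /\ Entry s (i + n1) q /\
     (RatCode p /\ (RatCode q /\
       ((Minimal B i /\ exists l, IsString i l /\ ratv q = (ratv p + half l)%R) \/
        (~ Minimal B i /\ ratv q = ratv p))))) /\
  exists p, Entry s B p /\ (RatCode p /\ ratv p = u).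

Lemma sem_fin_measure (B : tm) (r : Defs.rat) : rok r ->
  (sem (fin_measure B r) <-> FinMeasure (ev B) (rvt r)).
Proof.
move=> Hr; rewrite /fin_measure /FinMeasure; sm.
- sm_rat; rewrite sem_rat_eq //; last exact: rok_nat.
  by rewrite rvt_nat /= emb0.
- sm_rat; sm_rat; sm; [apply: sem_minimal| | apply: sem_minimal|exact: sem_rat_eq].
  lazymatch goal with |- _ <-> _ = (_ + half ?l)%R => sm_half l end.
  by rewrite sem_rat_eq ?rvt_add //; apply: rok_add.
- by sm_rat; apply: sem_rat_eq.
Qed.

Lemma mu_rv B : exists a b c, n0 < c /\ mu B = rv a b c.
Proof.
exists (cnt (Cov B) B), n0, (exp2 B); split; first exact: exp2_pos.
by rewrite /mu /rv emb0 subr0.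
Qed.

Lemma cnt_prefix_half s l L : IsString s l -> l <= L -> (emb (cnt (Prefix s) L) * half L = half l)%R.
Proof.
move=> Hs /(@sub_ex R) [k ->]; rewrite (cnt_prefix k Hs) half_add.
rewrite mulrC -mulrA halfK mulr1 //.
Qed.

(* The running totals of a measure computation, as numerators over [2^B]. *)
Lemma part_step B i : AllStr B -> i < B ->
  (Minimal B i /\ exists l, IsString i l /\
     (emb (part B B (i + n1)) * half B = emb (part B B i) * half B + half l)%R) \/
  (~ Minimal B i /\ (emb (part B B (i + n1)) * half B = emb (part B B i) * half B)%R).
Proof.
move=> HB Li; rewrite part_S.
case: (@ind_or R (Minimal B i)) => -[M ->]; [left|right]; split=> //; last first.
  by rewrite embD embM emb0 mul0r addr0.
have [l Hl] : exists l, IsString i l by apply: HB; case: M.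
exists l; split=> //; rewrite embD embM emb1 mul1r mulrDl; congr (_ + _)%R.
apply: (cnt_prefix_half Hl).
by apply: (@Lens_code R B i l) => //; case: M.
Qed.

(** The listed rationals may be represented in several ways, but their values are forced: by
    induction they are the partial sums [part B B i] divided by [2^B]. *)
Lemma FinMeasureE B u : AllStr B -> (FinMeasure B u <-> u = mu B).
Proof.
move=> HB; have E0 : mu B = (emb (part B B B) * half B)%R by rewrite measure_sum.
have D0 : Fn any (fun e => part B B (e 0)) by apply: Fn_part; df.
split=> [[s [Hs [[p0 [Hp0 [_ E]]] [HS [p1 [Hp1 [_ <-]]]]]]]|->].
  suff H : forall i, i <= B -> exists p, Entry s i p /\ ratv p = (emb (part B B i) * half B)%R.
    have [|p [Hp Ep]] := H B; first by nlin.
    rewrite E0 -Ep; have [|_ U] := @IsSeq_val R s _ B Hs; first by nlin.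
    by rewrite (U _ Hp) (U _ Hp1).
  apply: (@sig_ind R any).
  - apply: Sig_imp; first by df.
    apply: Sig_ex; apply: Sig_and; first by df.
    apply: Sig_Del; apply: (@Del_ext _ any (fun e => (ratv (e 0) <= emb (part B B (e 1)) * half B)%R /\
      (emb (part B B (e 1)) * half B <= ratv (e 0))%R)); first by df.
    by move=> e; split=> [->|[H1 H2]]; [split|apply/eqP; rewrite eq_le H1 H2].
  - by move=> _; exists p0; rewrite part_0 emb0 mul0r.
  - move=> i IH L; have [p [Hp Ep]] := IH ltac:(nlin).
    have Li : i < B by nlin.
    have [p' [q [Hp' [Hq [_ [_ H]]]]]] := HS i Li; exists q; split=> //.
    have Epp : p' = p.
      have [|_ U] := @IsSeq_val R s _ i Hs; first by nlin.
      by rewrite (U _ Hp') (U _ Hp).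
    rewrite Epp Ep in H.
    case: (part_step HB Li) => [[M [l [Hl E1]]]|[nM E1]].
      case: H => [[_ [l' [Hl' E2]]]|[nM _]] //.
      by rewrite E2 E1 (string_len_unique Hl Hl').
    by case: H => [[M _]|[_ ->]].
have [|s [Hs HE]] := @seq_exists R (fun i => pr (pr (part B B i) n0) (exp2 B)) (B + n1); first by df.
have V i : RatCode (pr (pr (part B B i) n0) (exp2 B)) /\
    ratv (pr (pr (part B B i) n0) (exp2 B)) = (emb (part B B i) * half B)%R.
  split; first by apply/RatCodeE; exists (part B B i), n0, (exp2 B); split=> //; apply: exp2_pos.
  rewrite ratv_pr; last exact: exp2_pos.
  by rewrite /rv emb0 subr0.
exists s; split=> //; split.
  exists (pr (pr (part B B n0) n0) (exp2 B)); split; first by apply/HE; split=> //; nlin.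
  by have [H1 H2] := V n0; split=> //; rewrite H2 part_0 emb0 mul0r.
split; last first.
  exists (pr (pr (part B B B) n0) (exp2 B)); split; first by apply/HE; split=> //; nlin.
  by have [H1 H2] := V B; split=> //; rewrite H2.
move=> i Li; have [H1 H2] := V i; have [H3 H4] := V (i + n1).
exists (pr (pr (part B B i) n0) (exp2 B)), (pr (pr (part B B (i + n1)) n0) (exp2 B)).
split; first by apply/HE; split=> //; nlin.
split; first by apply/HE; split=> //; nlin.
split=> //; split=> //; rewrite H2 H4; exact: part_step.
Qed.

(** The code of a stage and the value of its measure are unique, and the measure is rational, so the
    quantifiers over both collapse. *)
Lemma sem_stage_measure Z F (n m : tm) (p : Defs.rat -> fm) (P : K -> Prop) : OpenSeq Z F ->
  (forall u, rok u -> (sem (p u) <-> P (rvt u))) ->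
  (sem (∃ x, open_stage F n m x ∧ ex_rat (fun u => fin_measure x u ∧ p u))%l2 <->
   P (mu (ostage F (ev n) (ev m)))).
Proof.
move=> HF Hp; have HD := proj1 HF.
have E : sem (∃ x, open_stage F n m x ∧ ex_rat (fun u => fin_measure x u ∧ p u))%l2 <->
    exists c, c = ostage F (ev n) (ev m) /\
      exists a b d, n0 < d /\ (FinMeasure c (rv a b d) /\ P (rv a b d)).
  sm; first exact: sem_open_stage.
  eapply (@sem_ex_rat _ _ (fun u => FinMeasure _ u /\ P u)) => u Hu.
  by sm; [apply: sem_fin_measure|apply: Hp].
have HA := @ostage_str Z F (ev n) (ev m) HF.
rewrite E; split=> [[c [-> [a [b [d [Hd [/(FinMeasureE _ HA) <- //]]]]]]]|H].
exists (ostage F (ev n) (ev m)); split=> //.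
have [a [b [d [Hd Em]]]] := mu_rv (ostage F (ev n) (ev m)).
by exists a, b, d; split=> //; rewrite -Em; split=> //; apply/FinMeasureE.
Qed.

Lemma sem_open_measure_le Z F (n : tm) (r : Defs.rat) : OpenSeq Z F -> rok r ->
  (sem (open_measure_le F n r) <-> forall m, (mu (ostage F (ev n) m) <= rvt r)%R).
Proof.
move=> HF Hr; rewrite /open_measure_le; eapply sem_all => m.
apply: (@sem_stage_measure Z F n (tvar m) (fun u => rat_le u r) (fun u => (u <= rvt r)%R)) => //.
by move=> u Hu; apply: sem_rat_le.
Qed.

Definition MLTest Z F : Prop := OpenSeq Z F /\ forall n m, (mu (ostage F n m) <= half n)%R.

Lemma sem_ml_test Z F : sem (ml_test Z F : fm) <-> MLTest Z F.
Proof.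
rewrite /ml_test; eapply sem_and_dep; first exact: sem_open_seq.
move=> HF; eapply sem_all => n.
apply: (@sem_with_exp2_neg _ (tvar n) _ (fun r => forall m, (mu (ostage F n m) <= r)%R)) => u Hu.
exact: sem_open_measure_le HF Hu.
Qed.

Lemma sem_in_all_open X F : DSeq F -> (sem (in_all_open X F : fm) <-> forall n, OMem X F n).
Proof. by move=> HF; rewrite /in_all_open; sm; apply: sem_open_mem. Qed.

Definition OneRandom X Z : Prop := forall F, MLTest Z F -> ~ forall n, OMem X F n.

Lemma sem_imp_dep (p q : fm) (P Q : Prop) :
  (sem p <-> P) -> (P -> (sem q <-> Q)) -> (sem (pimp p q) <-> (P -> Q)).
Proof. by move=> HP HQ; split=> [H p'|H /HP p']; apply/(HQ p'); apply: H => //; apply/HP. Qed.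

Lemma sem_one_random X Z : sem (one_random X Z : fm) <-> OneRandom X Z.
Proof.
rewrite /one_random; eapply sem_allS => F; eapply sem_imp_dep; first exact: sem_ml_test.
by move=> [[HF _] _]; eapply sem_not; apply: sem_in_all_open.
Qed.

Definition WeakTest Z F : Prop := OpenSeq Z F /\
  forall k, exists n, forall m, n < m -> forall t, (mu (ostage F m t) <= half k)%R.

Definition WeaklyTwoRandom X Z : Prop := forall F, WeakTest Z F -> ~ forall n, OMem X F n.

Lemma sem_weakly_two_random X Z : sem (weakly_two_random X Z : fm) <-> WeaklyTwoRandom X Z.
Proof.
rewrite /weakly_two_random; eapply sem_allS => F; eapply (@sem_imp_dep _ _ (WeakTest Z F)); last first.
  by move=> [[HF _] _]; eapply sem_not; apply: sem_in_all_open.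
rewrite /weak_two_test; eapply sem_and_dep; first exact: sem_open_seq.
move=> HF; sm.
apply: (@sem_with_exp2_neg _ _ _ (fun r => forall t, (mu (ostage F _ t) <= r)%R)) => u Hu.
exact: sem_open_measure_le HF Hu.
Qed.

Definition TreeSeq Z T : Prop :=
  (forall n i s, mmem (pr (pr n i) s) T -> (exists l, IsString s l) /\
     forall t, (exists l, IsString t l) -> Prefix t s -> mmem (pr (pr n i) t) T) /\ TLe Z T.

Definition TreeLevel T n i l c : Prop := FinCode c /\
  forall s, FinMem s c <-> IsString s l /\ exists j, j <= i /\ mmem (pr (pr n j) s) T.

Definition Card (c p : N) : Prop := exists s, IsSeq s p /\
  (forall i j a, Entry s i a -> Entry s j a -> i = j) /\
  (forall a, FinMem a c <-> exists i, Entry s i a).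

Definition TwoTest Z T : Prop := TreeSeq Z T /\
  forall n i, exists l c p, TreeLevel T n i l c /\ Card c p /\ (emb p * half l <= half n)%R.

Definition TwoRandom X Z : Prop := forall T, TwoTest Z T ->
  ~ forall n, exists i, forall l, mmem (pr (pr n i) (rstr X l)) T.

Lemma sem_tree_seq Z T : sem (tree_seq Z T : fm) <-> TreeSeq Z T.
Proof. rewrite /tree_seq /TreeSeq; sm; apply: sem_turing_le. Qed.

Lemma sem_tree_level T (n i l c : tm) :
  sem (tree_level T n i l c : fm) <-> TreeLevel T (ev n) (ev i) (ev l) (ev c).
Proof. rewrite /tree_level /TreeLevel; sm. Qed.

Lemma sem_card (c p : tm) : sem (card c p : fm) <-> Card (ev c) (ev p).
Proof. rewrite /card /Card; sm. Qed.

Lemma sem_sigma2_mem X T (n : tm) :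
  sem (sigma2_mem X T n) <-> exists i, forall l, mmem (pr (pr (ev n) i) (rstr X l)) T.
Proof.
have E : sem (sigma2_mem X T n) <-> exists i, forall l, exists s,
    s = rstr X l /\ mmem (pr (pr (ev n) i) s) T.
  by rewrite /sigma2_mem; sm; apply: sem_restriction.
rewrite E; split=> -[i H]; exists i => l; first by have [s [-> Hs]] := H l.
by exists (rstr X l).
Qed.

Lemma sem_sigma2_measure_le T (n : tm) (u : Defs.rat) : rok u ->
  (sem (sigma2_measure_le T n u) <-> forall i, exists l c p,
     TreeLevel T (ev n) i l c /\ Card c p /\ (emb p * half l <= rvt u)%R).
Proof.
move=> Hu.
have E : sem (sigma2_measure_le T n u) <-> forall i, exists l c p e,
    TreeLevel T (ev n) i l c /\ Card c p /\ e = exp2 l /\ sem (rat_le (Rat (tvar p) tzero (tvar e)) u).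
  rewrite /sigma2_measure_le; sm; [exact: sem_tree_level|exact: sem_card|exact: iff_refl].
have A p l : sem (rat_le (Rat (tvar p) tzero (tvar (exp2 l))) u) <-> (emb p * half l <= rvt u)%R.
  have ok : rok (Rat (tvar p) tzero (tvar (exp2 l))) by exact: exp2_pos.
  by rewrite (sem_rat_le ok Hu) {1}/rvt /rv /= emb0 subr0.
rewrite E; split=> H i; have [l [c [p H']]] := H i; exists l, c, p.
  by move: H' => [e [H1 [H2 [-> /A H3]]]].
by exists (exp2 l); rewrite A; move: H' => [H1 [H2 H3]].
Qed.

Lemma sem_two_random X Z : sem (two_random X Z : fm) <-> TwoRandom X Z.
Proof.
rewrite /two_random; eapply sem_allS => T; eapply sem_imp; last first.
  by eapply sem_not; eapply sem_all => n; apply: sem_sigma2_mem.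
rewrite /sigma2_test; eapply sem_and; first exact: sem_tree_seq.
eapply sem_all => n.
apply: (@sem_with_exp2_neg _ _ _ (fun r => forall i, exists l c p, TreeLevel _ n i l c /\ Card c p /\
  (emb p * half l <= r)%R)) => u Hu.
exact: sem_sigma2_measure_le.
Qed.

Definition RealSeq M : Prop := DSeq M /\ forall n k i a b,
  mmem (pr (pr n k) a) M -> mmem (pr (pr n (k + i)) b) M ->
  RatCode a /\ (RatCode b /\ (ratv a <= ratv b + half k)%R /\ (ratv b <= ratv a + half k)%R).

Lemma sem_real_seq M : sem (real_seq M : fm) <-> RealSeq M.
Proof.
rewrite /real_seq /RealSeq; sm; first exact: sem_double_seq.
sm_rat; sm_rat; lazymatch goal with |- context [half ?k] => sm_half k end.
by eapply sem_and; rewrite sem_rat_le ?rvt_add //; apply: rok_add.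
Qed.

Lemma sem_real_le_rat M (n : tm) (r : Defs.rat) : rok r ->
  (sem (real_le_rat M n r) <-> forall k b, mmem (pr (pr (ev n) k) b) M ->
     RatCode b /\ (ratv b <= rvt r + (half k + half k))%R).
Proof.
move=> Hr; rewrite /real_le_rat; sm; sm_rat.
lazymatch goal with |- context [half ?k] => sm_half k end.
by rewrite sem_rat_le ?rvt_add //; repeat apply: rok_add.
Qed.

Lemma sem_rat_le_real M (n : tm) (r : Defs.rat) : rok r ->
  (sem (rat_le_real M n r) <-> forall k b, mmem (pr (pr (ev n) k) b) M ->
     RatCode b /\ (rvt r <= ratv b + (half k + half k))%R).
Proof.
move=> Hr; rewrite /rat_le_real; sm; sm_rat.
lazymatch goal with |- context [half ?k] => sm_half k end.
by rewrite sem_rat_le ?rvt_add //; repeat apply: rok_add.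
Qed.

Definition MeasEq F n M : Prop := forall k, exists m0, forall m, m0 <= m ->
  (forall k' b, mmem (pr (pr n k') b) M -> RatCode b /\
     (ratv b <= (mu (ostage F n m) + half k) + (half k' + half k'))%R) /\
  (forall k' b, mmem (pr (pr n k') b) M -> RatCode b /\
     (mu (ostage F n m) - half k <= ratv b + (half k' + half k'))%R).

Lemma sem_open_measure_eq Z F (n : tm) M : OpenSeq Z F ->
  (sem (open_measure_eq F n M) <-> MeasEq F (ev n) M).
Proof.
move=> HF; rewrite /open_measure_eq /MeasEq.
eapply sem_all => k; eapply sem_ex => m0; eapply sem_all => m; eapply sem_imp; first exact: sem_le.
apply: (@sem_stage_measure Z F n (tvar m) _ (fun v =>
  (forall k' b, mmem (pr (pr (ev n) k') b) M -> RatCode b /\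
     (ratv b <= (v + half k) + (half k' + half k'))%R) /\
  (forall k' b, mmem (pr (pr (ev n) k') b) M -> RatCode b /\
     (v - half k <= ratv b + (half k' + half k'))%R))) => // u Hu.
apply: (@sem_with_exp2_neg _ (tvar k) _ (fun h =>
  (forall k' b, mmem (pr (pr (ev n) k') b) M -> RatCode b /\
     (ratv b <= (rvt u + h) + (half k' + half k'))%R) /\
  (forall k' b, mmem (pr (pr (ev n) k') b) M -> RatCode b /\
     (rvt u - h <= ratv b + (half k' + half k'))%R))) => e He.
eapply sem_and.
  by rewrite sem_real_le_rat ?rvt_add //; apply: rok_add.
have He' : rok (rat_opp e) by [].
by rewrite sem_rat_le_real ?rvt_add ?rvt_opp //; apply: rok_add.
Qed.

Definition SchnorrTest Z F : Prop := MLTest Z F /\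
  exists M, RealSeq M /\ TLe Z M /\ forall n, MeasEq F n M.

Definition SchnorrRandom X Z : Prop := forall F, SchnorrTest Z F -> ~ forall n, OMem X F n.

Lemma sem_schnorr_random X Z : sem (schnorr_random X Z : fm) <-> SchnorrRandom X Z.
Proof.
rewrite /schnorr_random; eapply sem_allS => F; eapply (@sem_imp_dep _ _ (SchnorrTest Z F)); last first.
  by move=> [[[HF _] _] _]; eapply sem_not; apply: sem_in_all_open.
rewrite /schnorr_test; eapply sem_and_dep; first exact: sem_ml_test.
move=> [HF _]; eapply sem_exS => M; eapply sem_and; first exact: sem_real_seq.
eapply sem_and; first exact: sem_turing_le.
by eapply sem_all => n; apply: sem_open_measure_eq HF.
Qed.

Definition Supermartingale M : Prop :=
  (forall z, mmem z M -> exists s q, z = pr s q /\ (exists l, IsString s l) /\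
     (RatCode q /\ (0 <= ratv q)%R)) /\
  (forall s, (exists l, IsString s l) -> exists q, mmem (pr s q) M /\
     forall q', mmem (pr s q') M -> q' = q) /\
  (forall s s0 s1 q q0 q1, IsSnoc s n0 s0 -> IsSnoc s n1 s1 ->
     mmem (pr s q) M -> mmem (pr s0 q0) M -> mmem (pr s1 q1) M ->
     RatCode q /\ (RatCode q0 /\ (RatCode q1 /\ (ratv q0 + ratv q1 <= ratv q + ratv q)%R))).

Lemma sem_supermartingale M : sem (supermartingale M : fm) <-> Supermartingale M.
Proof.
rewrite /supermartingale /Supermartingale; sm.
- sm_rat; rewrite sem_rat_le //; last exact: rok_nat.
  by rewrite rvt_nat /= emb0.
- sm_rat; sm_rat; sm_rat.
  by rewrite sem_rat_le ?rvt_add //; apply: rok_add.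
Qed.

Definition Succeeds M X : Prop := forall k, exists n q, mmem (pr (rstr X n) q) M /\
  (RatCode q /\ (emb k < ratv q)%R).

Lemma sem_succeeds M X : sem (succeeds M X : fm) <-> Succeeds M X.
Proof.
have E : sem (succeeds M X : fm) <-> forall k, exists n s q, s = rstr X n /\ mmem (pr s q) M /\
    (RatCode q /\ (emb k < ratv q)%R).
  rewrite /succeeds; sm.
  by sm_rat; rewrite sem_rat_lt ?rvt_nat //; apply: rok_nat.
rewrite E; split=> H k; first by have [n [s [q [-> H']]]] := H k; exists n, q.
by have [n [q H']] := H k; exists n, (rstr X n), q.
Qed.

Definition ComputablyRandom X Z : Prop := forall M, Supermartingale M -> TLe Z M -> ~ Succeeds M X.

Lemma sem_computably_random X Z : sem (computably_random X Z : fm) <-> ComputablyRandom X Z.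
Proof.
rewrite /computably_random; eapply sem_allS => M; eapply sem_imp; first exact: sem_supermartingale.
eapply sem_imp; first exact: sem_turing_le.
by eapply sem_not; apply: sem_succeeds.
Qed.
End Tests.

Ltac df_tests :=
  first [ lazymatch goal with
  | |- Fn _ (fun _ => Fval _ _ _) =>
      apply Fn_Fval; [assumption|first [exact I|assumption]| |]
  | |- Fn _ (fun _ => ostage _ _ _) =>
      apply Fn_ostage; [assumption|first [exact I|assumption]| |]
  end | df_set ].
Ltac df_ext ::= df_tests.

(** * Weak 2-randomness *)

Section WeakTests.
Variable R : rca0.
Notation N := (dom R).
Notation K := (rfield R).
Notation env := (nat -> N).
Notation any := (@anyset R).
Implicit Types (X Z F M T : sets R) (B s l L n i m k c x y t : N).

Lemma one_random_of_weak X Z : WeaklyTwoRandom X Z -> OneRandom X Z.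
Proof.
move=> H F [HF HM]; apply: H; split=> // k; exists k => m L t.
by apply: le_trans (HM m t) _; apply: half_mono; nlin.
Qed.

Lemma string_level (Q : N -> Prop) l : Del any (fun e => Q (e 0)) ->
  exists c, FinCode c /\ forall s, FinMem s c <-> IsString s l /\ Q s.
Proof.
(* The summand [+ n1] makes the sum exceed each single string of length [l]. *)
move=> HQ; have [|H1 H2] := @code_spec R (Sum (fun x => str l x + n1) (exp2 l)) (fun s => IsString s l /\ Q s).
  by df.
exists (code (Sum (fun x => str l x + n1) (exp2 l)) (fun s => IsString s l /\ Q s)).
split=> // s; rewrite H2; split=> [[] //|[Hs Qs]]; split=> //.
have [x [Lx ->]] := str_surj Hs.
by have := @Sum_ge R (fun x => str l x + n1) ltac:(df) x _ Lx => *; nlin.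
Qed.

(** The coded definition of cardinality asks for an injective listing: [pos] ranks the elements in
    the enumeration of strings, and its inverse [inv] yields the listing. *)
Lemma card_strings c l : (forall s, FinMem s c -> IsString s l) ->
  Card c (cnt (fun s => FinMem s c) l).
Proof.
move=> Hc; pose P x := FinMem (str l x) c; pose pos x := Sum (fun x => ind (P x)) x.
have DP : Del any (fun e => P (e 0)) by rewrite /P; df.
have Fpos : Fn any (fun e => pos (e 0)) by rewrite /pos; df.
have pos_lt x y : P x -> x < y -> pos x < pos y.
  move=> Px L; have [w ->] : exists w, y = x + n1 + w by apply: sub_ex; nlin.
  rewrite /pos Sum_cat; last by df.
  rewrite SumS; last by df.
  by rewrite (ind_true _ Px); nlin.
have pos_inj x y : P x -> P y -> pos x = pos y -> x = y.
  by move=> Px Py E; apply: nle_anti => L; have := pos_lt _ _ _ L; rewrite E => H;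
    [have := H Py|have := H Px] => *; nlin.
have pos_surj n i : i < pos n -> exists x, x < n /\ (P x /\ pos x = i).
  move: n; apply: (@sig_ind R any); first by df.
    by rewrite /pos Sum0; [move=> L; nlin|df].
  move=> n IH; case: (classic (i < pos n)) => [/IH [x [L H]] _|L].
    by exists x; split=> //; nlin.
  rewrite /pos SumS; last by df.
  case: (@ind_or R (P n)) => -[p ->]; rewrite -/(pos n) => L'; last by nlin.
  by exists n; split; [nlin|split=> //; nlin].
pose inv i := mub (exp2 l) (fun x => P x /\ pos x = i).
have Finv : Fn any (fun e => inv (e 0)) by rewrite /inv; df.
have invP i : i < pos (exp2 l) -> inv i < exp2 l /\ P (inv i) /\ pos (inv i) = i.
  move=> /pos_surj [x [Lx Hx]].
  have [|[H1 [H2 _]]|[_ H]] := @mub_spec R (exp2 l) (fun x => P x /\ pos x = i); first by df.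
    by [].
  by case: (H x Lx).
have [|s [Hs HE]] := @seq_exists R (fun i => str l (inv i)) (pos (exp2 l)); first by df.
exists s; split=> //; split.
  move=> i j a /HE [Li ->] /HE [Lj E].
  have [Li' [Pi <-]] := invP i Li; have [Lj' [Pj <-]] := invP j Lj.
  by rewrite (str_inj Li' Lj' E).
move=> a; split=> [Ha|[i /HE [Li ->]]]; last by case: (invP i Li) => _ [].
have [x [Lx Ex]] := str_surj (Hc _ Ha); rewrite Ex in Ha *.
have Li : pos x < pos (exp2 l) by apply: pos_lt.
exists (pos x); apply/HE; split=> //; congr str.
by have [_ [Px E]] := invP _ Li; apply: pos_inj.
Qed.

Lemma mu_mono B B' : AllStr B -> AllStr B' -> (forall s, FinMem s B -> FinMem s B') -> (mu B <= mu B')%R.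
Proof.
move=> HB HB' H; have L1 := @Lens_code R B; have L2 := @Lens_code R B'.
have L1' : Lens B (B + B') by move=> s l Hs Hl; have := L1 s l Hs Hl => *; nlin.
have L2' : Lens B' (B + B') by move=> s l Hs Hl; have := L2 s l Hs Hl => *; nlin.
rewrite (mu_cnt HB L1') (mu_cnt HB' L2'); apply: ler_wpM2r; first exact/ltW/half_pos.
apply/le_iff; apply: cnt_le; try by df.
by move=> s _ /CovE [t [/H Ht Pt]]; apply/CovE; exists t.
Qed.

(** * The trees of the guesses at the first small component *)

Section TwoRandomTest.
Variables (X Z F : sets R).
Hypothesis HF : OpenSeq Z F.
Hypothesis HW : forall k, exists n, forall m, n < m -> forall t, (mu (ostage F m t) <= half k)%R.

(* Index [m] is still a candidate for the first [m] with [mu(U_m) <= 2^-n]: the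
   enumeration up to stage [l] does not refute it, and stage [t] refutes all
   smaller indices. *)
Definition candidate n m t l : Prop :=
  (forall t', t' < l + n1 -> (mu (ostage F m t') <= half n)%R) /\
  (forall m', m' < m -> exists t', t' < t + n1 /\ (half n < mu (ostage F m' t'))%R).

(** Refutations of [m] are sought only up to the length of [s], so membership is decidable. A
    refutable [m] gives a finite tree, and a [t] that leaves some smaller index unrefuted gives an
    empty one. *)
Definition in_tree n m t s : Prop := exists l, l < s + n1 /\ (IsString s l /\
  ((exists r, r < ostage F m t /\ (FinMem r (ostage F m t) /\ (Prefix r s \/ Prefix s r))) /\
   candidate n m t l)).

Lemma in_treeE n m t s l : IsString s l -> (in_tree n m t s <->
  (exists r, FinMem r (ostage F m t) /\ (Prefix r s \/ Prefix s r)) /\ candidate n m t l).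
Proof.
move=> Hs; split=> [[l' [_ [Hl' [[r [_ [Hr Pr]]] C]]]]|[[r [Hr Pr]] C]].
  by rewrite (string_len_unique Hs Hl'); split=> //; exists r.
exists l; split; first by have := string_le Hs => *; nlin.
by split=> //; split=> //; exists r; split=> //; apply: FinMem_lt.
Qed.

Lemma in_tree_string n m t s : in_tree n m t s -> exists l, IsString s l.
Proof. by move=> [l [_ [Hl _]]]; exists l. Qed.

Lemma in_tree_prefix n m t s r : in_tree n m t s -> (exists l, IsString r l) -> Prefix r s ->
  in_tree n m t r.
Proof.
move=> Hs [k Hk] P; have [l Hl] := in_tree_string Hs.
move/(in_treeE _ _ _ Hl): Hs => [[u [Hu Pu]] [C1 C2]]; apply/(in_treeE _ _ _ Hk).
have Lk := prefix_len Hk Hl P; split; last first.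
  by split=> // t' L; apply: C1; nlin.
exists u; split=> //; case: Pu => Pu; last by right; apply: prefix_trans P Pu.
have [j Hj] := ostage_str HF Hu; case: (classic (j <= k)) => L.
  by left; apply: (prefix_comparable Hj Hk L Pu P); exists l.
by right; apply: (prefix_comparable Hk Hj _ P Pu); [nlin|exists l].
Qed.

Lemma tree_exists : exists T, TLe Z T /\
  forall z, mmem z T <-> exists n m t s, z = pr (pr n (pr m t)) s /\ in_tree n m t s.
Proof.
have HD := proj1 HF; have HT : TLe Z F by case: HF => _ [].
pose P z := exists n, n < z + n1 /\ exists m, m < z + n1 /\ exists t, t < z + n1 /\
  exists s, s < z + n1 /\ (z = pr (pr n (pr m t)) s /\ in_tree n m t s).
(* One definability proof is used twice: with all sets for comprehension, and with the sets
   computable from [Z] for reducibility. *)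
have DP OK : OK F -> Del OK (fun e => P (e 0)) by move=> OF; rewrite /P /in_tree /candidate; df.
have [|T HT'] := @del_comp R any P; first exact: DP.
exists T; split.
  apply: (TLe_Del (OK := TLe Z) (P := P)) => //.
  exact: DP.
move=> z; rewrite HT'; split=> [[n [_ [m [_ [t [_ [s [_ H]]]]]]]]|[n [m [t [s [-> H]]]]]].
  by exists n, m, t, s.
have L1 := @pr_lel R (pr n (pr m t)) s; have L2 := @pr_ler R (pr n (pr m t)) s.
have L3 := @pr_lel R n (pr m t); have L4 := @pr_ler R n (pr m t).
have L5 := @pr_lel R m t; have L6 := @pr_ler R m t.
exists n; split; first by nlin.
exists m; split; first by nlin.
exists t; split; first by nlin.
by exists s; split=> //; nlin.
Qed.

(** Smallness of a component is Pi01, so a least small one exists; collection bounds the stages that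
    refute the finitely many smaller indices. *)
Lemma least_small n : exists m, (forall t, (mu (ostage F m t) <= half n)%R) /\
  exists w, forall m', m' < m -> exists t', t' < w /\ (half n < mu (ostage F m' t'))%R.
Proof.
have HD := proj1 HF; have [m0 Hm0] := HW n.
have [||m [_ [Hm U]]] := @least R any (fun m => forall t, (mu (ostage F m t) <= half n)%R) (m0 + n1).
- apply: (@Sig_ext _ _ (fun e => exists t, (half n < mu (ostage F (e 0) t))%R)); first by df.
  move=> e; split=> [H|[t Ht] H]; last by have := H t; rewrite leNgt Ht.
  apply: NNPP => H'; apply: H => t; rewrite leNgt; apply/negP => Ht.
  by apply: H'; exists t.
- by move=> t; apply: Hm0; nlin.
exists m; split=> //.
apply: (@sig_collection R any (fun m' t' => (half n < mu (ostage F m' t'))%R)); first by df.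
move=> m' /U H; apply: NNPP => H'; apply: H => t; rewrite leNgt; apply/negP => Ht.
by apply: H'; exists t.
Qed.

Variable T : sets R.
Hypothesis HT : forall z, mmem z T <-> exists n m t s, z = pr (pr n (pr m t)) s /\ in_tree n m t s.

Lemma tree_small n i : exists l c p, TreeLevel T n i l c /\ Card c p /\ (emb p * half l <= half n)%R.
Proof.
have HD := proj1 HF; have [m [Hm [w Hw]]] := least_small n.
(* At level [w + B] every smaller index has been refuted and no string of [B] is longer, so a string
   compatible with [B] is covered by it. *)
pose B := ostage F m i; pose l := w + B.
have [|c [Hc HcE]] := @string_level (fun s => exists j, j < i + n1 /\ mmem (pr (pr n j) s) T) l.
  by df.
have HcS s : FinMem s c -> IsString s l by move/HcE => [].
exists l, c, (cnt (fun s => FinMem s c) l); split.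
  split=> // s; rewrite HcE; split=> -[Hs [j [L Hj]]]; split=> //; exists j; split=> //; nlin.
split; first exact: card_strings.
have HB : AllStr B by apply: ostage_str HF.
have HL : Lens B l by move=> s k Hs Hk; have := @Lens_code R B s k Hs Hk; rewrite /l => *; nlin.
apply: le_trans (Hm i); rewrite -/B (mu_cnt HB HL).
apply: ler_wpM2r; first exact/ltW/half_pos.
apply/le_iff; apply: cnt_le; try by df.
move=> s Hs /HcE [_ [j [Lj /HT [n' [m' [t [s' [/pr_inj [/pr_inj [<- Ej] <-]]]]]]]]].
move/(in_treeE _ _ _ Hs) => [[r [Hr Pr]] [C1 C2]].
(* An [m'] above [m] would presuppose a refutation of [m]; an [m'] below [m] is refuted before stage
   [w], hence is no candidate at this level. *)
have Em : m' = m.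
  apply: nle_anti; rewrite /nle => L.
    by have [t' [_]] := C2 m L; rewrite ltNge Hm.
  have [t' [Lt Ht]] := Hw m' L.
  by have := C1 t'; rewrite leNgt Ht => C; have := C ltac:(rewrite /l; nlin).
rewrite Em in Hr.
(* The index [pr m' t] of the tree is at most [i], hence so is the stage [t]. *)
have HrB : FinMem r B.
  apply: ostage_mono Hr => //; have := @pr_ler R m' t; rewrite -Ej => *; nlin.
apply/CovE; exists r; split=> //; case: Pr => // P.
have [k Hk] := HB r HrB; have Lk := HL r k HrB Hk.
have Lk' := prefix_len Hs Hk P.
have Ek : k = l by nlin.
by rewrite Ek in Hk; rewrite (prefix_same_len Hs Hk P).
Qed.

Lemma tree_captures n : (forall m, OMem X F m) -> exists i, forall l, mmem (pr (pr n i) (rstr X l)) T.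
Proof.
have [m [Hm [w Hw]]] := least_small n; move=> /(_ m) [t0 [l0 Hl0]].
(* Stage [t0] puts a prefix of [X] into the component, stage [w] refutes all smaller indices; their
   sum does both. *)
exists (pr m (t0 + w)) => l; apply/HT; exists n, m, (t0 + w), (rstr X l); split=> //.
apply/(in_treeE _ _ _ (rstr_string X l)); split.
  exists (rstr X l0); split.
    by apply: ostage_mono Hl0; [case: HF|nlin].
  by case: (classic (l0 <= l)) => L; [left|right]; apply: rstr_prefix => //; nlin.
split=> [t' _|m' /Hw [t' [L Ht]]]; first exact: Hm.
by exists t'; split=> //; nlin.
Qed.
End TwoRandomTest.

Lemma weak_of_two_random X Z : TwoRandom X Z -> WeaklyTwoRandom X Z.
Proof.
move=> H F [HF HW] HX; have [T [TT HT]] := tree_exists HF.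
apply: (H T) => [|n]; last exact: (tree_captures HF HW HT n HX).
split=> [|n i]; last exact: (tree_small HF HW HT).
split=> // n i s /HT [n' [m [t [s' [E Ht]]]]].
move/pr_inj: E => [/pr_inj [-> ->] ->]; split; first exact: in_tree_string Ht.
move=> r Hr P; apply/HT; exists n', m, t, r; split=> //.
exact: (in_tree_prefix HF Ht Hr P).
Qed.
End WeakTests.

(** * Computable randomness *)

Section Martingale.
Variable R : rca0.
Notation N := (dom R).
Notation K := (rfield R).
Notation env := (nat -> N).
Notation any := (@anyset R).
Implicit Types (X Z F : sets R) (B s l L n i m k c x y t q : N).
Variable M : sets R.
Hypothesis HM : Supermartingale M.

(** The value 0 at numbers that code no string makes the function total, so it can be used in
    definable terms. *)
Definition Mcode s : N := epsilon (inhabits n0)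
  (fun q => mmem (pr s q) M \/ (~ (exists l, IsString s l) /\ q = n0)).
Definition Mval s : K := ratv (Mcode s).

Lemma McodeE s q : q = Mcode s <-> mmem (pr s q) M \/ (~ (exists l, IsString s l) /\ q = n0).
Proof.
have [H1 [H2 _]] := HM.
have Hs q' : mmem (pr s q') M -> exists l, IsString s l.
  by move=> /H1 [s' [q2 [/pr_inj [-> _] [H _]]]].
have H := epsilon_spec (inhabits n0) (fun q => mmem (pr s q) M \/ (~ (exists l, IsString s l) /\ q = n0)).
rewrite -/(Mcode s) in H.
case: (classic (exists l, IsString s l)) => St.
  have [q0 [Hq0 U]] := H2 s St.
  have {}H : mmem (pr s (Mcode s)) M by case: (H (ex_intro _ q0 (or_introl Hq0))) => // -[].
  split=> [->|[Hq|[] //]]; first by left.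
  by rewrite (U _ Hq) (U _ H).
have {H} E : Mcode s = n0 by case: (H (ex_intro _ n0 (or_intror (conj St erefl)))) => [/Hs //|[]].
by rewrite E; split=> [->|[/Hs //|[] //]]; right.
Qed.

Lemma Mcode_mem s l : IsString s l -> mmem (pr s (Mcode s)) M.
Proof. by move=> Hs; have /McodeE [//|[H _]] := erefl (Mcode s); case: H; exists l. Qed.

Lemma Fn_Mcode OK f : OK M -> Fn OK f -> Fn OK (fun e : env => Mcode (f e)).
Proof.
move=> OM Hf; apply: (Fn_app1 (F := Mcode)) => //.
apply: (@Sig_ext _ _ (fun e => mmem (pr (e 1) (e 0)) M \/
  (~ (exists l, l < e 1 + n1 /\ IsString (e 1) l) /\ e 0 = n0))); first by df.
move=> e; rewrite McodeE; have E : (exists l, IsString (e 1) l) <-> exists l, l < e 1 + n1 /\ IsString (e 1) l.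
  by split=> [[l Hl]|[l [_ Hl]]]; exists l => //; split=> //; have := string_le Hl => *; nlin.
by rewrite E.
Qed.

Lemma FnK_Mval OK f : OK M -> Fn OK f -> FnK OK (fun e : env => Mval (f e)).
Proof. by move=> OM Hf; apply: FnK_ratv; apply: Fn_Mcode. Qed.

Lemma Mval_ge0 s l : IsString s l -> (0 <= Mval s)%R.
Proof.
by move=> /Mcode_mem; case: HM => H _ /H [s' [q [/pr_inj [_ E] [_ [_ H']]]]]; rewrite /Mval E.
Qed.

Lemma Mval_snoc s l : IsString s l -> (Mval (snoc s n0) + Mval (snoc s n1) <= Mval s + Mval s)%R.
Proof.
move=> Hs; have [_ [_ H]] := HM.
have [|||||_ [_ [_ H']]] := H s (snoc s n0) (snoc s n1) (Mcode s) (Mcode (snoc s n0)) (Mcode (snoc s n1)).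
- by apply/(IsSnocE _ Hs) => //; left.
- by apply/(IsSnocE _ Hs) => //; right.
- exact: Mcode_mem Hs.
- exact: Mcode_mem (snoc_string _ Hs).
- exact: Mcode_mem (snoc_string _ Hs).
- exact: H'.
Qed.

Lemma cnt_Prefix_Cov_split s l B L : IsString s l -> l < L ->
  cnt (fun t => Prefix s t /\ Cov B t) L =
  cnt (fun t => Prefix (snoc s n0) t /\ Cov B t) L + cnt (fun t => Prefix (snoc s n1) t /\ Cov B t) L.
Proof.
move=> Hs LL; rewrite -cnt_disj; [|by df|by df|].
  apply: cnt_ext; try by df.
  move=> t Ht; split=> [[P C]|[[P C]|[P C]]].
  - by case: (snoc_split Hs Ht LL P) => P'; [left|right].
  - by split=> //; apply: prefix_trans P; apply: prefix_snoc Hs.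
  - by split=> //; apply: prefix_trans P; apply: prefix_snoc Hs.
by move=> t Ht [P _] [P' _]; apply: (snoc_disj Hs Ht LL P P').
Qed.

(* Kolmogorov's inequality, by induction on the distance [k] to level [L]; [s]
   ranges over the strings none of whose proper prefixes are in [B]. *)
Lemma kolmogorov_aux B L c : Lens B L -> AllStr B -> (forall s, FinMem s B -> (emb c <= Mval s)%R) ->
  forall k l, l < L + n1 -> l + k = L -> forall x, x < exp2 l ->
  (forall r, r < B -> FinMem r B -> Prefix r (str l x) -> r = str l x) ->
  (emb c * emb (cnt (fun t => Prefix (str l x) t /\ Cov B t) L) <= Mval (str l x) * emb (exp2 k))%R.
Proof.
move=> HL HB Hc.
(* At a string of [B] the capital is at least [c], while at most [2^k] strings of length [L] extend
   it. *)
have inB l k x : l + k = L -> FinMem (str l x) B ->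
  (emb c * emb (cnt (fun t => Prefix (str l x) t /\ Cov B t) L) <= Mval (str l x) * emb (exp2 k))%R.
  move=> E H; apply: ler_pM; [exact: emb_ge0|exact: emb_ge0|exact: Hc|].
  apply/le_iff; rewrite -(cnt_prefix k (str_string l x)) E.
  by apply: cnt_le; try df; move=> t _ [].
(* Strings are quantified as [str l x] with [x < exp2 l], and the lengths are bounded as well, so
   the induction formula is Delta01. *)
apply: (@sig_ind R any).
- have FM := @FnK_Mval any; apply: Sig_Del; df; apply: FM => //; df.
- move=> l _; rewrite nadd0 => -> x Lx U.
  case: (classic (FinMem (str L x) B)) => H; first by apply: inB => //; apply: nadd0.
  have -> : cnt (fun t => Prefix (str L x) t /\ Cov B t) L = n0.
    apply: nle_anti; last exact: n0_le.
    rewrite -(_ : cnt (fun _ => False) L = n0).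
      apply: cnt_le; try df; move=> t Ht [P /CovE [r [Hr Pr]]].
      rewrite -(prefix_same_len (str_string L x) Ht P) in Pr.
      by apply: H; rewrite -(U r (FinMem_lt Hr) Hr Pr).
    by apply: Sum_zero; [df|move=> i _; rewrite ind_false].
  rewrite emb0 mulr0 mulr_ge0 //; [exact: Mval_ge0 (str_string _ _)|exact: emb_ge0].
move=> k IH l Ll El x Lx U; set s := str l x in U *.
have Hs : IsString s l by apply: str_string.
case: (classic (FinMem s B)) => H; first exact: inB.
have LlL : l < L by nlin.
rewrite (cnt_Prefix_Cov_split B Hs LlL) embD mulrDr.
(* An initial segment of [snoc s a] in [B] other than the whole would lie below [s], hence be [s],
   which is not in [B]; so the hypothesis on initial segments passes to the extension. *)
have step a : (emb c * emb (cnt (fun t => Prefix (snoc s a) t /\ Cov B t) L) <=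
    Mval (snoc s a) * emb (exp2 k))%R.
  have [y [Ly Ey]] := str_surj (snoc_string a Hs); rewrite Ey.
  apply: IH => //; [nlin|nlin|move=> r Lr Hr; rewrite -Ey => P].
  have [j Hj] := HB r Hr; have Lj := prefix_len Hj (snoc_string a Hs) P.
  case: (classic (j <= l)) => L'.
    have P' := proj1 (prefix_snocE a Hj Hs L') P.
    by case: H; rewrite -(U r Lr Hr P').
  have Ej : j = l + n1 by nlin.
  by rewrite Ej in Hj; apply: prefix_same_len Hj (snoc_string a Hs) P.
apply: le_trans (lerD (step n0) (step n1)) _; rewrite -mulrDl exp2_S embM embD emb1.
have := ler_wpM2r (emb_ge0 (exp2 k)) (Mval_snoc Hs); lra.
Qed.

Definition eps : N := str n0 n0.

Lemma kolmogorov B c : AllStr B -> (forall s, FinMem s B -> (emb c <= Mval s)%R) ->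
  (emb c * mu B <= Mval eps)%R.
Proof.
move=> HB Hc; have HL := @Lens_code R B.
have L0 : (n0 : N) < exp2 n0 by exact: exp2_pos.
have E : n0 + B = B by nlin.
have U r : r < B -> FinMem r B -> Prefix r eps -> r = eps.
  move=> _ Hr P; have [j Hj] := HB r Hr; have Lj := prefix_len Hj (str_string _ _) P.
  have Ej : j = n0 by nlin.
  by rewrite Ej in Hj; apply: prefix_same_len Hj (str_string _ _) P.
have := kolmogorov_aux HL HB Hc (k := B) (l := n0) ltac:(nlin) E L0 U.
rewrite -/eps; have -> : cnt (fun t => Prefix eps t /\ Cov B t) B = cnt (Cov B) B.
  apply: cnt_ext; try df; move=> t Ht; split=> [[] //|C]; split=> //.
  by apply/(PrefixE (str_string n0 n0) Ht); split=> [|i L]; nlin.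
move=> H; rewrite /mu mulrA.
apply: le_trans (ler_wpM2r (ltW (half_pos B)) H) _.
by rewrite -mulrA [(emb _ * half B)%R]mulrC halfK mulr1.
Qed.

Section Test.
Variable c : N.
Hypothesis c_pos : n1 <= c.
Hypothesis c_ge : (Mval eps <= emb c)%R.

Definition wins n i : Prop := (exists l, l < i + n1 /\ IsString i l) /\ (emb (exp2 n * c) < Mval i)%R.
(** Stage [i] considers only the string with code [i], so each winning string is enumerated at
    exactly one stage. *)
Definition wcode n i : N := code (i + n1) (fun s => s = i /\ wins n i).

Lemma Del_wins OK f g : OK M -> Fn OK f -> Fn OK g -> Del OK (fun e : env => wins (f e) (g e)).
Proof.
move=> OM Hf Hg; apply: (Del_app2 (P := wins)) => //; rewrite /wins.
have FM := fun f => @FnK_Mval OK f OM.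
by df; apply: FM; df.
Qed.

Lemma wcode_spec n i : FinCode (wcode n i) /\ forall s, FinMem s (wcode n i) <-> s = i /\ wins n i.
Proof.
have [|H1 H2] := @code_spec R (i + n1) (fun s => s = i /\ wins n i); first by df.
split=> // s; rewrite H2; split=> [[] //|[-> H]]; split=> //; nlin.
Qed.

Lemma test_exists Z : TLe Z M -> exists F, OpenSeq Z F /\ forall n i, Fval F n i = wcode n i.
Proof.
move=> TM; pose P z := exists n, n < z + n1 /\ exists i, i < z + n1 /\ z = pr (pr n i) (wcode n i).
have DP OK : OK M -> Del OK (fun e => P (e 0)).
  move=> OM; have D := fun f g => @Del_wins OK f g OM.
  by rewrite /P /wcode; df; apply: D; df.
have [|F HF] := @del_comp R any P; first exact: DP.
have HFE n i b : mmem (pr (pr n i) b) F <-> b = wcode n i.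
  rewrite HF; split=> [[n' [_ [i' [_ /pr_inj [/pr_inj [-> ->] ->]]]]] //|->].
  have L1 := @pr_lel R (pr n i) (wcode n i); have L3 := @pr_lel R n i; have L4 := @pr_ler R n i.
  exists n; split; first by nlin.
  by exists i; split=> //; nlin.
have HD : DSeq F.
  split=> [z /HF [n [_ [i [_ ->]]]]|n i]; first by exists n, i, (wcode n i).
  by exists (wcode n i); split=> [|b' /HFE //]; apply/HFE.
have HV n i : Fval F n i = wcode n i by apply/esym/FvalE => //; apply/HFE.
exists F; split=> //; split=> //; split.
  move=> n i; rewrite HV; have [H1 H2] := wcode_spec n i; split=> // s /H2 [-> [[l [_ Hl]] _]].
  by exists l.
apply: (TLe_Del (OK := TLe Z) (P := P)) => //; exact: DP.
Qed.

Lemma test_small Z F : OpenSeq Z F -> (forall n i, Fval F n i = wcode n i) -> MLTest Z F.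
Proof.
move=> HF HV; split=> // n m; set B := ostage F n m.
have HB : AllStr B by apply: ostage_str HF.
have Hc s : FinMem s B -> (emb (exp2 n * c) <= Mval s)%R.
  move/(proj2 (ostage_spec n m (proj1 HF))) => [i [_]]; rewrite HV.
  by move/(proj2 (wcode_spec n i)) => [-> [_ /ltW]].
have H := le_trans (kolmogorov HB Hc) c_ge.
have cp : (0 < emb c)%R by apply: lt_le_trans ltr01 _; rewrite -emb1; exact/le_iff.
(* The inequality bounds [2^n c mu(B)] by the initial capital, hence by [c], and [c] is
   cancelled. *)
have H' : (emb (exp2 n) * mu B <= 1)%R.
  by rewrite -(ler_pM2l cp) mulr1 mulrA -embM (_ : c * exp2 n = exp2 n * c) //; nring.
have := ler_wpM2l (ltW (half_pos n)) H'.
by rewrite mulr1 mulrA halfK mul1r.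
Qed.

Lemma test_captures Z F X : OpenSeq Z F -> (forall n i, Fval F n i = wcode n i) -> Succeeds M X ->
  forall n, OMem X F n.
Proof.
move=> HF HV HS n; have [k [q [Hq [_ Lq]]]] := HS (exp2 n * c).
exists (rstr X k), k; apply/(proj2 (ostage_spec _ _ (proj1 HF))); exists (rstr X k); split; first by nlin.
rewrite HV; apply/(proj2 (wcode_spec _ _)); split=> //; split.
  exists k; split; last exact: rstr_string.
  by have := string_le (rstr_string X k) => *; nlin.
by rewrite /Mval; have <- : q = Mcode (rstr X k) by apply/McodeE; left.
Qed.
End Test.

(** The denominator is at least 1, so the value is at most the positive part of the numerator; the
    added 1 makes the bound positive. *)
Lemma bound_exists : exists c, n1 <= c /\ (Mval eps <= emb c)%R.
Proof.
exists (rnum (Mcode eps) + n1); split; first by nlin.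
have dp := emb_pos (rden_pos (Mcode eps)).
have d1 : (1 <= emb (rden (Mcode eps)))%R.
  by have /lt_iff := rden_pos (Mcode eps); rewrite emb0 add0r.
rewrite /Mval /ratv /rv ler_pdivrMr // embD emb1.
have a0 := emb_ge0 (rnum (Mcode eps)); have b0 := emb_ge0 (rneg (Mcode eps)).
by nra.
Qed.
End Martingale.

Lemma computably_random_of_one (R : rca0) (X Z : sets R) : OneRandom X Z -> ComputablyRandom X Z.
Proof.
move=> H M HM TM HS; have [c [c1 cM]] := bound_exists M.
have [F [HF HV]] := test_exists HM c1 TM.
exact: (H F (test_small HM c1 cM HF HV) (test_captures HM c1 HF HV HS)).
Qed.

(** * Schnorr randomness *)

Section SchnorrTests.
Variable R : rca0.
Notation N := (dom R).
Notation K := (rfield R).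
Notation env := (nat -> N).
Notation any := (@anyset R).
Implicit Types (X Z F : sets R) (B s l L n i m k c x y t q w : N).

Lemma nle_trans y x z : x <= y -> y <= z -> x <= z.
Proof. by move=> H H'; nlin. Qed.

(** At level [a + w] the measure [2^-a] amounts to [2^w] strings. *)
Lemma mu_le_cnt B L a w : AllStr B -> Lens B L -> L = a + w -> (mu B <= half a)%R ->
  cnt (Cov B) L <= exp2 w.
Proof.
move=> HB HL EL; rewrite (mu_cnt HB HL) => H; apply/le_iff.
have := ler_wpM2r (emb_ge0 (exp2 L)) H; rewrite -mulrA halfK mulr1.
by rewrite EL exp2_add embM mulrA halfK mul1r.
Qed.

Lemma mu_diff_cnt B B' L a w : AllStr B -> AllStr B' -> Lens B L -> Lens B' L -> L = a + w ->
  (mu B' <= mu B + half a)%R -> cnt (Cov B') L <= cnt (Cov B) L + exp2 w.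
Proof.
move=> HB HB' HL HL' EL; rewrite (mu_cnt HB HL) (mu_cnt HB' HL') => H; apply/le_iff.
have := ler_wpM2r (emb_ge0 (exp2 L)) H; rewrite mulrDl -!mulrA halfK !mulr1 embD.
by rewrite {3}EL exp2_add embM mulrA halfK mul1r.
Qed.

(** The newly covered extensions of [s] are among all newly covered strings. Either inclusion is
    allowed, since two stages will be compared without knowledge of which is later. *)
Lemma cnt_Prefix_Cov_diff B B' s L w : (forall t, Cov B t -> Cov B' t) \/ (forall t, Cov B' t -> Cov B t) ->
  cnt (Cov B') L <= cnt (Cov B) L + w ->
  cnt (fun t => Prefix s t /\ Cov B' t) L <= cnt (fun t => Prefix s t /\ Cov B t) L + w.
Proof.
case=> S H; last first.
  apply: (@nle_trans (cnt (fun t => Prefix s t /\ Cov B t) L)); last exact: le_addr.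
  apply: cnt_le; try by df.
  by move=> t _ [P /S].
pose D t := Cov B' t /\ ~ Cov B t.
have DD : Del any (fun e => D (e 0)) by rewrite /D; df.
have E : cnt (Cov B') L = cnt (Cov B) L + cnt D L.
  rewrite -cnt_disj; [|by df|by df|by move=> t _ C [_]].
  apply: cnt_ext; try by df.
  move=> t _; split=> [C|[/S //|[] //]].
  by case: (classic (Cov B t)); [left|right].
have H' : cnt (fun t => Prefix s t /\ Cov B' t) L <= cnt (fun t => Prefix s t /\ Cov B t) L + cnt D L.
  rewrite -cnt_disj; [|by df|by df|by move=> t _ [_ C] [_]].
  apply: cnt_le; try by df.
  move=> t _ [P C]; by case: (classic (Cov B t)); [left|right].
by rewrite E in H; nlin.
Qed.

Lemma Sum_exp2 l : Sum (@exp2 R) l + n1 = exp2 l.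
Proof.
have Fe : Fn any (fun e => exp2 (e 0)) by df.
move: l; apply: (@sig_ind R any); first by df.
  by rewrite Sum0 // exp2_0; nlin.
by move=> l IH; rewrite SumS // exp2_S -IH; nring.
Qed.

(** * The supermartingale of a Schnorr test *)

Section Capital.
Variables Z F M : sets R.
Hypothesis HF : OpenSeq Z F.
Hypothesis HM : RealSeq M.
Hypothesis HE : forall n, MeasEq F n M.

Definition approx n k : K := ratv (Fval M n k).
(** A decidable condition that holds from some stage on. One [half k] is the precision of the limit,
    the other two come from the comparison of reals with rationals. *)
Definition settled n k t : Prop := (approx n k <= mu (ostage F n t) + (half k + half k + half k))%R.

Lemma stage_mu_mono n t t' : t <= t' -> (mu (ostage F n t) <= mu (ostage F n t'))%R.
Proof.
move=> L; apply: mu_mono; [exact: ostage_str HF|exact: ostage_str HF|].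
by move=> s; apply: ostage_mono L; case: HF.
Qed.

Lemma approx_mem n k : mmem (pr (pr n k) (Fval M n k)) M.
Proof. by apply/(FvalE _ _ _ (proj1 HM)). Qed.

Lemma settled_ex n k : exists t, settled n k t.
Proof.
have [m0 /(_ m0)] := HE n k; rewrite /nle => H; have [|H1 _] := H; first by move=> L; nlin.
exists m0; have [_] := H1 k _ (approx_mem n k); rewrite /settled /approx; lra.
Qed.

Lemma settled_mono n k t t' : t <= t' -> settled n k t -> settled n k t'.
Proof. by rewrite /settled => /(stage_mu_mono n); lra. Qed.

(** The approximation is within [3 * 2^-k] above the stage [t] and within [3 * 2^-k] below late
    stages; for [k = l + 3] the sum of these errors is less than [2^-l]. *)
Lemma settled_small n l m t : settled n (l + n1 + n1 + n1) t ->
  (mu (ostage F n m) <= mu (ostage F n t) + half l)%R.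
Proof.
rewrite /settled; set k := l + n1 + n1 + n1 => H; have [m0 /(_ (m0 + m) (@le_addr R _ _)) [_ H2]] := HE n k.
have [_] := H2 k _ (approx_mem n k); rewrite -/(approx n k).
have : (mu (ostage F n m) <= mu (ostage F n (m0 + m)))%R by apply: stage_mu_mono; nlin.
have : half k = (half l / 2 / 2 / 2)%R by rewrite /k !half_S.
have := half_pos l; lra.
Qed.

(* The component [U_(3n+2)] gets weight [2^n] in the martingale. *)
Definition comp n : N := n + n + n + n2.
(** The condition [l <= t] makes the stages unbounded, so that every enumerated string is seen at
    some level; the precision limits the later growth of each component to [2^-(3l+2)]. *)
Definition good l t : Prop := l <= t /\ forall n, n < l -> settled (comp n) (comp l + n1 + n1 + n1) t.
Definition time l : N := epsilon (inhabits n0) (fun t => good l t /\ forall y, y < t -> ~ good l y).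

Lemma Del_good OK f g : OK F -> OK M -> Fn OK f -> Fn OK g -> Del OK (fun e : env => good (f e) (g e)).
Proof.
move=> OF OM Hf Hg; apply: (Del_app2 (P := good)) => //; have HD := proj1 HF; have HD' := proj1 HM.
by rewrite /good /settled /approx /comp; df.
Qed.

(** Collection yields one stage at which all [n < l] are settled, by monotonicity; taking the least
    such stage gives [time] a definable graph. *)
Lemma time_least l : good l (time l) /\ forall y, y < time l -> ~ good l y.
Proof.
apply: (epsilon_spec (inhabits n0) (fun t => good l t /\ forall y, y < t -> ~ good l y)).
have [||w Hw] := @sig_collection R any (fun n t => settled (comp n) (comp l + n1 + n1 + n1) t) l.
- have HD := proj1 HF; have HD' := proj1 HM; apply: Sig_Del; rewrite /settled /approx /comp; df.
- by move=> n _; apply: settled_ex.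
have G : good l (w + l).
  split=> [|n /Hw [y [L H]]]; first by nlin.
  by apply: settled_mono H; nlin.
have [|t [_ H]] := @least R any (good l) (w + l) _ G; last by exists t.
by apply/Sig_Del/Del_not/Del_good; df.
Qed.

Lemma Fn_time OK f : OK F -> OK M -> Fn OK f -> Fn OK (fun e : env => time (f e)).
Proof.
move=> OF OM Hf; apply: (Fn_app1 (F := time)) => //.
have G := fun f g => @Del_good OK f g OF OM.
apply: (@Sig_ext _ _ (fun e => good (e 1) (e 0) /\ forall y, y < e 0 -> ~ good (e 1) y)).
  by apply: Sig_Del; df; apply: G; df.
move=> e; have [G1 G2] := time_least (e 1); split=> [->|[H1 H2]] //.
apply: nle_anti => L; first by apply: H2 G1.
by apply: G2 H1.
Qed.

Definition block n l : N := ostage F (comp n) (time l).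

Lemma Fn_block OK f g : OK F -> OK M -> Fn OK f -> Fn OK g -> Fn OK (fun e : env => block (f e) (g e)).
Proof.
move=> OF OM Hf Hg; have HD := proj1 HF; have HT := @Fn_time OK (fun e => e 0) OF OM (@Fn_var _ _ 0).
by rewrite /block /comp; df.
Qed.

Lemma Fn_block_any : Fn any (fun e => block (e 0) (e 1)).
Proof. by apply: Fn_block; df. Qed.

Definition span l : N := Sum (fun n => block n l) l.
(** [span l] bounds the lengths of the strings in all blocks, so counts at this level are exact. The
    part [l + l] makes the reserve [4^-l] a whole number [exp2 (span l)] of units. *)
Definition level l : N := l + l + span l.
Definition bet l s L : N := Sum (fun n => exp2 n * cnt (fun t => Prefix s t /\ Cov (block n l) t) L) l.

Lemma Fn_bet OK f g h : OK F -> OK M -> Fn OK f -> Fn OK g -> Fn OK h ->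
  Fn OK (fun e : env => bet (f e) (g e) (h e)).
Proof.
move=> OF OM Hf Hg Hh; apply: (Fn_app3 (F := bet)) => //.
by have HB := @Fn_block OK (fun e => e 0) (fun e => e 1) OF OM (@Fn_var _ _ 0) (@Fn_var _ _ 1); rewrite /bet; df.
Qed.

Lemma Fn_span OK f : OK F -> OK M -> Fn OK f -> Fn OK (fun e : env => span (f e)).
Proof.
move=> OF OM Hf; apply: (Fn_app1 (F := span)) => //.
by have HB := @Fn_block OK (fun e => e 0) (fun e => e 1) OF OM (@Fn_var _ _ 0) (@Fn_var _ _ 1); rewrite /span; df.
Qed.

Lemma block_str n l : AllStr (block n l).
Proof. exact: ostage_str HF. Qed.

Lemma block_lens n l L : n < l -> level l <= L -> Lens (block n l) L.
Proof.
move=> Ln LL s k Hs Hk; have HB := Fn_block_any.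
have := @Sum_ge R (fun n => block n l) ltac:(by df) n l Ln; rewrite -/(span l) => H.
by have := @Lens_code R _ s k Hs Hk; rewrite /level in LL => H'; nlin.
Qed.

Lemma bet_scale l s L k : IsString s l -> level l <= L -> bet l s (L + k) = exp2 k * bet l s L.
Proof.
move=> Hs LL; have HB := Fn_block_any; rewrite /bet -Sum_scale; last by df.
apply: Sum_ext; [by df|by df|].
move=> n Ln; rewrite cnt_scale; [by nring|by df|].
move=> t j a Ht Lj.
have P : Prefix s (snoc t a) <-> Prefix s t.
  by apply: prefix_snocE Hs Ht _; rewrite /level in LL; nlin.
have C : Cov (block n l) (snoc t a) <-> Cov (block n l) t.
  apply: (@Cov_snoc R _ L) Ht Lj; [exact: block_str|exact: block_lens].
by rewrite P C.
Qed.

Definition betv l s : K := (emb (bet l s (level l)) * half (level l))%R.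

(** Freedom in the level allows the values at lengths [l] and [l + n1] to be compared at a common
    one. *)
Lemma betv_eq l s L : IsString s l -> level l <= L -> (emb (bet l s L) * half L = betv l s)%R.
Proof.
move=> Hs /(@sub_ex R) [k ->]; rewrite bet_scale //; last by nlin.
rewrite embM half_add /betv.
transitivity (emb (bet l s (level l)) * half (level l) * (half k * emb (exp2 k)))%R; first by ring.
by rewrite halfK mulr1.
Qed.

Hypothesis Hmu : forall n m, (mu (ostage F n m) <= half n)%R.

(** In units of [2^-L] the new summand costs at most [2^l 2^w], and the growth of the older ones,
    with weights [2^n] for [n < l], at most [(2^l - 1) 2^w]. *)
Lemma bet_split l s L w : IsString s l -> level l <= L -> level (l + n1) <= L -> L = comp l + w ->
  bet (l + n1) (snoc s n0) L + bet (l + n1) (snoc s n1) L <= bet l s L + exp2 (l + n1) * exp2 w.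
Proof.
move=> Hs L1 L2 EL; have HB := Fn_block_any.
have LL : l < L by rewrite EL /comp; nlin.
pose A n := cnt (fun t => Prefix s t /\ Cov (block n (l + n1)) t) L.
pose C n := cnt (fun t => Prefix s t /\ Cov (block n l) t) L.
have FA : Fn any (fun e => A (e 0)) by rewrite /A; df.
have FC : Fn any (fun e => C (e 0)) by rewrite /C; df.
have -> : bet (l + n1) (snoc s n0) L + bet (l + n1) (snoc s n1) L = Sum (fun n => exp2 n * A n) (l + n1).
  rewrite /bet -Sum_D; [|by df|by df]; apply: Sum_ext; [by df|by df|].
  by move=> n Ln; rewrite /A (cnt_Prefix_Cov_split _ Hs LL); nring.
rewrite SumS; last by df.
have Al : A l <= exp2 w.
  have Ll : l < l + n1 by nlin.
  apply: (@nle_trans (cnt (Cov (block l (l + n1))) L)); last first.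
    by apply: (mu_le_cnt (a := comp l)) => //; [exact: block_str|exact: block_lens|exact: Hmu].
  by apply: cnt_le; try df; move=> t _ [].
have An n : n < l -> A n <= C n + exp2 w.
  move=> Ln; have Ln' : n < l + n1 by nlin.
  apply: cnt_Prefix_Cov_diff.
    (* Whichever of the two stages is later, one block contains the other. *)
    have HD := proj1 HF; case: (classic (time l <= time (l + n1))) => T; [left|right];
      move=> t /CovE [r [Hr P]]; apply/CovE; exists r; split=> //; apply: ostage_mono Hr => //.
    by nlin.
  apply: (mu_diff_cnt (a := comp l)) => //; [exact: block_str|exact: block_str| | |].
  - exact: block_lens.
  - exact: block_lens.
  - apply: settled_small; have [[_ H] _] := time_least l; exact: H.
have H1 : Sum (fun n => exp2 n * A n) l <= Sum (fun n => exp2 n * C n + exp2 w * exp2 n) l.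
  apply: Sum_le; [by df|by df|]; move=> n Ln; have := An n Ln; have := exp2_pos n => *; nnlin.
rewrite Sum_D in H1; [|by df|by df].
rewrite Sum_scale in H1; last by df.
rewrite -/(bet l s L) in H1.
have H2 : Sum (fun n => exp2 n) l + n1 = exp2 l := Sum_exp2 l.
have H3 : exp2 l * A l <= exp2 l * exp2 w by have := exp2_pos l => *; nnlin.
have H4 : exp2 w * Sum (fun n => exp2 n) l <= exp2 l * exp2 w.
  by rewrite -H2; have := exp2_pos w => *; nlin.
by rewrite exp2_S; nlin.
Qed.

Definition capital l s : K := (emb (exp2 l) * (betv l s + half (l + l)))%R.

(** Half of the reserve [4^-l] covers the error [2^-(2l+1)], and the other half provides the
    reserves [4^-(l+1)] of the two extensions. *)
Lemma capital_snoc l s : IsString s l ->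
  (capital (l + n1) (snoc s n0) + capital (l + n1) (snoc s n1) <= capital l s + capital l s)%R.
Proof.
move=> Hs; pose L := comp l + (level l + level (l + n1)).
have L1 : level l <= L by rewrite /L; nlin.
have L2 : level (l + n1) <= L by rewrite /L; nlin.
have := bet_split Hs L1 L2 erefl => /le_iff; rewrite !embD => H.
have := ler_wpM2r (ltW (half_pos L)) H; rewrite !mulrDl !betv_eq //; try exact: snoc_string.
have -> : (emb (exp2 (l + n1) * exp2 (level l + level (l + n1))) * half L = half (l + l + n1))%R.
  rewrite /L half_add embM.
  (* The factor [2^(l+1)] of the error cancels against the first part of the exponent [3l+2] and
     leaves [2^-(2l+1)]. *)
  have -> : comp l = l + n1 + (l + l + n1) by rewrite /comp; nring.
  rewrite half_add; set a := emb (exp2 (l + n1)); set b := emb (exp2 (level l + _)).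
  transitivity ((half (l + n1) * a) * (half (level l + level (l + n1)) * b) * half (l + l + n1))%R; first by ring.
  by rewrite !halfK !mul1r.
move=> {}H; rewrite /capital exp2_S embM embD emb1.
have E1 := half_S (l + l).
have E2 : half (l + n1 + (l + n1)) = (half (l + l) / 2 / 2)%R.
  by rewrite -!half_S; congr half; nring.
have := emb_exp2_pos l; rewrite E2; rewrite E1 in H; set e := emb (exp2 l) => e0.
nra.
Qed.

(** The value over the common denominator [2^level], where the reserve [4^-l] has numerator
    [exp2 (span l)]. *)
Definition capital_code s : N :=
  pr (pr (exp2 (len s) * (bet (len s) s (level (len s)) + exp2 (span (len s)))) n0) (exp2 (level (len s))).

Lemma capital_codeE s l : IsString s l -> RatCode (capital_code s) /\ ratv (capital_code s) = capital l s.
Proof.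
move=> Hs; rewrite /capital_code (len_eq Hs); have P := exp2_pos (level l); split.
  by apply/RatCodeE; eexists _, _, _; split; last reflexivity.
rewrite ratv_pr // /rv emb0 subr0 /capital /betv embM embD -/(half (level l)) -mulrA mulrDl.
congr (_ * (_ + _))%R; rewrite /level half_add mulrCA.
by rewrite [(emb _ * _)%R]mulrC halfK mulr1.
Qed.

Lemma capital_ge0 l s : (0 <= capital l s)%R.
Proof.
by rewrite /capital /betv mulr_ge0 ?addr_ge0 ?mulr_ge0 ?emb_ge0 // ltW ?half_pos.
Qed.

Lemma supermartingale_exists : TLe Z M -> exists S, Supermartingale S /\ TLe Z S /\
  forall z, mmem z S <-> exists s l, IsString s l /\ z = pr s (capital_code s).
Proof.
move=> TM; pose P z := exists s, s < z + n1 /\ exists l, l < z + n1 /\ (IsString s l /\ z = pr s (capital_code s)).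
have DP OK : OK F -> OK M -> Del OK (fun e => P (e 0)).
  move=> OF OM; have H1 := fun f => @Fn_span OK f OF OM; have H2 := fun f g h => @Fn_bet OK f g h OF OM.
  by rewrite /P /capital_code /level; df; try apply: H2; df; apply: H1; df.
have [|S HS] := @del_comp R any P; first exact: DP.
have HS' z : mmem z S <-> exists s l, IsString s l /\ z = pr s (capital_code s).
  rewrite HS; split=> [[s [_ [l [_ H]]]]|[s [l [Hl ->]]]]; first by exists s, l.
  have L1 := @pr_lel R s (capital_code s); have L2 := string_le Hl.
  exists s; split; first by nlin.
  by exists l; split; first by nlin.
exists S; split; last split=> //.
  split=> [z /HS' [s [l [Hs ->]]]|].
    exists s, (capital_code s); split=> //; split; first by exists l.
    by have [H1 H2] := capital_codeE Hs; split=> //; rewrite H2 capital_ge0.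
  have SE s q : mmem (pr s q) S -> q = capital_code s.
    by move/HS' => [s' [l [_ /pr_inj [-> ->]]]].
  split=> [s [l Hs]|s s0 s1 q q0 q1 H0 H1 /SE -> /SE -> /SE ->].
    by exists (capital_code s); split=> [|q /SE //]; apply/HS'; exists s, l.
  have [l [Hs _]] := H0.
  have -> : s0 = snoc s n0 by apply/(IsSnocE _ Hs) => //; left.
  have -> : s1 = snoc s n1 by apply/(IsSnocE _ Hs) => //; right.
  have [A1 A2] := capital_codeE Hs; have [B1 B2] := capital_codeE (snoc_string n0 Hs).
  have [C1 C2] := capital_codeE (snoc_string n1 Hs).
  by split=> //; split=> //; split=> //; rewrite A2 B2 C2; apply: capital_snoc.
apply: (TLe_Del (OK := TLe Z) (P := P)) => //; apply: DP => //.
by case: HF => _ [].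
Qed.

Lemma capital_large X : (forall n, OMem X F n) -> forall k, exists l,
  (emb k < capital l (rstr X l))%R.
Proof.
(* With [l > k] the summand [k] is present, with [l >= m] the stage of level [l] already contains
   the string, and with [l >= l0] the prefix of [X] of length [l] extends it. That summand alone
   contributes [2^k]. *)
move=> H k; have [m [l0 Hl0]] := H (comp k); pose l := l0 + m + k + n1; exists l.
have HB := Fn_block_any; have Hs := rstr_string X l.
have Hk : exp2 k * exp2 (l + span l) <= bet l (rstr X l) (level l).
  have Lk : k < l by rewrite /l; nlin.
  apply: (@nle_trans (exp2 k * cnt (fun t => Prefix (rstr X l) t /\ Cov (block k l) t) (level l))); last first.
    by apply: (@Sum_ge R (fun n => exp2 n * cnt (fun t => Prefix (rstr X l) t /\ Cov (block n l) t) (level l)) _ k l Lk); df.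
  rewrite -(cnt_prefix (l + span l) Hs).
  have -> : l + (l + span l) = level l by rewrite /level; nring.
  suff : cnt (Prefix (rstr X l)) (level l) <=
      cnt (fun t => Prefix (rstr X l) t /\ Cov (block k l) t) (level l).
    by have := exp2_pos k => *; nnlin.
  apply: cnt_le; try by df.
  move=> t _ P; split=> //; apply/CovE; exists (rstr X l0); split.
    apply: ostage_mono Hl0; first by case: HF.
    by have [[T _] _] := time_least l; rewrite /l in T *; nlin.
  by apply: prefix_trans P; apply: rstr_prefix; rewrite /l; nlin.
move/le_iff: Hk; rewrite embM => Hk.
have := ler_wpM2r (ltW (half_pos (level l))) Hk; rewrite -/(betv _ _).
have -> : level l = l + (l + span l) by rewrite /level; nring.
rewrite half_add -!mulrA [(emb (exp2 (l + _)) * _)%R]mulrC -mulrA halfK mulr1 => {}Hk.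
have := ler_wpM2l (emb_ge0 (exp2 l)) Hk.
rewrite mulrCA [(emb (exp2 l) * half l)%R]mulrC halfK mulr1 => {}Hk.
have : (emb k < emb (exp2 k))%R by apply/lt_emb/exp2_gt.
rewrite /capital mulrDr.
have : (0 <= emb (exp2 l) * half (l + l))%R by rewrite mulr_ge0 ?emb_ge0 // ltW // half_pos.
move: Hk; lra.
Qed.
End Capital.

Lemma schnorr_random_of_computable X Z : ComputablyRandom X Z -> SchnorrRandom X Z.
Proof.
move=> H F [[HF Hmu] [M [HM [TM HE]]]] HX.
have [S [HS [TS SE]]] := supermartingale_exists HF HM HE Hmu TM.
apply: (H S HS TS) => k; have [l Hl] := capital_large HF HM HE HX k.
have [A1 A2] := capital_codeE F M (rstr_string X l).
exists l, (capital_code F M (rstr X l)); split; first by apply/SE; exists (rstr X l), l; split=> //; apply: rstr_string.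
by split=> //; rewrite A2.
Qed.
End SchnorrTests.

(** * Derivability in RCA0 *)

Lemma universal_closure_closed p :
  boundN (universal_closure p) = 0 /\ boundS (universal_closure p) = 0.
Proof.
have NN k q : boundN (Nat.iter k fallN q) = Nat.sub (boundN q) k.
  elim: k => [|k IH]; first by rewrite /= Nat.sub_0_r.
  by change (Nat.pred (boundN (Nat.iter k fallN q)) = Nat.sub (boundN q) (S k)); lia.
have SN k q : boundS (Nat.iter k fallN q) = boundS q by elim: k.
have NS k q : boundN (Nat.iter k fallS q) = boundN q by elim: k.
have SS k q : boundS (Nat.iter k fallS q) = Nat.sub (boundS q) k.
  elim: k => [|k IH]; first by rewrite /= Nat.sub_0_r.
  by change (Nat.pred (boundS (Nat.iter k fallS q)) = Nat.sub (boundS q) (S k)); lia.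
by rewrite /universal_closure NN SN NS SS; lia.
Qed.

Lemma RCA0_closed q : RCA0 q -> boundN q = 0 /\ boundS q = 0.
Proof.
case=> [p Hp|p _|p r _ _]; try exact: universal_closure_closed.
by repeat (case: Hp => [<-|Hp]; first by vm_compute); case: Hp.
Qed.

Lemma RCA0_proves_of_models (p : sentence) : boundN (db p) = 0 /\ boundS (db p) = 0 ->
  (forall (R : rca0) rho sig, @sat R rho sig (db p)) -> RCA0_proves p.
Proof.
move=> [HN HS] H; apply: completeness => //; first exact: RCA0_closed.
(* The value [sig 0] supplies a set, needed as a default when set constants are numbered. *)
move=> M HM rho sig; have [R E] := rca0_of_model HM (sig 0).
by subst M; apply: H.
Qed.

Lemma sem_random_existence (R : rca0) (P : sets R -> sets R -> pform (dom R) (sets R))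
  (Q : sets R -> sets R -> Prop) : (forall X Z, sem (P X Z) <-> Q X Z) ->
  (sem (random_existence P) <-> forall Z, exists X, Q X Z).
Proof. by move=> H; eapply sem_allS => Z; eapply sem_exS => X; apply: H. Qed.

Theorem proposition5p3 :
  (RCA0_proves (fun N S => ∀² X Z, two_random X Z ⟹ weakly_two_random X Z)%l2 /\
   RCA0_proves (fun N S => MLR2 ⟹ W2R)%l2) /\
  (RCA0_proves (fun N S => ∀² X Z, weakly_two_random X Z ⟹ one_random X Z)%l2 /\
   RCA0_proves (fun N S => W2R ⟹ MLR)%l2) /\
  (RCA0_proves (fun N S => ∀² X Z, one_random X Z ⟹ computably_random X Z)%l2 /\
   RCA0_proves (fun N S => MLR ⟹ CR)%l2) /\
  (RCA0_proves (fun N S => ∀² X Z, computably_random X Z ⟹ schnorr_random X Z)%l2 /\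
   RCA0_proves (fun N S => CR ⟹ SR)%l2).
Proof.
(* That the sentences are closed is checked by computation; each [change] then uses that
   satisfaction of the translation is convertible to [sem]. *)
split; [|split; [|split]]; split; (apply: RCA0_proves_of_models; first by vm_compute) => R rho sig.
- change (sem (∀² X Z, two_random X Z ⟹ weakly_two_random X Z : pform (dom R) (sets R))%l2).
  move=> X Z /sem_two_random H; exact/sem_weakly_two_random/weak_of_two_random.
- change (sem (MLR2 ⟹ W2R : pform (dom R) (sets R))%l2).
  move=> /(sem_random_existence (@sem_two_random R)) H.
  apply/(sem_random_existence (@sem_weakly_two_random R)) => Z.
  have [X HX] := H Z; exists X; exact: weak_of_two_random.
- change (sem (∀² X Z, weakly_two_random X Z ⟹ one_random X Z : pform (dom R) (sets R))%l2).
  move=> X Z /sem_weakly_two_random H; exact/sem_one_random/one_random_of_weak.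
- change (sem (W2R ⟹ MLR : pform (dom R) (sets R))%l2).
  move=> /(sem_random_existence (@sem_weakly_two_random R)) H.
  apply/(sem_random_existence (@sem_one_random R)) => Z.
  have [X HX] := H Z; exists X; exact: one_random_of_weak.
- change (sem (∀² X Z, one_random X Z ⟹ computably_random X Z : pform (dom R) (sets R))%l2).
  move=> X Z /sem_one_random H; exact/sem_computably_random/computably_random_of_one.
- change (sem (MLR ⟹ CR : pform (dom R) (sets R))%l2).
  move=> /(sem_random_existence (@sem_one_random R)) H.
  apply/(sem_random_existence (@sem_computably_random R)) => Z.
  have [X HX] := H Z; exists X; exact: computably_random_of_one.
- change (sem (∀² X Z, computably_random X Z ⟹ schnorr_random X Z : pform (dom R) (sets R))%l2).
  move=> X Z /sem_computably_random H; exact/sem_schnorr_random/schnorr_random_of_computable.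
- change (sem (CR ⟹ SR : pform (dom R) (sets R))%l2).
  move=> /(sem_random_existence (@sem_computably_random R)) H.
  apply/(sem_random_existence (@sem_schnorr_random R)) => Z.
  have [X HX] := H Z; exists X; exact: schnorr_random_of_computable.
Qed.
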